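(* Let $n\ge 1$ be an integer, $0<s<1$, $x_0\in\mathbb R^n$ and $R>0$. Consider the non-homogeneous Dirichlet problem $$\begin{cases}(-\Delta)^s u=1 & \text{in } B(x_0,R),\\ u=0 & \text{in }\mathbb R^n\setminus B(x_0,R).\end{cases}$$ Then its unique solution is $$u(x)=\frac{\Gamma\left(\frac n2\right)}{4^s\,\Gamma\left(\frac{n+2s}{2}\right)\Gamma(s+1)}\left(R^2-|x-x_0|^2\right)_+^s .$$
   Context: $B(x_0,R)=\{x\in\mathbb R^n: |x-x_0|<R\}$ and $t_+^s=(\max\{t,0\})^s$. A solution is a function $u\in C(\mathbb R^n)$ with $\int_{\mathbb R^n}\frac{|u(x)|}{1+|x|^{n+2s}}dx<\infty$, which for some $\varepsilon\in(0,1)$ (sufficiently small) is locally of class $C^{2s+\varepsilon}$ in $B(x_0,R)$ (meaning $C^{0,2s+\varepsilon}_{loc}$ if $0<s<\frac12$ and $C^{1,2s+\varepsilon-1}_{loc}$ if $\frac12\le s<1$), and which satisfies both conditions pointwise, where $$(-\Delta)^s u(x)=\frac{\gamma(n,s)}{2}\int_{\mathbb R^n}\frac{2u(x)-u(x+y)-u(x-y)}{|y|^{n+2s}}\,dy,\qquad \gamma(n,s)=\frac{s\,2^{2s}\,\Gamma\left(\frac{n+2s}{2}\right)}{\pi^{n/2}\,\Gamma(1-s)}.$$ *)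

(* Defs.v *)
From HB Require Import structures.
From mathcomp Require Import all_boot all_order all_algebra.
From mathcomp Require Import all_classical all_reals all_analysis.

Set Implicit Arguments.
Unset Strict Implicit.
Unset Printing Implicit Defensive.

Import Order.TTheory GRing.Theory Num.Theory numFieldNormedType.Exports.

Local Open Scope classical_set_scope.
Local Open Scope ring_scope.

Section lebesgue_cons.
Context (R : realType) (n : nat).
Variable m : {sigma_finite_measure set (n.-tuple (measurableTypeR R)) -> \bar R}.

Definition tcons (p : measurableTypeR R * n.-tuple (measurableTypeR R)) :
  n.+1.-tuple (measurableTypeR R) := [tuple of p.1 :: p.2].

Lemma measurable_tcons : measurable_fun setT tcons.
Proof. exact: measurable_cons. Qed.

Definition lebesgue_cons : set (n.+1.-tuple (measurableTypeR R)) -> \bar R :=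
  pushforward (@lebesgue_measure R \x m)%E tcons.

Let preimage_tcons A : measurable A -> measurable (tcons @^-1` A).
Proof.
by move=> mA; rewrite -[X in measurable X]setTI; exact: measurable_tcons.
Qed.

Let lebesgue_cons0 : lebesgue_cons set0 = 0%E.
Proof. by rewrite /lebesgue_cons /pushforward preimage_set0 measure0. Qed.

Let lebesgue_cons_ge0 A : (0 <= lebesgue_cons A)%E.
Proof. by rewrite /lebesgue_cons /pushforward measure_ge0. Qed.

Let lebesgue_cons_sigma_additive : semi_sigma_additive lebesgue_cons.
Proof.
move=> F mF tF mUF; rewrite /lebesgue_cons /pushforward preimage_bigcup.
apply: measure_semi_sigma_additive.
- by move=> i; exact: preimage_tcons.
- apply/trivIsetP => /= i j _ _ ij; rewrite -preimage_setI.
  by move/trivIsetP : tF => /(_ _ _ _ _ ij) ->//; rewrite preimage_set0.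
- by rewrite -preimage_bigcup; exact: preimage_tcons.
Qed.

HB.instance Definition _ := isMeasure.Build _ _ _ lebesgue_cons
  lebesgue_cons0 lebesgue_cons_ge0 lebesgue_cons_sigma_additive.

Let lebesgue_cons_sigma_finite : sigma_finite setT lebesgue_cons.
Proof.
pose h (t : n.+1.-tuple (measurableTypeR R)) := (thead t, [tuple of behead t]).
have mh : measurable_fun setT h.
  apply/measurable_fun_pairP; split; first exact: (measurable_tnth ord0).
  exact: measurable_behead.
have tconsK : cancel tcons h by case=> a t; congr pair; exact/val_inj.
have [F FT Foo] : sigma_finite setT (@lebesgue_measure R \x m)%E.
  have /sigma_finiteP[F [TF ndF Foo]] := sigma_finiteT (@lebesgue_measure R).
  have /sigma_finiteP[G [TG ndG Goo]] := sigma_finiteT m.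
  exists (fun k => F k `*` G k).
    rewrite -setXTT TF TG predeqE => -[x y]; split; last first.
      by move=> [k _ []/= ? ?]; split; exists k.
    move=> [/= [k _ Fkx] [l _ Gly]]; exists (maxn k l) => //; split.
    - by move: x Fkx; exact/subsetPset/ndF/leq_maxl.
    - by move: y Gly; exact/subsetPset/ndG/leq_maxr.
  move=> k; have [? ?] := Foo k; have [? ?] := Goo k.
  split; first exact: measurableX.
  by rewrite product_measure1E// lte_mul_pinfty// ge0_fin_numE.
exists (fun i => h @^-1` F i).
  apply/seteqP; split => // t _.
  have : setT (h t) by [].
  by rewrite FT => -[i _ Fi]; exists i.
move=> i; have [mFi Fioo] := Foo i; split.
  by rewrite -[X in measurable X]setTI; exact: mh.
rewrite /lebesgue_cons /pushforward (_ : _ @^-1` _ = F i)//.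
by apply/seteqP; split => p /=; rewrite tconsK.
Qed.

HB.instance Definition _ :=
  Measure_isSigmaFinite.Build _ _ _ lebesgue_cons lebesgue_cons_sigma_finite.

End lebesgue_cons.

Section lebesgue_tuple.
Context (R : realType).

(* n-fold product of the one-dimensional Lebesgue measure *)
Fixpoint lebesgue_tuple n :
    {sigma_finite_measure set (n.-tuple (measurableTypeR R)) -> \bar R} :=
  if n is n'.+1 then lebesgue_cons (lebesgue_tuple n') else dirac [tuple].

End lebesgue_tuple.

Lemma lebesgue_tuple_box (R : realType) n (A : 'I_n -> set (measurableTypeR R)) :
  (forall i, measurable (A i)) ->
  lebesgue_tuple R n [set t | forall i, A i (tnth t i)] =
  (\prod_(i < n) lebesgue_measure (A i))%E.
Proof.
elim: n => [|n IH] in A * => mA.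
  rewrite big_ord0 /= diracE (_ : _ \in _ = true)//; apply/mem_set => -[].
  by [].
rewrite big_ord_recl -IH// -product_measure1E//=; last first.
  rewrite (_ : [set t | _] = \bigcap_(i in [set: 'I_n])
    ((fun t : n.-tuple (measurableTypeR R) => tnth t i) @^-1` A (lift ord0 i))).
    apply: fin_bigcap_measurable => // i _; rewrite -[X in measurable X]setTI.
    exact: measurable_tnth.
  by apply/seteqP; split => t /= H i; [move=> _|]; exact: H.
rewrite /lebesgue_cons /pushforward; congr (_ _).
apply/seteqP; split => -[a t] /= H.
  split; first exact: (H ord0).
  by move=> i; have := H (lift ord0 i); rewrite tnthS.
case: H => Ha Ht i; case: (unliftP ord0 i) => [j ->|->//].
by rewrite tnthS.
Qed.

Section definitions.
Context (R : realType).

Definition Gamma (z : R) : R :=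
  (\int[lebesgue_measure]_(t in `]0%R, +oo[) (t `^ (z - 1) * expR (- t)))%R.

Context (n : nat).
Implicit Types (x y : 'rV[R]_n) (u f : 'rV[R]_n -> R).

(* the library norm `|x| of 'rV[R]_n is the sup norm *)
Definition enorm x : R := Num.sqrt (\sum_(i < n) x ord0 i ^+ 2).

Definition eball x0 (r : R) : set 'rV[R]_n := [set x | enorm (x - x0) < r].

Definition integral_rV (F : 'rV[R]_n -> \bar R) : \bar R :=
  (\int[lebesgue_tuple R n]_t F (\row_i tnth t i))%E.

Definition fraclap_cst (s : R) : R :=
  s * 2 `^ (2 * s) * Gamma ((n%:R + 2 * s) / 2) /
  (pi `^ (n%:R / 2) * Gamma (1 - s)).

(* Being extended-real valued, [fraclap s u x] is finite only when the integral
   converges (absolutely). *)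
Definition fraclap (s : R) u x : \bar R :=
  ((fraclap_cst s / 2)%:E * integral_rV (fun y =>
    ((2 * u x - u (x + y) - u (x - y)) / enorm y `^ (n%:R + 2 * s))%:E))%E.

Definition loc_holder (a : R) (O : set 'rV[R]_n) f : Prop :=
  forall K, compact K -> K `<=` O -> exists C : R, forall x y, K x -> K y ->
    `|f x - f y| <= C * enorm (x - y) `^ a.

Definition loc_C1_holder (a : R) (O : set 'rV[R]_n) f : Prop :=
  (forall x, O x -> differentiable f x) /\
  forall i : 'I_n, loc_holder a O ('D_(delta_mx ord0 i) f).

Definition loc_regular (s : R) (O : set 'rV[R]_n) f : Prop :=
  exists e : R, [/\ 0 < e, e < 1 &
    if s < 2^-1 then 2 * s + e < 1 /\ loc_holder (2 * s + e) O f
    else 2 * s + e - 1 < 1 /\ loc_C1_holder (2 * s + e - 1) O f].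

Definition dirichlet_solution (s : R) x0 (r : R) u : Prop :=
  [/\ continuous u,
      (integral_rV (fun x => (`|u x| / (1 + enorm x `^ (n%:R + 2 * s)))%:E)
        < +oo)%E,
      loc_regular s (eball x0 r) u,
      forall x, eball x0 r x -> fraclap s u x = 1%:E &
      forall x, ~ eball x0 r x -> u x = 0].

Definition pospow (t a : R) : R := Num.max t 0 `^ a.

End definitions.

(* Main.v *)
Require Import Defs.
From HB Require Import structures.
From mathcomp Require Import all_boot all_order all_algebra.
From mathcomp Require Import ring lra.
From mathcomp Require Import all_classical all_reals all_analysis.
From mathcomp Require Import measurable_realfun.

Import Order.TTheory GRing.Theory Num.Theory numFieldNormedType.Exports.

Local Open Scope classical_set_scope.
Local Open Scope ring_scope.

(* On any line through the ball the solution is, up to scaling, the profile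
   [w y = (1 - y^2)_+^s], so the n-dimensional integral reduces to the identity
     \int_0^oo (2 w x - w (x + t) - w (x - t)) t^(-1-2s) dt = Gamma s * Gamma (1 - s)
   for |x| < 1. There, [w (x + t) t^(-1-2s)] plus the correction
   [x w (x + t) t^(-2s) / (1 - x^2 - 2 x t)] becomes an incomplete Beta integral in
   the variable [(1 - (x + t)^2) / t^2], and the corrections for [x] and [- x]
   cancel by a Moebius involution that fixes [x]. Parametrizing the lines by
   [b (1, z)], the integral over [z] is the area of a hemisphere, computed from the
   Gaussian integral.
   Uniqueness is the maximum principle: at a positive maximum of the difference of
   two solutions the difference of their fractional Laplacians is positive. *)

(** The integral along a line depends neither on the length of the chord cut out by the ball nor on
    the position of [x] on it, only on the speed of the parametrization: this is why the fractional
    Laplacian is constant on the ball. The obstacle is cancellation. Near t = 0 the three terms of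
    the second difference are not separately integrable against t^(-1-2s), so the one-dimensional
    identity is proved for integrals truncated at [e]. Each piece diverges like e^(-2s); the
    divergences recombine into a second difference of [w] at distance [e], and what remains differs
    from the limit by O(e^(2-2s)). In dimension n, Tonelli and the cone decomposition hold for
    nonnegative integrands, so the signed one is first dominated by a multiple of min(1, |y|^2)
    |y|^(-n-2s). The lines b (1, z) fit a measure built as an iterated product: dilating the last
    coordinates and exchanging two integrals is all that the change of variables amounts to. The
    product Gamma s Gamma (1 - s) is never evaluated: Gamma (1 - s) cancels against the constant of
    the operator, and Gamma s against Gamma (s + 1) = s Gamma s. *)

(** A positive real factor distributes even over a difference of infinities, which lets signed
    integrals be rescaled below without any integrability assumption. *)
Lemma gt0_muleBr {R : realDomainType} (r : R) (x y : \bar R) : 0 < r ->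
  (r%:E * (x - y) = r%:E * x - r%:E * y)%E.
Proof.
move=> r0; have r0' : (0 < r%:E)%E by rewrite lte_fin.
by case: x y => [x| |] [y| |] //=;
  rewrite /= ?(gt0_muley, gt0_muleNy) //= -!EFinM -EFinD mulrBr.
Qed.

(** * One-dimensional Lebesgue measure under dilations *)

Section dilation.
Context {R : realType}.
Notation mu := (@lebesgue_measure R).
Local Open Scope ereal_scope.

Let measurable_mulrl (a : R) :
  measurable_fun setT ( *%R a : measurableTypeR R -> measurableTypeR R).
Proof. exact: mulrl_measurable. Qed.

Let dilm (a : R) : {measure set (measurableTypeR R) -> \bar R} :=
  mscale (NngNum (normr_ge0 a))
    (measure_function_pushforward__canonical__measure_function_Measure mu
      (measurable_mulrl a)).

(** By uniqueness of Lebesgue measure only the intervals []x, y]] have to be checked. For negative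
    [a] the preimage is closed at the other end, which does not change its length. *)
Lemma lebesgue_measure_dilation (a : R) (A : set (measurableTypeR R)) : a != 0%R -> measurable A ->
  mu A = `|a|%:E * mu ( *%R a @^-1` A).
Proof.
move=> a0 mA.
transitivity (dilm a A); last by [].
apply: lebesgue_measure_unique => //= _ [[x y]] _ <-.
rewrite /mscale/= /pushforward/=.
have [{}a0|{}a0|aE] := ltgtP a 0%R; last by rewrite aE eqxx in a0.
- rewrite (_ : _ @^-1` _ = `[(y / a)%R, (x / a)%R[%classic); last first.
    apply/seteqP; split => z /=; rewrite !in_itv/= ler_ndivrMr// ltr_ndivlMr//;
    by rewrite ![(z * a)%R]mulrC andbC.
  rewrite !lebesgue_measure_itv/= !lte_fin ltr_ndivlMr// divfK ?lt_eqF//.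
  case: ifPn => [xy|_]; last by rewrite mule0.
  by rewrite -!EFinD -EFinM ltr0_norm//; congr EFin; field; rewrite lt_eqF.
- rewrite (_ : _ @^-1` _ = `](x / a)%R, (y / a)%R]%classic); last first.
    apply/seteqP; split => z /=; rewrite !in_itv/= ltr_pdivrMr// ler_pdivlMr//;
    by rewrite ![(z * a)%R]mulrC.
  rewrite !lebesgue_measure_itv/= !lte_fin ltr_pdivrMr// divfK ?gt_eqF//.
  case: ifPn => [xy|_]; last by rewrite mule0.
  by rewrite -!EFinD -EFinM gtr0_norm//; congr EFin; field; rewrite gt_eqF.
Qed.

Lemma ge0_integral_dilation (a : R) (D : set (measurableTypeR R)) (f : measurableTypeR R -> \bar R) : a != 0%R ->
  measurable D -> measurable_fun D f -> (forall x, D x -> 0 <= f x) ->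
  \int[mu]_(x in D) f x =
  `|a|%:E * \int[mu]_(x in *%R a @^-1` D) f (a * x)%R.
Proof.
move=> a0 mD mf f0.
rewrite (eq_measure_integral (dilm a)); last first.
  by move=> A mA _; exact: lebesgue_measure_dilation.
rewrite ge0_integral_mscale//=; congr (_ * _).
by rewrite (ge0_integral_pushforward (measurable_mulrl a))// => x /set_mem; exact: f0.
Qed.

Lemma integral_dilation (a : R) (D : set (measurableTypeR R)) (f : measurableTypeR R -> \bar R) : a != 0%R ->
  measurable D -> measurable_fun D f ->
  \int[mu]_(x in D) f x =
  `|a|%:E * \int[mu]_(x in *%R a @^-1` D) f (a * x)%R.
Proof.
move=> a0 mD mf.
rewrite integralE [in RHS]integralE.
rewrite (ge0_integral_dilation a D f^\+)//; last exact: measurable_funepos.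
rewrite (ge0_integral_dilation a D f^\-)//; last exact: measurable_funeneg.
rewrite [RHS]gt0_muleBr ?normr_gt0//; congr (_ * _ - _ * _).
- by apply: eq_integral => x _; rewrite !funeposE.
- by apply: eq_integral => x _; rewrite !funenegE.
Qed.

End dilation.

(** * Improper integrals of powers, and Tonelli on subsets *)

Section improper_integrals.
Context {R : realType}.
Notation mu := (@lebesgue_measure R).
Local Open Scope ereal_scope.

Lemma ge0_cvg_integral_itv_oc (f : R -> \bar R) (b : R) : (0 < b)%R ->
  measurable_fun setT f -> (forall x, 0 <= f x) ->
  \int[mu]_(x in `[(b / k.+1%:R)%R, b]) f x @[k --> \oo] -->
  \int[mu]_(x in `]0%R, b]) f x.
Proof.
move=> b0 mf f0.
have -> : `]0%R, b]%classic = \bigcup_k `[(b / k.+1%:R)%R, b]%classic.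
  apply/seteqP; split => [x /=|x [k _]/=]; rewrite !in_itv/=.
    move=> /andP[x0 xb]; exists (Num.truncn (b / x)) => //=; rewrite in_itv/= xb andbT.
    rewrite ler_pdivrMr// mulrC -ler_pdivrMr//.
    by apply/ltW; rewrite truncnS_gt.
  by move=> /andP[bx ->]; rewrite andbT (lt_le_trans _ bx)// divr_gt0.
apply: ge0_nondecreasing_set_cvg_integral => //.
- move=> m n mn; rewrite subsetEset; apply: subset_itvr; rewrite bnd_simp.
  by rewrite ler_pM2l// lef_pV2 ?posrE// ler_nat.
- by move=> i; exact: measurable_funTS.
Qed.

Lemma ge0_cvg_integral_0y (f : R -> \bar R) (a b : R^nat) :
  {homo a : x y / (x <= y)%N >-> (y <= x)%R} -> a @ \oo --> (0%R:R) ->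
  (forall k, 0 < a k)%R ->
  {homo b : x y / (x <= y)%N >-> (x <= y)%R} -> b @ \oo --> +oo%R ->
  measurable_fun setT f -> (forall x, 0 <= f x) ->
  \int[mu]_(x in `[a k, b k]) f x @[k --> \oo] -->
  \int[mu]_(x in `]0%R, +oo[) f x.
Proof.
move=> na a0 apos nb by_ mf f0.
have -> : `]0%R, +oo[%classic = \bigcup_k `[a k, b k]%classic.
  apply/seteqP; split => [x /=|x [k _]/=]; rewrite !in_itv/= ?andbT.
    move=> x0.
    have [N1 _ H1] : \forall k \near \oo, (a k <= x)%R.
      exact: (cvgr_le _ a0).
    have [N2 _ H2] : \forall k \near \oo, (x <= b k)%R.
      by move/cvgryPge : by_; exact.
    exists (maxn N1 N2) => //=; rewrite in_itv/= H1 ?H2//=.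
      by rewrite leq_maxr.
    by rewrite leq_maxl.
  by move=> /andP[ax _]; rewrite (lt_le_trans _ ax).
apply: ge0_nondecreasing_set_cvg_integral => //.
- move=> m n mn; rewrite subsetEset => x /=; rewrite !in_itv/= => /andP[h1 h2].
  by rewrite (le_trans _ h1) ?na//= (le_trans h2)// nb.
- by move=> i; exact: measurable_funTS.
Qed.

Lemma continuous_at_within (f : R -> R) (A : set R) :
  (forall x, A x -> {for x, continuous f}) -> {within A, continuous f}.
Proof.
move=> cf; apply: continuous_in_subspaceT => x /set_mem; exact: cf.
Qed.

Lemma is_derive_continuous_FTC2 (f F : R -> R) (a b : R) : (a < b)%R ->
  (forall x, a <= x <= b -> {for x, continuous f})%R ->
  (forall x, a <= x <= b -> is_derive x 1 F (f x))%R ->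
  \int[mu]_(x in `[a, b]) (f x)%:E = (F b - F a)%:E.
Proof.
move=> ab cf dF; rewrite EFinB (@continuous_FTC2 _ f F)//.
- by apply: continuous_at_within => x /=; rewrite in_itv/=; exact: cf.
- split.
  + move=> x; rewrite in_itv/= => /andP[ax xb].
    by apply: ex_derive; apply: dF; rewrite (ltW ax) ltW.
  + apply: cvg_at_right_filter; apply/differentiable_continuous/derivable1_diffP.
    by apply: ex_derive; apply: dF; rewrite lexx ltW.
  + apply: cvg_at_left_filter; apply/differentiable_continuous/derivable1_diffP.
    by apply: ex_derive; apply: dF; rewrite lexx ltW.
- move=> x; rewrite in_itv/= => /andP[ax xb].
  by rewrite derive1E; apply: derive_val; apply: dF; rewrite (ltW ax) ltW.
Qed.

Lemma continuous_powR (p x : R) : (0 < x)%R -> {for x, continuous (@powR R ^~ p)}.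
Proof.
move=> x0; apply/differentiable_continuous/derivable1_diffP.
by have [] := is_derive1_powR p x0.
Qed.

Lemma continuous_pospow (p : R) : (0 < p)%R -> continuous (@pospow R ^~ p).
Proof.
move=> p0 x; have [x0|x0|->] := ltgtP x 0%R.
- apply/(@cvgrPdist_le _ R) => e e0; near=> y.
  have y0 : (y < 0)%R by near: y; exact: lt_nbhsl.
  by rewrite /pospow (max_r (ltW x0)) (max_r (ltW y0)) subrr normr0 ltW.
- have cx : {for x, continuous (@powR R ^~ p)} by exact: continuous_powR.
  have xE : pospow x p = (x `^ p)%R by rewrite /pospow max_l// ltW.
  rewrite /prop_for /continuous_at xE; apply: cvg_trans cx.
  apply: near_eq_cvg; near=> y.
  have y0 : (0 < y)%R by near: y; exact: lt_nbhsr.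
  by rewrite /pospow max_l// ltW.
(* At 0 the radius e^(1/p) is chosen so that its p-th power is [e]. *)
- apply/(@cvgrPdist_le _ R) => e e0; near=> y.
  rewrite /pospow maxxx powR0 ?gt_eqF// sub0r normrN ger0_norm ?powR_ge0//.
  have -> : (e = (e `^ p^-1) `^ p)%R by rewrite -powRrM mulVf ?gt_eqF// powRr1// ltW.
  apply: ge0_ler_powR; rewrite ?nnegrE ?powR_ge0 ?(ltW p0)// ?le_max ?lexx ?orbT//.
  rewrite ge_max powR_ge0 andbT (le_trans (ler_norm _))//.
  near: y; apply: cvgr0_norm_le; first exact: cvg_id.
  exact: powR_gt0.
Unshelve. all: by end_near. Qed.

(** At 0 the power is controlled on nonnegative bases only, so the limit is read off from [pospow],
    which is continuous everywhere and agrees with the power on the values of [f]. *)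
Lemma cvg_powR0 (p : R) (T : Type) (F : set_system T) (f : T -> R) : Filter F ->
  (0 < p)%R -> (\forall x \near F, 0 <= f x)%R -> f @ F --> (0%R : R) ->
  (f x `^ p)%R @[x --> F] --> (0%R : R).
Proof.
move=> FF p0 f0 cf.
have h : pospow (f x) p @[x --> F] --> pospow 0%R p.
  apply: (@continuous_cvg T R R F FF f (@pospow R ^~ p) 0%R) => //.
  exact: continuous_pospow.
move: h; rewrite {2}/pospow maxxx powR0 ?gt_eqF//; apply: cvg_trans.
apply: near_eq_cvg; near=> y.
by rewrite /pospow max_l//; near: y.
Unshelve. all: by end_near. Qed.

Lemma cvg_powRN_y (p : R) : (0 < p)%R -> (x `^ (- p))%R @[x --> +oo%R] --> (0%R : R).
Proof.
move=> p0.
have h : ((x^-1) `^ p)%R @[x --> +oo%R] --> (0%R : R).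
  apply: cvg_powR0 => //.
    by near=> x; rewrite invr_ge0; near: x; exact: nbhs_pinfty_ge.
  apply/(gtr0_cvgV0 (f := fun x : R => x)).
    by near=> x; near: x; exact: nbhs_pinfty_gt.
  exact: cvg_id.
apply: cvg_trans h; apply: near_eq_cvg; near=> x.
by rewrite -powR_inv1// -powRrM mulN1r.
Unshelve. all: by end_near. Qed.

Lemma is_derive_powR_cst (p x c : R) : (0 < x)%R ->
  is_derive x 1%R (fun y => y `^ p * c)%R (p * x `^ (p - 1) * c)%R.
Proof.
move=> x0; have -> : (fun y : R => y `^ p * c)%R = (c \*: (@powR R ^~ p))%R.
  by apply/funext => y /=; rewrite mulrC.
have H := is_derive1_powR p x0.
by apply: is_derive_eq; rewrite /GRing.scale/= mulrC.
Qed.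

(** The integrand is singular at 0 when p < 1, so the primitive is used on [b/(k+1), b], and
    monotone convergence gives the integral over the half-open interval. *)
Lemma integral_powR_oc (p b : R) : (0 < p)%R -> (0 < b)%R ->
  \int[mu]_(x in `]0%R, b]) (x `^ (p - 1))%:E = (b `^ p / p)%:E.
Proof.
move=> p0 b0.
have h : \int[mu]_(x in `[(b / k.+1%:R)%R, b]) (x `^ (p - 1))%:E @[k --> \oo] -->
  \int[mu]_(x in `]0%R, b]) (x `^ (p - 1))%:E.
  apply: (@ge0_cvg_integral_itv_oc (fun x => (x `^ (p - 1))%:E)) => //.
    by apply/measurable_EFinP; exact: measurable_powR.
  by move=> x; rewrite lee_fin powR_ge0.
rewrite -(cvg_lim _ h)//; apply/cvg_lim => //.
have h2 : (b `^ p / p - (b / k.+1%:R) `^ p / p)%:E @[k --> \oo] --> (b `^ p / p)%:E.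
  apply: cvg_EFin; first by near=> k.
  rewrite /comp/= -[X in _ --> X]subr0; apply: cvgB; first exact: cvg_cst.
  rewrite -[X in _ --> X](mul0r p^-1)%R; apply: cvgMl.
  apply: cvg_powR0 => //.
    by near=> k; rewrite divr_ge0// ltW.
  rewrite -[X in _ --> X](mulr0 b); apply: cvgMr; exact: cvg_harmonic.
apply: cvg_trans h2; apply: near_eq_cvg; near=> k.
apply/esym/(@is_derive_continuous_FTC2 _ (fun x => x `^ p / p)%R).
- rewrite ltr_pdivrMr// ltr_pMr// ltr1n ltnS.
  by near: k; exact: nbhs_infty_gt.
- move=> x /andP[bx _]; apply: continuous_powR.
  by rewrite (lt_le_trans _ bx)// divr_gt0.
- move=> x /andP[bx _]; have x0 : (0 < x)%R by rewrite (lt_le_trans _ bx)// divr_gt0.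
  have H := is_derive_powR_cst p x p^-1%R x0.
  by apply: is_derive_eq; rewrite mulrAC divff ?mul1r// gt_eqF.
Unshelve. all: by end_near. Qed.

Lemma integral_powR_cy (p a : R) : (0 < p)%R -> (0 < a)%R ->
  \int[mu]_(x in `[a, +oo[) (x `^ (- p - 1))%:E = (a `^ (- p) / p)%:E.
Proof.
move=> p0 a0.
have dF (x : R) : (a <= x)%R ->
    is_derive x 1%R (fun x => x `^ (- p) * (- p^-1))%R (x `^ (- p - 1))%R.
  move=> ax; have H := is_derive_powR_cst (- p)%R x (- p^-1)%R (lt_le_trans a0 ax).
  by apply: is_derive_eq; rewrite mulrAC mulrNN divff ?mul1r// gt_eqF.
have -> := @ge0_continuous_FTC2y _ (fun x => x `^ (- p - 1))%R
  (fun x => x `^ (- p) * (- p^-1))%R a 0%R.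
- by rewrite sub0e -EFinN mulrN opprK.
- by move=> x ax; rewrite powR_ge0.
- apply: continuous_at_within => x /=; rewrite in_itv/= andbT => ax.
  by apply: continuous_powR; rewrite (lt_le_trans a0).
- rewrite -[X in _ --> X](mul0r (- p^-1))%R; apply: cvgMl; exact: cvg_powRN_y.
- by move=> x /ltW ax; apply: ex_derive; exact: dF.
- have ca : {for a, continuous (fun x => x `^ (- p) * (- p^-1))%R}.
    apply/differentiable_continuous/derivable1_diffP.
    by apply: ex_derive; exact: dF.
  exact: cvg_at_right_filter.
- move=> x; rewrite in_itv/= andbT => /ltW ax.
  by rewrite derive1E; apply: derive_val; exact: dF.
Qed.

(** The function is extended by zero outside the product of [D1] and [D2], so that Tonelli on the
    whole product applies. *)
Lemma ge0_tonelli_subset d1 d2 (T1 : measurableType d1) (T2 : measurableType d2)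
    (m1 : {sigma_finite_measure set T1 -> \bar R})
    (m2 : {sigma_finite_measure set T2 -> \bar R})
    (D1 : set T1) (D2 : set T2) (f : T1 -> T2 -> \bar R) :
  measurable D1 -> measurable D2 ->
  measurable_fun setT (fun p : T1 * T2 => f p.1 p.2) ->
  (forall x y, 0 <= f x y) ->
  \int[m1]_(x in D1) \int[m2]_(y in D2) f x y =
  \int[m2]_(y in D2) \int[m1]_(x in D1) f x y.
Proof.
move=> mD1 mD2 mf f0.
pose g := (fun p : T1 * T2 => f p.1 p.2) \_ (D1 `*` D2).
have mg : measurable_fun setT g.
  by apply/(measurable_restrictT _ (measurableX mD1 mD2)); exact: measurable_funTS.
have g0 p : 0 <= g p by rewrite /g patchE; case: ifP.
transitivity (\int[m1]_x \int[m2]_y g (x, y)).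
  rewrite integral_mkcond; apply: eq_integral => x _; rewrite patchE.
  case: ifPn => [xD1|xD1].
    rewrite integral_mkcond; apply: eq_integral => y _.
    by rewrite /g !patchE in_setX xD1.
  by rewrite integral0_eq// => y _; rewrite /g patchE in_setX (negbTE xD1).
rewrite (fubini_tonelli g mg g0).
rewrite [RHS]integral_mkcond; apply: eq_integral => y _; rewrite patchE.
case: ifPn => [yD2|yD2].
  rewrite [RHS]integral_mkcond; apply: eq_integral => x _.
  by rewrite /g !patchE in_setX yD2 andbT.
by rewrite integral0_eq// => x _; rewrite /g patchE in_setX (negbTE yD2) andbF.
Qed.

End improper_integrals.

Lemma measurable_fun_powR d (T : measurableType d) (R : realType) (D : set T)
    (f : T -> R) (p : R) :
  measurable_fun D f -> measurable_fun D (fun x => f x `^ p).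
Proof. exact: (measurableT_comp (@measurable_powR R p)). Qed.

(** * The Gamma function *)

Section gamma.
Context {R : realType}.
Notation mu := (@lebesgue_measure R).
Local Open Scope ereal_scope.

Lemma measurable_gamma_fun (z l : R) :
  measurable_fun setT (fun t : R => t `^ (z - 1) * expR (- (l * t)))%R.
Proof.
apply: measurable_funM; first exact: measurable_powR.
by apply: measurableT_comp => //; apply: measurableT_comp.
Qed.

Let I (z : R) := \int[mu]_(t in `]0%R, +oo[) (t `^ (z - 1) * expR (- t))%:E.

Let Iint z : measurable_fun setT (fun t : measurableTypeR R => (t `^ (z - 1) * expR (- t))%:E).
Proof.
apply/measurable_EFinP; have := measurable_gamma_fun z 1%R.
by under eq_fun do rewrite mul1r.
Qed.

Let f0 z (t : R) : 0 <= (t `^ (z - 1) * expR (- t))%:E.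
Proof. by rewrite lee_fin mulr_ge0 ?powR_ge0 ?expR_ge0. Qed.

(* [e^t = (e^{t/p})^p >= (t/p)^p] with [p = z + 1] *)
Lemma gamma_integral_lty (z : R) : (0 < z)%R -> I z < +oo.
Proof.
move=> z0; rewrite /I.
have -> : `]0%R : R, +oo[%classic = `]0%R, 1%R]%classic `|` `]1%R, +oo[%classic.
  by rewrite -itv_bndbnd_setU ?bnd_simp.
rewrite ge0_integral_setU//=; first last.
- rewrite disj_set2E; apply/eqP/seteqP; split => // x /=; rewrite !in_itv/= andbT.
  by move=> [/andP[_ x1] /lt_geF]; rewrite x1.
- by apply: measurable_funTS; exact: Iint.
apply: lte_add_pinfty.
- apply: (@le_lt_trans _ _ (\int[mu]_(x in `]0%R, 1%R]) (x `^ (z - 1))%:E)); last first.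
    by rewrite integral_powR_oc ?ltry.
  apply: ge0_le_integral => //.
  + by apply: measurable_funTS; exact: Iint.
  + by apply/measurable_funTS/measurable_EFinP; exact: measurable_powR.
  + move=> x /=; rewrite in_itv/= => /andP[x0 _]; rewrite lee_fin ler_piMr ?powR_ge0//.
    by rewrite -expR0 ler_expR oppr_le0 ltW.
- pose p := (z + 1)%R.
  have p0 : (0 < p)%R by rewrite /p addr_gt0.
  apply: (@le_lt_trans _ _ (\int[mu]_(x in `[1%R, +oo[) ((p `^ p)%:E * (x `^ (- 1 - 1))%:E))); last first.
    rewrite ge0_integralZl//=.
    + by rewrite integral_powR_cy// -EFinM ltry.
    + by apply/measurable_funTS/measurable_EFinP; exact: measurable_powR.
    + by move=> x _; rewrite lee_fin powR_ge0.
    + by rewrite lee_fin powR_ge0.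
  apply: (@le_trans _ _ (\int[mu]_(x in `[1%R, +oo[) (x `^ (z - 1) * expR (- x))%:E)).
    apply: ge0_subset_integral => //; first by apply: measurable_funTS; exact: Iint.
    by apply: subset_itvr; rewrite bnd_simp.
  apply: ge0_le_integral => //.
  + by apply: measurable_funTS; exact: Iint.
  + apply/measurable_funTS/measurable_EFinP; apply: measurable_funM => //.
  + move=> x /=; rewrite in_itv/= andbT => x1; rewrite -EFinM lee_fin.
    have x0 : (0 < x)%R by rewrite (lt_le_trans _ x1).
    have : (x `^ p <= p `^ p * expR x)%R.
      have -> : expR x = (expR (x / p) `^ p)%R by rewrite -expRM divfK ?gt_eqF.
      rewrite -powRM ?expR_ge0 ?(ltW p0)//; apply: ge0_ler_powR;
        rewrite ?nnegrE ?mulr_ge0 ?expR_ge0 ?(ltW p0) ?(ltW x0)//.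
      rewrite mulrC -ler_pdivrMr//.
      by rewrite (le_trans _ (expR_ge1Dx _))// ler_wpDl.
    rewrite expRN ler_pdivrMr ?expR_gt0// => h.
    rewrite mulrAC.
    have -> : (x `^ (z - 1) = x `^ p * x `^ (- 1 - 1))%R.
      rewrite -powRD; last by rewrite (gt_eqF x0) implybT.
      by congr (_ `^ _)%R; rewrite /p; ring.
    by rewrite ler_wpM2r ?powR_ge0.
Qed.

Lemma gamma_integral_gt0 (z : R) : (0 < z)%R -> 0 < I z.
Proof.
move=> z0.
(* On [1, 2] one has t^(z-1) >= 1/t >= 1/2 and e^(-t) >= e^(-2). *)
apply: (@lt_le_trans _ _ (\int[mu]_(x in `[1%R, 2%R]) (cst (2^-1 * expR (- 2))%:E x))).
  rewrite integral_cst//= lebesgue_measure_itv/= lte_fin ltr1n -EFinB.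
  by rewrite (_ : (2 - 1 = 1 :> R)%R) ?mule1 ?lte_fin ?mulr_gt0 ?expR_gt0//; ring.
apply: (@le_trans _ _ (\int[mu]_(x in `[1%R, 2%R]) (x `^ (z - 1) * expR (- x))%:E)); last first.
  apply: ge0_subset_integral => //; first by apply: measurable_funTS; exact: Iint.
  by apply: subset_itv; rewrite bnd_simp.
apply: ge0_le_integral => //.
- by move=> x _; rewrite lee_fin mulr_ge0 ?expR_ge0.
- by apply: measurable_funTS; exact: Iint.
- move=> x /=; rewrite in_itv/= => /andP[x1 x2]; rewrite lee_fin.
  have x0 : (0 < x)%R by rewrite (lt_le_trans _ x1).
  apply: ler_pM => //; rewrite ?expR_ge0 ?ler_expR ?lerN2//.
  apply: (@le_trans _ _ x^-1%R); first by rewrite lef_pV2 ?posrE.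
  rewrite -powR_inv1 ?(ltW x0)//; apply: ler_powR => //.
  by rewrite lerDr ltW.
Qed.

(** [Gamma] is the finite part of an extended integral and would be 0 if that integral were
    infinite, so positivity rests on finiteness as well. *)
Lemma Gamma_gt0 (z : R) : (0 < z)%R -> (0 < Gamma z)%R.
Proof.
move=> z0; apply: fine_gt0; apply/andP; split; first exact: gamma_integral_gt0.
exact: gamma_integral_lty.
Qed.

Lemma GammaE (z : R) : (0 < z)%R ->
  \int[mu]_(t in `]0%R, +oo[) (t `^ (z - 1) * expR (- t))%:E = (Gamma z)%:E.
Proof.
move=> z0; rewrite /Gamma /Rintegral fineK// ge0_fin_numE.
  exact: gamma_integral_lty.
by apply: integral_ge0 => t _; exact: f0.
Qed.

Lemma integral_gamma_scale (z l : R) : (0 < z)%R -> (0 < l)%R ->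
  \int[mu]_(t in `]0%R, +oo[) (t `^ (z - 1) * expR (- (l * t)))%:E
  = (l `^ (- z) * Gamma z)%:E.
Proof.
move=> z0 l0.
have Glt : (0 < l `^ z)%R by rewrite powR_gt0.
rewrite EFinM -GammaE// (ge0_integral_dilation l _ (fun t => (t `^ (z - 1) * expR (- t))%:E)) ?gt_eqF//.
- rewrite gtr0_norm// muleA -EFinM.
  have -> : *%R l @^-1` `]0%R, +oo[%classic = `]0%R, +oo[%classic.
    by apply/seteqP; split => x /=; rewrite !in_itv/= !andbT pmulr_rgt0.
  rewrite -ge0_integralZl//=.
  + apply: eq_integral => t; rewrite inE/= in_itv/= andbT => t0.
    rewrite -EFinM powRM ?ltW//; congr EFin.
    have -> : (l `^ (- z) * l = l `^ (1 - z))%R.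
      by rewrite -{2}(powRr1 (ltW l0)) -powRD ?(gt_eqF l0) ?implybT// addrC.
    rewrite !mulrA -powRD ?(gt_eqF l0) ?implybT//.
    by rewrite (_ : (1 - z + (z - 1) = 0)%R) ?powRr0 ?mul1r//; ring.
  + apply/measurable_funTS/measurable_EFinP; apply: measurable_funM.
      exact: measurable_fun_powR.
    by apply: measurableT_comp => //; apply: measurableT_comp.
  + by rewrite lee_fin mulr_ge0 ?powR_ge0 ?ltW.
- by apply: measurable_funTS; exact: Iint.
Qed.

Lemma integral_expRN_cy (t a : R) : (0 < t)%R ->
  \int[mu]_(l in `[a, +oo[) (expR (- (l * t)))%:E = (t^-1 * expR (- (a * t)))%:E.
Proof.
move=> t0.
have dF (x : R) : is_derive x 1%R (fun l => - (t^-1 * expR (- (l * t))))%R (expR (- (x * t))).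
  apply: is_derive_eq.
  by rewrite scaler0 add0r /GRing.scale/= mulr1; field; rewrite gt_eqF.
have -> := @ge0_continuous_FTC2y _ (fun l => expR (- (l * t)))
  (fun l => - (t^-1 * expR (- (l * t))))%R a 0%R.
- by rewrite sub0e -EFinN opprK.
- by move=> x _; exact: expR_ge0.
- apply: continuous_at_within => x _.
  apply/differentiable_continuous/derivable1_diffP; exact: ex_derive.
- rewrite -oppr0; apply: cvgN; rewrite -(mulr0 (t^-1)%R); apply: cvgMr.
  apply: (cvg_comp (fun l : R => l * t)%R (fun x : R => expR (- x)%R)); last exact: cvgr_expR.
  by apply: gt0_cvgMly => //; exact: cvg_id.
- by move=> x _; apply: ex_derive.
- have ca : {for a, continuous (fun l : R => - (t^-1 * expR (- (l * t))))%R}.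
    by apply/differentiable_continuous/derivable1_diffP; apply: ex_derive.
  exact: cvg_at_right_filter.
- move=> x _.
  by rewrite derive1E; apply: derive_val.
Qed.

(** Writing e^(-t)/t as the integral of e^(-lt) over l >= 1 turns Gamma z into a double integral.
    Integrating first in t gives l^(-z-1) Gamma (z + 1), and the integral of l^(-z-1) over l >= 1 is
    1/z. *)
Lemma GammaS (z : R) : (0 < z)%R -> Gamma (z + 1) = (z * Gamma z)%R.
Proof.
move=> z0; have z10 : (0 < z + 1)%R by rewrite addr_gt0.
suff : (Gamma z)%:E = (z^-1 * Gamma (z + 1))%:E.
  by move=> [->]; rewrite mulrA divff ?mul1r// gt_eqF.
rewrite -GammaE//.
transitivity (\int[mu]_(t in `]0%R, +oo[) \int[mu]_(l in `[1%R, +oo[)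
    (t `^ (z + 1 - 1) * expR (- (l * t)))%:E).
  apply: eq_integral => t; rewrite inE/= in_itv/= andbT => t0.
  under eq_integral do rewrite EFinM.
  rewrite ge0_integralZl//=; last 2 first.
  - apply/measurable_funTS/measurable_EFinP; apply: measurableT_comp => //.
    by apply: measurableT_comp => //; exact: mulrr_measurable.
  - by rewrite lee_fin powR_ge0.
  rewrite integral_expRN_cy// mul1r -EFinM; congr EFin.
  rewrite mulrA addrK; congr (_ * _)%R.
  by rewrite powRB ?powRr1 ?(ltW t0)// (gt_eqF t0) implybT.
rewrite (@ge0_tonelli_subset _ _ _ _ _ mu mu `]0%R, +oo[%classic `[1%R, +oo[%classic
  (fun t l => (t `^ (z + 1 - 1) * expR (- (l * t)))%:E))//=; last 2 first.
- apply/measurable_EFinP; apply: measurable_funM.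
    exact: measurable_fun_powR.
  apply: measurableT_comp => //; apply: measurableT_comp => //.
  exact: measurable_funM.
- by move=> x y; rewrite lee_fin mulr_ge0 ?powR_ge0 ?expR_ge0.
transitivity (\int[mu]_(l in `[1%R, +oo[) ((Gamma (z + 1))%:E * (l `^ (- z - 1))%:E)).
  apply: eq_integral => l; rewrite inE/= in_itv/= andbT => l1.
  by rewrite integral_gamma_scale ?(lt_le_trans _ l1)// -EFinM mulrC opprD.
rewrite ge0_integralZl//=.
- by rewrite integral_powR_cy// powR1 mul1r -EFinM mulrC.
- by apply/measurable_funTS/measurable_EFinP; exact: measurable_powR.
- by move=> x _; rewrite lee_fin powR_ge0.
- by rewrite lee_fin ltW// Gamma_gt0.
Qed.

(** The factor 1/(1+v) is the integral of e^(-l(1+v)) over l > 0. After exchanging the integrals,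
    the one in v is Gamma s l^(-s) e^(-l), and integrating this in l yields Gamma (1 - s). *)
Lemma integral_beta (s : R) : (0 < s)%R -> (s < 1)%R ->
  \int[mu]_(v in `]0%R, +oo[) (v `^ (s - 1) / (1 + v))%:E =
  (Gamma s * Gamma (1 - s))%:E.
Proof.
move=> s0 s1.
transitivity (\int[mu]_(v in `]0%R, +oo[) \int[mu]_(l in `]0%R, +oo[)
    (v `^ (s - 1) * expR (- (l * (1 + v))))%:E).
  apply: eq_integral => v; rewrite inE/= in_itv/= andbT => v0.
  have v10 : (0 < 1 + v)%R by rewrite addr_gt0.
  under eq_integral do rewrite EFinM.
  rewrite ge0_integralZl//=; last 2 first.
  - apply/measurable_funTS/measurable_EFinP; apply: measurableT_comp => //.
    by apply: measurableT_comp => //; exact: mulrr_measurable.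
  - by rewrite lee_fin powR_ge0.
  rewrite integral_itv_obnd_cbnd; last first.
    apply/measurable_funTS/measurable_EFinP; apply: measurableT_comp => //.
    by apply: measurableT_comp => //; exact: mulrr_measurable.
  by rewrite integral_expRN_cy// mul0r oppr0 expR0 mulr1 -EFinM.
rewrite (@ge0_tonelli_subset _ _ _ _ _ mu mu `]0%R, +oo[%classic `]0%R, +oo[%classic
  (fun v l => (v `^ (s - 1) * expR (- (l * (1 + v))))%:E))//=; last 2 first.
- apply/measurable_EFinP; apply: measurable_funM.
    exact: measurable_fun_powR.
  apply: measurableT_comp => //; apply: measurableT_comp => //.
  by apply: measurable_funM => //; exact: measurable_funD.
- by move=> x y; rewrite lee_fin mulr_ge0 ?powR_ge0 ?expR_ge0.
transitivity (\int[mu]_(l in `]0%R, +oo[) ((Gamma s)%:E * (l `^ (1 - s - 1) * expR (- l))%:E)).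
  apply: eq_integral => l; rewrite inE/= in_itv/= andbT => l0.
  transitivity (\int[mu]_(v in `]0%R, +oo[) ((expR (- l))%:E * (v `^ (s - 1) * expR (- (l * v)))%:E)).
    apply: eq_integral => v _; rewrite -EFinM; congr EFin.
    by rewrite mulrDr mulr1 opprD expRD mulrCA.
  rewrite ge0_integralZl//=.
  - rewrite integral_gamma_scale// -!EFinM; congr EFin.
    by rewrite (_ : (1 - s - 1 = - s)%R); ring.
  - by apply/measurable_funTS/measurable_EFinP; exact: measurable_gamma_fun.
  - by move=> x _; rewrite lee_fin mulr_ge0 ?powR_ge0 ?expR_ge0.
rewrite ge0_integralZl//=.
- by rewrite GammaE ?subr_gt0// -EFinM.
- by apply: measurable_funTS; exact: Iint.
- by rewrite lee_fin ltW// Gamma_gt0.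
Qed.

(** The nonnegative case is the dilation by -1 of the negative half-line. The signed case treats the
    two parts separately and holds even when both are infinite. *)
Lemma integralT_even (f : measurableTypeR R -> \bar R) : measurable_fun setT f ->
  (forall x, f (- x)%R = f x) ->
  \int[mu]_x f x = 2%:E * \int[mu]_(x in `]0%R, +oo[) f x.
Proof.
have ge0 (g : measurableTypeR R -> \bar R) : measurable_fun setT g -> (forall x, 0 <= g x) ->
    (forall x, g (- x)%R = g x) ->
    \int[mu]_x g x = 2%:E * \int[mu]_(x in `]0%R, +oo[) g x.
  move=> mg g0 ge.
  have -> : [set: measurableTypeR R] = `]-oo, 0%R[%classic `|` `[0%R, +oo[%classic.
    by apply/seteqP; split => x //= _; rewrite !in_itv/= andbT; case: (ltP x 0%R); [left|right].
  rewrite ge0_integral_setU//=; last 2 first.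
  - exact: measurable_funTS.
  - rewrite disj_set2E; apply/eqP/seteqP; split => // x /=; rewrite !in_itv/= andbT.
    by move=> [/lt_geF ->].
  rewrite -(integral_itv_obnd_cbnd (f := g)); last exact: measurable_funTS.
  rewrite [X in X + _](ge0_integral_dilation (-1)%R)//; last exact: measurable_funTS.
  rewrite normrN1 mul1e.
  have -> : *%R (-1)%R @^-1` `]-oo, 0%R[%classic = `]0%R : R, +oo[%classic.
    by apply/seteqP; split => x /=; rewrite !in_itv/= ?andbT mulN1r oppr_lt0.
  under eq_integral do rewrite mulN1r ge.
  by rewrite -[in RHS](_ : 1%:E + 1%:E = 2%:E)// ge0_muleDl ?mul1e.
move=> mf fe; rewrite integralE [in RHS]integralE gt0_muleBr//.
rewrite (ge0 f^\+)//; [|exact: measurable_funepos|by move=> x; rewrite !funeposE fe].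
by rewrite (ge0 f^\-)//; [exact: measurable_funeneg|move=> x; rewrite !funenegE fe].
Qed.

(** * Change of variables on a segment *)

Section substitution.
Variables (F dF G : R -> R) (a b : R).
Hypothesis ab : (a <= b)%R.
Hypothesis isdF : forall x, (a <= x <= b)%R -> is_derive x 1%R F (dF x).
Hypothesis cdF : forall x, (a <= x <= b)%R -> {for x, continuous dF}.

Let cF x : (a <= x <= b)%R -> {for x, continuous F}.
Proof.
move=> axb; apply/differentiable_continuous/derivable1_diffP.
by apply: ex_derive; exact: isdF.
Qed.

Let F'E x : (a < x < b)%R -> F^`()%classic x = dF x.
Proof.
by move=> /andP[ax xb]; rewrite derive1E; apply: derive_val; apply: isdF; rewrite !ltW.
Qed.

Let F'near x : (a < x < b)%R -> \forall y \near x, dF y = F^`()%classic y.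
Proof.
move=> /andP[ax xb]; near=> y; apply/esym/F'E; apply/andP; split.
  by near: y; exact: lt_nbhsr.
by near: y; exact: lt_nbhsl.
Unshelve. all: by end_near. Qed.

Let cF' : {in `]a, b[, continuous F^`()%classic}.
Proof.
move=> x; rewrite in_itv/= => axb.
have axb' : (a <= x <= b)%R by move: axb => /andP[ax xb]; rewrite !ltW.
have h : dF y @[y --> x] --> dF x := cdF _ axb'.
rewrite /prop_for /continuous_at F'E//; apply: cvg_trans h.
by apply: near_eq_cvg; exact: F'near.
Qed.

Let cvgF'a : (a < b)%R -> cvg (F^`()%classic x @[x --> a^'+]).
Proof.
move=> ab'; apply/cvg_ex; exists (dF a).
have h : dF x @[x --> a^'+] --> dF a.
  by apply: cvg_at_right_filter; apply: cdF; rewrite lexx.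
apply: cvg_trans h; apply: near_eq_cvg; near=> x; apply/esym/F'E; apply/andP; split.
  by near: x; exact: nbhs_right_gt.
by near: x; exact: nbhs_right_lt.
Unshelve. all: by end_near. Qed.

Let cvgF'b : (a < b)%R -> cvg (F^`()%classic x @[x --> b^'-]).
Proof.
move=> ab'; apply/cvg_ex; exists (dF b).
have h : dF x @[x --> b^'-] --> dF b.
  by apply: cvg_at_left_filter; apply: cdF; rewrite lexx andbT.
apply: cvg_trans h; apply: near_eq_cvg; near=> x; apply/esym/F'E; apply/andP; split.
  by near: x; exact: nbhs_left_gt.
by near: x; exact: nbhs_left_lt.
Unshelve. all: by end_near. Qed.

Let dooF : derivable_oo_LRcontinuous F a b.
Proof.
split.
- move=> x; rewrite in_itv/= => /andP[ax xb].
  by apply: ex_derive; apply: isdF; rewrite !ltW.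
- by apply: cvg_at_right_filter; apply: cF; rewrite lexx.
- by apply: cvg_at_left_filter; apply: cF; rewrite lexx andbT.
Qed.

Let wF : {within `[a, b], continuous F}.
Proof. by apply: continuous_at_within => x /=; rewrite in_itv/=; exact: cF. Qed.

Lemma substitution_increasing : (forall x, a < x < b -> 0 < dF x)%R ->
  (forall y, F a <= y <= F b -> {for y, continuous G})%R ->
  \int[mu]_(y in `[F a, F b]) (G y)%:E = \int[mu]_(x in `[a, b]) (G (F x) * dF x)%:E.
Proof.
have [ab' dF0 cG|ba] := ltP a b; last first.
  by move=> _ _; rewrite (_ : b = a) ?set_itv1 ?integral_set1//; apply/eqP; rewrite eq_le ab ba.
have mF : {in `[a, b] &, {homo F : x y / (x < y)%R}}.
  apply: (@gtr0_derive1_lt_cc R F a b _ _ wF) => x; rewrite in_itv/= => axb.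
    by apply: ex_derive; apply: isdF; move: axb => /andP[ax xb]; rewrite !ltW.
  by rewrite F'E//; exact: dF0.
have mGF : measurable_fun `]a, b[ (fun x => G (F x) * dF x)%R.
  apply: open_continuous_measurable_fun => // x; rewrite inE/= in_itv/= => /andP[ax xb].
  have axb : (a <= x <= b)%R by rewrite !ltW.
  have c1 : {for x, continuous (G \o F)}.
    apply: continuous_comp; first exact: cF.
    by apply: cG; rewrite !ltW// mF// ?in_itv/= ?lexx ?(ltW ab') ?(ltW ax) ?(ltW xb).
  exact: (continuousM c1 (cdF _ axb)).
rewrite integration_by_substitution_increasing//.
- rewrite [RHS]integral_itv_bndoo; last exact/measurable_EFinP.
  rewrite integral_itv_bndoo; last first.
    apply/measurable_EFinP; apply: eq_measurable_fun mGF => x.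
    by rewrite inE/= in_itv/= => axb; rewrite /= !fctE F'E.
  by apply: eq_integral => x; rewrite inE/= in_itv/= => axb; rewrite !fctE F'E.
- exact: cvgF'a.
- exact: cvgF'b.
- by apply: continuous_at_within => x /=; rewrite in_itv/=; exact: cG.
Qed.

Lemma substitution_decreasing : (forall x, a < x < b -> dF x < 0)%R ->
  (forall y, F b <= y <= F a -> {for y, continuous G})%R ->
  \int[mu]_(y in `[F b, F a]) (G y)%:E = \int[mu]_(x in `[a, b]) (G (F x) * - dF x)%:E.
Proof.
have [ab' dF0 cG|ba] := ltP a b; last first.
  by move=> _ _; rewrite (_ : b = a) ?set_itv1 ?integral_set1//; apply/eqP; rewrite eq_le ab ba.
have mF : {in `[a, b] &, {homo F : x y /~ (x < y)%R}}.
  apply: (@ltr0_derive1_lt_cc R F a b _ _ wF) => x; rewrite in_itv/= => axb.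
    by apply: ex_derive; apply: isdF; move: axb => /andP[ax xb]; rewrite !ltW.
  by rewrite F'E//; exact: dF0.
have mGF : measurable_fun `]a, b[ (fun x => G (F x) * - dF x)%R.
  apply: open_continuous_measurable_fun => // x; rewrite inE/= in_itv/= => /andP[ax xb].
  have axb : (a <= x <= b)%R by rewrite !ltW.
  have c1 : {for x, continuous (G \o F)}.
    apply: continuous_comp; first exact: cF.
    by apply: cG; rewrite !ltW// mF// ?in_itv/= ?lexx ?(ltW ab') ?(ltW ax) ?(ltW xb).
  have c2 : {for x, continuous (- dF)%R} by apply: continuousN; exact: cdF.
  exact: (continuousM c1 c2).
rewrite integration_by_substitution_decreasing//.
- rewrite [RHS]integral_itv_bndoo; last exact/measurable_EFinP.
  rewrite integral_itv_bndoo; last first.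
    apply/measurable_EFinP; apply: eq_measurable_fun mGF => x.
    by rewrite inE/= in_itv/= => axb; rewrite /= !fctE F'E.
  by apply: eq_integral => x; rewrite inE/= in_itv/= => axb; rewrite !fctE F'E.
- exact: cvgF'a.
- exact: cvgF'b.
- by apply: continuous_at_within => x /=; rewrite in_itv/=; exact: cG.
Qed.

End substitution.

Lemma cvgr_natS : (k.+1%:R : R) @[k --> \oo] --> +oo%R.
Proof. by rewrite (cvg_shiftS (fun k : nat => k%:R : R)); exact: cvgr_idn. Qed.

(** The substitution y = a t^2 brings this to the integral of Gamma at (m+1)/2. It is carried out on
    the segments [1/(k+1), k+1] and passed to the limit by monotone convergence. The absolute value
    makes the integrand even, as it is needed on whole lines. *)
Lemma integral_gauss_moment (m : nat) (a : R) : (0 < a)%R ->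
  \int[mu]_(t in `]0%R, +oo[) (`|t| ^+ m * expR (- (a * t ^+ 2)))%:E =
  (a `^ (- (m.+1%:R / 2)) * Gamma (m.+1%:R / 2) / 2)%:E.
Proof.
move=> a0; pose z := (m.+1%:R / 2 : R)%R.
have z0 : (0 < z)%R by rewrite /z divr_gt0.
have az0 : (0 < a `^ z)%R by rewrite powR_gt0.
pose G (t : R) := (t `^ (z - 1) * expR (- t))%R.
(* This is (a t^2)^(z-1) e^(-a t^2) times the derivative 2 a t, since 2z - 1 = m. *)
pose h (t : R) := ((2 * a `^ z)%:E * (`|t| ^+ m * expR (- (a * t ^+ 2)))%:E).
have mh : measurable_fun setT (fun t : R => (`|t| ^+ m * expR (- (a * t ^+ 2))))%R.
  apply: measurable_funM; first by apply: measurable_funX.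
  by apply: measurableT_comp => //; apply: measurableT_comp => //; apply: measurable_funM.
have sub k : \int[mu]_(x in `[(a * k.+1%:R^-1 ^+ 2)%R, (a * k.+1%:R ^+ 2)%R]) (G x)%:E =
    \int[mu]_(x in `[(k.+1%:R^-1)%R, k.+1%:R%R]) h x.
  have kinv0 : (0 < k.+1%:R^-1 :> R)%R by rewrite invr_gt0.
  have kk : (k.+1%:R^-1 <= k.+1%:R :> R)%R.
    by rewrite (@le_trans _ _ 1%R)// ?invf_le1// ler1n.
  apply: etrans; first apply: (substitution_increasing (fun t => a * t ^+ 2)%R
      (fun t => a * (2 * t))%R G _ _ kk).
  - move=> x _; apply: is_derive_eq; rewrite /GRing.scale/= ?expr1.
    by ring.
  - move=> x _; apply/differentiable_continuous/derivable1_diffP; exact: ex_derive.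
  - by move=> x /andP[kx _]; rewrite mulr_gt0// mulr_gt0// (lt_trans _ kx).
  - move=> y /andP[ky _].
    have y0 : (0 < y)%R by rewrite (lt_le_trans _ ky)// mulr_gt0// exprn_gt0.
    have c2 : {for y, continuous (fun t : R => expR (- t))}.
      by apply/differentiable_continuous/derivable1_diffP; exact: ex_derive.
    have c1 := continuous_powR (z - 1)%R y y0.
    exact: (continuousM c1 c2).
  apply: eq_integral => x; rewrite inE/= in_itv/= => /andP[kx _].
  have x0 : (0 < x)%R by rewrite (lt_le_trans _ kx).
  rewrite /h -EFinM /G gtr0_norm//; congr EFin.
  have -> : ((a * x ^+ 2) `^ (z - 1) = a `^ (z - 1) * x `^ (2%:R * (z - 1)))%R.
    by rewrite powRM ?exprn_ge0 ?(ltW x0) ?(ltW a0)// -(powR_mulrn 2 (ltW x0)) -powRrM.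
  rewrite -(powR_mulrn m (ltW x0)).
  have -> : (a * (2 * x) = 2 * (a `^ 1 * x `^ 1))%R by rewrite !powRr1 ?ltW//; ring.
  have -> : (a `^ z = a `^ (z - 1) * a `^ 1)%R.
    by rewrite -powRD ?subrK// (gt_eqF a0) implybT.
  have -> : (x `^ m%:R = x `^ (2%:R * (z - 1)) * x `^ 1)%R.
    rewrite -powRD; last by rewrite (gt_eqF x0) implybT.
    by congr (_ `^ _)%R; rewrite /z -natr1; field.
  by ring.
have h1 : \int[mu]_(x in `[(a * k.+1%:R^-1 ^+ 2)%R, (a * k.+1%:R ^+ 2)%R]) (G x)%:E @[k --> \oo] --> (Gamma z)%:E.
  rewrite -GammaE//; apply: (@ge0_cvg_integral_0y _ (EFin \o G)).
  - move=> x y xy; rewrite ler_pM2l// ler_sqr ?nnegrE//.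
    by rewrite lef_pV2 ?posrE// ler_nat.
  - rewrite -(mulr0 a); apply: cvgMr; under eq_fun do rewrite expr2.
    by rewrite -(mulr0 (0 : R)%R); apply: cvgM; exact: cvg_harmonic.
  - by move=> k; rewrite mulr_gt0// exprn_gt0// invr_gt0.
  - by move=> x y xy; rewrite ler_pM2l// ler_sqr ?nnegrE// ler_nat.
  - apply: (cvg_comp (fun k : nat => k.+1%:R : R) (fun x => a * x ^+ 2)%R); first exact: cvgr_natS.
    by apply: gt0_cvgMry => //; exact: cvgr_expr2.
  - exact: Iint.
  - by move=> x; exact: f0.
have h2 : \int[mu]_(x in `[(k.+1%:R^-1)%R, k.+1%:R%R]) (h x) @[k --> \oo] --> \int[mu]_(t in `]0%R, +oo[) h t.
  apply: (@ge0_cvg_integral_0y _ h).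
  - by move=> x y xy; rewrite lef_pV2 ?posrE// ler_nat.
  - exact: cvg_harmonic.
  - by move=> k; rewrite invr_gt0.
  - by move=> x y xy; rewrite ler_nat.
  - exact: cvgr_natS.
  - by rewrite /h; apply: emeasurable_funM => //; exact/measurable_EFinP.
  - move=> x; rewrite /h -EFinM lee_fin !mulr_ge0 ?expR_ge0 ?exprn_ge0//.
    exact: powR_ge0.
have hG : (Gamma z)%:E = \int[mu]_(t in `]0%R, +oo[) h t.
  by rewrite -(cvg_lim _ h1)//; apply/cvg_lim => //; under eq_fun do rewrite sub.
rewrite -/z powRN -mulrA mulrA mulrAC -invfM EFinM hG /h ge0_integralZl//=.
- by rewrite muleA -EFinM [(2 * _)%R]mulrC mulVf ?mul1e// mulf_neq0 ?gt_eqF.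
- exact/measurable_funTS/measurable_EFinP.
- by rewrite lee_fin !mulr_ge0 ?powR_ge0.
Qed.

End gamma.

(** * The one-dimensional integral *)

Section pospow_theory.
Context {R : realType}.
Implicit Types (s h c : R).

Lemma pospow_ge0 c s : 0 <= pospow c s.
Proof. exact: powR_ge0. Qed.

Lemma pospowE c s : 0 <= c -> pospow c s = c `^ s.
Proof. by move=> c0; rewrite /pospow max_l. Qed.

Lemma pospow_le0 c s : 0 < s -> c <= 0 -> pospow c s = 0.
Proof. by move=> s0 c0; rewrite /pospow max_r// powR0// gt_eqF. Qed.

Lemma pospowM c k s : 0 <= k -> pospow (k * c) s = k `^ s * pospow c s.
Proof.
move=> k0; rewrite /pospow -powRM// ?le_max ?lexx ?orbT//.
by rewrite maxr_pMr// mulr0.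
Qed.

Lemma ler_pospow s : 0 <= s -> {homo (fun c => pospow c s) : a b / a <= b}.
Proof.
move=> s0 a b ab; apply: ge0_ler_powR => //; rewrite ?nnegrE ?le_max ?lexx ?orbT//.
by case: (leP b 0) => [b0|/ltW b0]; rewrite !ge_max ?ab ?b0 ?lexx ?(le_trans ab b0) ?orbT.
Qed.

(** Young's inequality with exponents 1/s and 1/(1-s), applied to (1+h)^s and 1, gives the bound s
    (1+h) + (1-s). *)
Lemma powR_le_bernoulli s h : 0 < s -> s < 1 -> -1 <= h -> (1 + h) `^ s <= 1 + s * h.
Proof.
move=> s0 s1 h1; have h0 : 0 <= 1 + h by rewrite addrC -lerBlDr sub0r.
have s10 : 0 < 1 - s by rewrite subr_gt0.
have := @conjugate_powR R ((1 + h) `^ s) 1 s^-1 (1 - s)^-1 (powR_ge0 _ _) ler01.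
rewrite !invr_gt0 !invrK [s + _]addrC subrK => /(_ s0 s10 erefl).
rewrite mulr1 powR1 mul1r -powRrM divff ?gt_eqF// powRr1// => /le_trans; apply.
by rewrite le_eqVlt; apply/orP; left; apply/eqP; ring.
Qed.

(* Both signs follow from Bernoulli: the lower bound for [h > -1] is
   [(1+h)^s = (1+h) / (1+h)^(1-s) >= (1+h) / (1 + (1-s) h)]. *)
Lemma pospow_taylor1 s h : 0 < s -> s < 1 -> `|pospow (1 + h) s - 1 - s * h| <= h ^+ 2.
Proof.
move=> s0 s1; have [h1|h1] := leP h (-1).
  rewrite pospow_le0//; last by lra.
  by rewrite ler_norml; apply/andP; split; nra.
have h0 : 0 < 1 + h by lra.
have ub := powR_le_bernoulli s h s0 s1 (ltW h1).
have s10 : 0 < 1 - s by rewrite subr_gt0.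
have lb := powR_le_bernoulli (1 - s) h s10 ltac:(lra) (ltW h1).
have e1 : (1 + h) `^ s * (1 + h) `^ (1 - s) = 1 + h.
  by rewrite -powRD ?(gt_eqF h0) ?implybT// [s + _]addrC subrK powRr1// ltW.
rewrite pospowE ?(ltW h0)//.
set A := (1 + h) `^ s in ub e1 *; set B := (1 + h) `^ (1 - s) in lb e1 *.
have A0 : 0 <= A by exact: powR_ge0.
have k0 : 0 < 1 + (1 - s) * h by nra.
have h3 : 1 + h <= A * (1 + (1 - s) * h) by rewrite -{1}e1 ler_wpM2l.
have h4 : (1 + s * h - (1 - s) * h ^+ 2) * (1 + (1 - s) * h) <= 1 + h.
  have -> : (1 + s * h - (1 - s) * h ^+ 2) * (1 + (1 - s) * h) =
    1 + h - (1 - s) ^+ 2 * h ^+ 2 * (1 + h) by ring.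
  by rewrite lerBlDr lerDl; apply: mulr_ge0; [rewrite mulr_ge0 ?sqr_ge0|exact: ltW].
have h5 : 1 + s * h - (1 - s) * h ^+ 2 <= A.
  by rewrite -(ler_pM2r k0) (le_trans h4).
have h6 : s * h ^+ 2 >= 0 by rewrite mulr_ge0 ?sqr_ge0// ltW.
by rewrite ler_norml; apply/andP; split; nra.
Qed.

(** By homogeneity, c + h = c (1 + h/c) reduces this to c = 1. The bound holds for every [h], also
    where the truncation is active; the price is a constant that blows up as [c] tends to 0, that
    is, at the boundary of the ball. *)
Lemma pospow_taylor s c h : 0 < s -> s < 1 -> 0 < c ->
  `|pospow (c + h) s - c `^ s - s * c `^ (s - 1) * h| <= c `^ (s - 2) * h ^+ 2.
Proof.
move=> s0 s1 c0.
have c1 : c `^ (s - 1) = c `^ s / c by rewrite powRB ?powRr1 ?(ltW c0)// (gt_eqF c0) implybT.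
have c2 : c `^ (s - 2) = c `^ s / c ^+ 2.
  by rewrite powRB ?powR_mulrn ?(ltW c0)// (gt_eqF c0) implybT.
have := pospow_taylor1 s (h / c) s0 s1.
have -> : c + h = c * (1 + h / c) by field; rewrite gt_eqF.
rewrite pospowM ?(ltW c0)// c1 c2 => H.
have -> : c `^ s * pospow (1 + h / c) s - c `^ s - s * (c `^ s / c) * h =
  c `^ s * (pospow (1 + h / c) s - 1 - s * (h / c)) by field; rewrite gt_eqF.
have -> : c `^ s / c ^+ 2 * h ^+ 2 = c `^ s * (h / c) ^+ 2 by field; rewrite gt_eqF.
by rewrite normrM ger0_norm ?powR_ge0// ler_wpM2l ?powR_ge0.
Qed.

(** Here [p] is the part of the increment that changes sign with the direction and [q] the part that
    does not. The first-order terms in [p] cancel, and the two squares add up to 2 (p^2 + q^2). In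
    the applications [p] is linear and [q] quadratic in the step. *)
Lemma pospow_second_difference s c p q : 0 < s -> s < 1 -> 0 < c ->
  `|2 * pospow c s - pospow (c + p - q) s - pospow (c - p - q) s| <=
  2 * s * c `^ (s - 1) * `|q| + 2 * c `^ (s - 2) * (p ^+ 2 + q ^+ 2).
Proof.
move=> s0 s1 c0.
have := pospow_taylor s c (p - q) s0 s1 c0.
have := pospow_taylor s c (- p - q) s0 s1 c0.
rewrite !addrA (pospowE c) ?(ltW c0)//.
set U := pospow _ s; set V := pospow _ s; set K1 := c `^ (s - 1); set K2 := c `^ (s - 2).
set C := c `^ s.
have K10 : 0 <= K1 by exact: powR_ge0.
move=> h1 h2.
have h3 : 2 * C - V - U = - (U - C - s * K1 * (- p - q)) - (V - C - s * K1 * (p - q))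
    + 2 * s * K1 * q by ring.
rewrite h3; apply: (le_trans (ler_normD _ _)); rewrite addrC lerD//.
  by rewrite !normrM (ger0_norm K10) (ger0_norm (ltW s0)) ger0_norm.
apply: (le_trans (ler_normB _ _)); rewrite normrN; apply: (le_trans (lerD h1 h2)).
by rewrite le_eqVlt; apply/orP; left; apply/eqP; ring.
Qed.

Lemma ler_pospow_le1 s c : 0 < s -> c <= 1 -> pospow c s <= 1.
Proof. by move=> s0 c1; have -> : 1 = pospow 1 s :> R; [by rewrite pospowE// powR1|exact: (ler_pospow _ (ltW s0))]. Qed.

End pospow_theory.

(** * Truncated integrals of the profile and their limit *)

Section one_dimensional.
Context {R : realType}.
Notation mu := (@lebesgue_measure R).
Variable s : R.
Hypotheses (s0 : 0 < s) (s1 : s < 1).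

Let w (y : R) := pospow (1 - y ^+ 2) s.
(** The incomplete Beta integral. It grows like M^s/s, and [- B] is the constant term of its
    expansion for large [M]. *)
Let J (M : R) : \bar R :=
  (\int[mu]_(m in `[0%R, M]) (pospow m s * (1 + m) `^ (- 1))%:E)%E.
Let B : R := Gamma s * Gamma (1 - s).

Lemma powR_splitB1 (p x : R) : 0 < x -> x `^ (p - 1) = x `^ p / x.
Proof. by move=> x0; rewrite powRB ?powRr1 ?(ltW x0)// (gt_eqF x0) implybT. Qed.

Lemma is_derive_inv (f : R -> R) (x v df : R) : f x != 0 -> is_derive x v f df ->
  is_derive x v (fun y => (f y)^-1) (- (f x) ^- 2 *: df).
Proof.
move=> fx0 [dfx <-]; split; first exact: derivableV.
exact: deriveV.
Qed.

(** The identity 1/f = f (1/|f|)^2 reduces the inverse to a power of a nonnegative function; it also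
    holds where [f] vanishes, because the inverse of 0 is 0. *)
Lemma measurable_fun_inv d (T : measurableType d) (f : T -> R) : measurable_fun setT f ->
  measurable_fun setT (fun y => (f y)^-1).
Proof.
move=> mf; rewrite (_ : (fun y => _) = fun y => f y * (`|f y| `^ (- 1)) ^+ 2).
  apply: measurable_funM => //; apply: measurable_funX; apply: measurable_fun_powR.
  exact: measurableT_comp.
apply/funext => y; rewrite powR_inv1// exprVn real_normK ?num_real//.
by have [->|fy0] := eqVneq (f y) 0; [rewrite invr0 mul0r|field].
Qed.

Lemma measurable_fun_pospow (f : R -> R) p : measurable_fun setT f ->
  measurable_fun setT (fun y => pospow (f y) p).
Proof. by move=> mf; apply: measurable_fun_powR; exact: measurable_maxr. Qed.

(** Since m^s/(1+m) = m^(s-1) - m^(s-1)/(1+m), the value of [J M] is M^s/s minus [B] plus the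
    integral of m^(s-1)/(1+m) over m > M. That tail is nonnegative and at most the integral of
    m^(s-2), which is M^(s-1)/(1-s). *)
Lemma truncated_beta_bounds (M : R) : 0 < M -> exists2 r, J M = r%:E &
  M `^ s / s - B <= r <= M `^ s / s - B + M `^ (s - 1) / (1 - s).
Proof.
move=> M0.
have s10 : 0 < 1 - s by rewrite subr_gt0.
pose f (m : R) := m `^ (s - 1) * (1 + m) `^ (- 1).
have mf : measurable_fun setT (EFin \o f).
  apply/measurable_EFinP; apply: measurable_funM; first exact: measurable_powR.
  by apply: measurable_fun_powR; exact: measurable_funD.
have mJ : measurable_fun setT (fun m : R => (pospow m s * (1 + m) `^ (- 1))%:E).
  apply/measurable_EFinP; apply: measurable_funM; first exact: measurable_fun_pospow.
  by apply: measurable_fun_powR; exact: measurable_funD.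
have f0 (m : R) : (0 <= (f m)%:E)%E.
  by rewrite lee_fin /f mulr_ge0 ?powR_ge0.
pose I1 := (\int[mu]_(m in `]0%R, M]) (f m)%:E)%E.
pose I2 := (\int[mu]_(m in `]M, +oo[) (f m)%:E)%E.
have I10 : (0 <= I1)%E by apply: integral_ge0 => x _.
have I20 : (0 <= I2)%E by apply: integral_ge0 => x _.
have e12 : (I1 + I2 = B%:E)%E.
  rewrite /B -integral_beta// /I1 /I2 -ge0_integral_setU//=; last 2 first.
  - by apply: measurable_funTS; exact: mf.
  - rewrite disj_set2E; apply/eqP/seteqP; split => // x /=; rewrite !in_itv/= andbT.
    by move=> [/andP[_ x1] /lt_geF]; rewrite x1.
  have <- : `]0%R, +oo[%classic = `]0%R, M]%classic `|` `]M, +oo[%classic.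
    by rewrite -itv_bndbnd_setU ?bnd_simp// ltW.
  apply: eq_integral => v; rewrite inE/= in_itv/= andbT => v0.
  by rewrite /f powR_inv1// addr_ge0// ltW.
have I2le : (I2 <= (M `^ (s - 1) / (1 - s))%:E)%E.
  apply: (@le_trans _ _ (\int[mu]_(m in `[M, +oo[) (m `^ (- (1 - s) - 1))%:E)%E); last first.
    by rewrite integral_powR_cy// opprB.
  rewrite /I2 integral_itv_obnd_cbnd; last by apply: measurable_funTS; exact: mf.
  apply: ge0_le_integral => //.
  - by apply: measurable_funTS; exact: mf.
  - by apply/measurable_funTS/measurable_EFinP; exact: measurable_powR.
  - move=> x /=; rewrite in_itv/= andbT => Mx; have x0 : 0 < x by rewrite (lt_le_trans M0).
    rewrite lee_fin /f opprB (powR_splitB1 (s - 1))// ler_wpM2l ?powR_ge0//.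
    rewrite powR_inv1 ?addr_ge0 ?(ltW x0)// lef_pV2 ?posrE ?addr_gt0// lerDr//.
have J0 : (0 <= J M)%E.
  by apply: integral_ge0 => x _; rewrite lee_fin mulr_ge0 ?powR_ge0.
have eJ : (J M + I1 = (M `^ s / s)%:E)%E.
  rewrite -integral_powR_oc// /J -integral_itv_obnd_cbnd; last first.
    by apply: measurable_funTS; exact: mJ.
  rewrite -ge0_integralD//=; last 3 first.
  - by move=> x _; rewrite lee_fin mulr_ge0 ?powR_ge0.
  - by apply: measurable_funTS; exact: mJ.
  - by apply: measurable_funTS; exact: mf.
  apply: eq_integral => m; rewrite inE/= in_itv/= => /andP[m0 _].
  rewrite /f -EFinD pospowE ?(ltW m0)// powR_splitB1//; congr EFin.
  rewrite powR_inv1 ?addr_ge0 ?(ltW m0)//.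
  by field; rewrite !gt_eqF// addr_gt0.
move: J0 I10 I20 eJ e12 I2le; case: (J M) I1 I2 => [j| |] [i1| |] [i2| |]//=.
rewrite -!EFinD !lee_fin => _ _ h1 [eJ] [e12] h2.
by exists j => //; apply/andP; split; lra.
Qed.

Lemma measurable_quadratic (x : R) : measurable_fun setT (fun t : measurableTypeR R =>
  (w (x + t) * (t `^ (- (1 + 2 * s)) + x * (t `^ (- (2 * s)) / (1 - x ^+ 2 - 2 * x * t))))%:E).
Proof.
apply/measurable_EFinP; apply: measurable_funM.
  apply: measurable_fun_pospow; apply: measurable_funB => //.
  by apply: measurable_funX; exact: measurable_funD.
apply: measurable_funD; first exact: measurable_powR.
apply: measurable_funM => //; apply: measurable_funM; first exact: measurable_powR.
by apply: measurable_fun_inv; apply: measurable_funB => //; exact: measurable_funM.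
Qed.

(** With d = 1 - x^2 - 2xt the new variable is m = d/t^2 - 1, which decreases to 0 at t = 1 - x. Its
    derivative is -2 (d + xt)/t^3, so m^s |m'|/(1+m) equals 2 w(x+t) t^(-2s) (1/t + x/d): the
    correction is exactly the second summand. *)
Lemma integral_quadratic_substitution (x e : R) :
  -1 < x -> x < 1 -> 0 < e -> e <= 1 - x ->
  (\int[mu]_(t in `[e, (1 - x)%R])
     (w (x + t) * (t `^ (- (1 + 2 * s)) + x * (t `^ (- (2 * s)) / (1 - x ^+ 2 - 2 * x * t))))%:E
   = 2^-1%:E * J ((1 - (x + e) ^+ 2) / e ^+ 2))%E.
Proof.
move=> x1 x2 e0 ex.
pose c := 1 - x ^+ 2; pose d t := c - 2 * x * t.
have c0 : 0 < c by rewrite /c; nra.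
have d0 t : 0 <= t -> t <= 1 - x -> 0 < d t.
  move=> t0 tx; rewrite /d /c; have [x0|x0] := leP x 0; first by nra.
  by have := mulr_ge0 (ltW x0) (_ : 0 <= 1 - x - t); rewrite subr_ge0 => /(_ tx); nra.
have cx0 t : 0 <= t -> t <= 1 - x -> 0 < c - x * t.
  by move=> t0 tx; rewrite /c; nra.
pose m t := d t / t ^+ 2 - 1.
pose dm t := - (2 * (c - x * t) / t ^+ 3).
pose G (y : R) := pospow y s * (1 + y) `^ (- 1).
have mE t : 0 < t -> m t = (1 - (x + t) ^+ 2) / t ^+ 2.
  by move=> t0; rewrite /m /d /c; field; rewrite gt_eqF.
rewrite -mE// /J.
have m1x : m (1 - x) = 0.
  by rewrite mE ?subr_gt0// [x + _]addrC subrK expr1n subrr mul0r.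
have := @substitution_decreasing R m dm G e (1 - x) ex.
rewrite m1x => H.
pose f t := w (x + t) * (t `^ (- (1 + 2 * s)) + x * (t `^ (- (2 * s)) / (1 - x ^+ 2 - 2 * x * t))).
have fE t : e <= t -> t <= 1 - x -> G (m t) * - dm t = 2 * f t.
  move=> et tx; have t0 : 0 < t by rewrite (lt_le_trans e0).
  have dt := d0 t (ltW t0) tx.
  have m0 : 0 <= m t.
    rewrite mE//; apply: divr_ge0; last exact: sqr_ge0.
    by nra.
  have e1 : 1 + m t = d t / t ^+ 2 by rewrite /m addrC subrK.
  rewrite /G e1 powR_inv1 ?divr_ge0 ?exprn_ge0 ?(ltW dt) ?(ltW t0)//.
  have -> : pospow (m t) s = w (x + t) * t `^ (- (2 * s)).
    have -> : m t = (t `^ (-1)) ^+ 2 * (1 - (x + t) ^+ 2).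
      by rewrite mE// powR_inv1 ?(ltW t0)// exprVn mulrC.
    rewrite pospowM ?sqr_ge0// mulrC; congr (_ * _).
    rewrite -(powR_mulrn 2 (powR_ge0 _ _)) -!powRrM; congr (_ `^ _); ring.
  rewrite /f (_ : - (1 + 2 * s) = - (2 * s) - 1); last by ring.
  rewrite powR_splitB1// -/c -/(d t) /dm /d.
  by field; rewrite !gt_eqF.
have mf := measurable_quadratic x.
have G0 y : 0 <= G y by rewrite /G mulr_ge0 ?powR_ge0.
have dm0 t : e <= t -> t <= 1 - x -> 0 <= - dm t.
  move=> et tx; have t0 : 0 < t by rewrite (lt_le_trans e0).
  by rewrite /dm opprK ltW// divr_gt0 ?exprn_gt0// mulr_gt0// cx0// ltW.
have {}H : (\int[mu]_(y in `[0%R, m e]) (G y)%:E =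
    \int[mu]_(x in `[e, (1 - x)%R]) (G (m x) * - dm x)%:E)%E.
  apply: H.
- move=> t /andP[et _]; have t0 : 0 < t by rewrite (lt_le_trans e0).
  have tn0 : t != 0 by rewrite gt_eqF.
  have H1 : is_derive t 1 (fun t : R => t ^+ 2) (2 * t).
    by apply: is_derive_eq; rewrite /GRing.scale/=; ring.
  have H2 := is_derive_inv (fun t : R => t ^+ 2) t 1 (2 * t) (expf_neq0 2 tn0) H1.
  have H3 : is_derive t 1 d (- (2 * x)).
    by rewrite /d; apply: is_derive_eq; rewrite /GRing.scale/=; ring.
  rewrite /m /dm; apply: is_derive_eq.
  by rewrite /GRing.scale/= /d; field.
- move=> t /andP[et _]; have t0 : 0 < t by rewrite (lt_le_trans e0).
  have tn0 : t != 0 by rewrite gt_eqF.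
  have H1 : is_derive t 1 (fun t : R => t ^+ 3) (3 * t ^+ 2).
    by apply: is_derive_eq; rewrite /GRing.scale/=; ring.
  have H2 := is_derive_inv (fun t : R => t ^+ 3) t 1 (3 * t ^+ 2) (expf_neq0 3 tn0) H1.
  by apply/differentiable_continuous/derivable1_diffP; rewrite /dm; apply: ex_derive.
- move=> t /andP[/ltW et /ltW tx]; have t0 : 0 < t by rewrite (lt_le_trans e0).
  by rewrite /dm oppr_lt0 divr_gt0 ?exprn_gt0// mulr_gt0// cx0// ltW.
- move=> y /andP[y0 _].
  have c1 : {for y, continuous (fun y : R => pospow y s)} by exact: continuous_pospow.
  have y10 : 0 < 1 + y by rewrite ltr_wpDr.
  have c2 : {for y, continuous (fun y : R => (1 + y) `^ (- 1))}.
    apply: (@continuous_comp _ _ _ (fun y : R => 1 + y) (@powR R ^~ (- 1))).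
      by apply: continuousD; [exact: cst_continuous|].
    exact: continuous_powR.
  exact: (continuousM c1 c2).
rewrite -/f H.
  rewrite [X in (_ * X)%E](_ : _ = 2%:E * \int[mu]_(t in `[e, (1 - x)%R]) (f t)%:E)%E.
    by rewrite muleA -EFinM mulVf// mul1e.
  rewrite -ge0_integralZl//=.
  + apply: eq_integral => t; rewrite inE/= in_itv/= => /andP[et tx].
    by rewrite fE// EFinM.
  + exact: measurable_funTS.
  + move=> t /=; rewrite in_itv/= => /andP[et tx]; rewrite lee_fin.
    by rewrite -(pmulr_rge0 _ (ltr0n R 2)) -fE// mulr_ge0// dm0.
Qed.

Let corr (x t : R) : R := w (x + t) * (t `^ (- (2 * s)) / (1 - x ^+ 2 - 2 * x * t)).

(** The expression is affine in [t], with the positive values 1 - x^2 at t = 0 and (1-x)^2 at t = 1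
    - x. *)
Lemma quadratic_gt0 (x t : R) : -1 < x -> x < 1 -> 0 <= t -> t <= 1 - x ->
  0 < 1 - x ^+ 2 - 2 * x * t.
Proof.
move=> x1 x2 t0 tx; have [x0|x0] := leP x 0; first by nra.
by have := mulr_ge0 (ltW x0) (_ : 0 <= 1 - x - t); rewrite subr_ge0 => /(_ tx); nra.
Qed.

Lemma continuous_w (x y : R) : {for y, continuous (fun t : R => w (x + t))}.
Proof.
apply: (@continuous_comp _ _ _ (fun t : R => 1 - (x + t) ^+ 2) (fun c : R => pospow c s)).
  by apply/differentiable_continuous/derivable1_diffP; exact: ex_derive.
exact: continuous_pospow.
Qed.

Lemma continuous_corr (x y : R) : -1 < x -> x < 1 -> 0 < y -> y <= 1 - x ->
  {for y, continuous (corr x)}.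
Proof.
move=> x1 x2 y0 yx; have dy := quadratic_gt0 x y x1 x2 (ltW y0) yx.
have c2 := continuous_powR (- (2 * s)) y y0.
have c3 : {for y, continuous (fun t : R => (1 - x ^+ 2 - 2 * x * t)^-1)}.
  have H : is_derive y 1 (fun t : R => 1 - x ^+ 2 - 2 * x * t) (- (2 * x)).
    by apply: is_derive_eq; rewrite /GRing.scale/=; ring.
  have H2 := is_derive_inv (fun t : R => 1 - x ^+ 2 - 2 * x * t) y 1 _ (lt0r_neq0 dy) H.
  by apply/differentiable_continuous/derivable1_diffP; exact: ex_derive.
exact: (continuousM (continuous_w x y) (continuousM c2 c3)).
Qed.

(* The substitution is the Moebius involution of [-1, 1] that fixes [x] and
   exchanges its endpoints. *)
Lemma corr_substitution (x e : R) : -1 < x -> x < 1 -> 0 < e -> e <= 1 - x ->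
  (\int[mu]_(t in `[((1 - x ^+ 2) * e / (1 - x ^+ 2 - 2 * x * e))%R, (1 + x)%R]) (x * corr (- x) t)%:E =
   \int[mu]_(t in `[e, (1 - x)%R]) (x * corr x t)%:E)%E.
Proof.
move=> x1 x2 e0 ex.
pose c : R := 1 - x ^+ 2; pose d (t : R) : R := c - 2 * x * t.
have c0 : 0 < c by rewrite /c; nra.
pose F (t : R) : R := c * t / d t; pose dF (t : R) : R := c ^+ 2 / d t ^+ 2.
have d0 t : e <= t -> t <= 1 - x -> 0 < d t.
  by move=> et tx; apply: quadratic_gt0 => //; rewrite (le_trans (ltW e0)).
have F1 : F (1 - x) = 1 + x.
  have x2' : 1 - x != 0 by rewrite subr_eq0 gt_eqF.
  have dE : d (1 - x) = (1 - x) ^+ 2 by rewrite /d /c; ring.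
  by rewrite /F dE /c; field.
have Hd (t : R) : is_derive t 1 d (- (2 * x)).
  by rewrite /d; apply: is_derive_eq; rewrite /GRing.scale/=; ring.
have H1 : forall t, e <= t <= 1 - x -> is_derive t 1 F (dF t).
  move=> t /andP[et tx]; have dt := lt0r_neq0 (d0 t et tx).
  have H := is_derive_inv d t 1 _ dt (Hd t).
  by rewrite /F; apply: is_derive_eq; rewrite /dF /GRing.scale/= /d; field.
have H2 : forall t, e <= t <= 1 - x -> {for t, continuous dF}.
  move=> t /andP[et tx]; have dt := lt0r_neq0 (d0 t et tx).
  have H3 : is_derive t 1 (fun t => d t ^+ 2) (2 * d t * - (2 * x)).
    by apply: is_derive_eq; rewrite /GRing.scale/=; ring.
  have H4 := is_derive_inv (fun t => d t ^+ 2) t 1 _ (expf_neq0 2 dt) H3.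
  by apply/differentiable_continuous/derivable1_diffP; rewrite /dF; apply: ex_derive.
have := substitution_increasing F dF (fun y => x * corr (- x) y) e (1 - x) ex H1 H2.
rewrite F1 => H; rewrite {}H.
- apply: eq_integral => t; rewrite inE/= in_itv/= => /andP[et tx]; congr EFin.
  have t0 : 0 < t by rewrite (lt_le_trans e0).
  have dt := d0 t et tx.
  rewrite -mulrA; congr (_ * _); rewrite /corr sqrrN.
  (* In [corr (- x) (F t)] the profile gains the factor (c/d)^(2s), the power of [t] gains
     (c/d)^(-2s), and the denominator becomes c^2/d. Multiplied by the derivative c^2/d^2, this
     leaves [corr x t]. *)
  have -> : 1 - x ^+ 2 - 2 * - x * F t = c ^+ 2 / d t.
    by rewrite /F -/c /d; field; rewrite gt_eqF.
  have -> : w (- x + F t) = (c / d t) `^ (2 * s) * w (x + t).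
    rewrite /w (_ : 1 - (- x + F t) ^+ 2 = (c / d t) ^+ 2 * (1 - (x + t) ^+ 2)); last first.
      by rewrite /F /d /c; field; rewrite gt_eqF.
    rewrite pospowM ?sqr_ge0//; congr (_ * _).
    by rewrite -(powR_mulrn 2) ?divr_ge0 ?(ltW c0) ?(ltW dt)// -powRrM.
  have -> : F t = (c / d t) * t by rewrite /F mulrAC.
  rewrite (@powRM _ (c / d t) t) ?divr_ge0 ?(ltW c0) ?(ltW dt) ?(ltW t0)// (powRN (c / d t)).
  rewrite -/(d t) -/c /dF.
  by field; rewrite !gt_eqF// powR_gt0 ?divr_gt0.
- move=> t /andP[/ltW et /ltW tx].
  by rewrite /dF divr_gt0 ?exprn_gt0// d0.
- move=> y /andP[Fy yx].
  have y0 : 0 < y.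
    by rewrite (lt_le_trans _ Fy)// /F divr_gt0 ?mulr_gt0// d0.
  have co : {for y, continuous (corr (- x))}.
    by apply: continuous_corr; rewrite ?opprK//; lra.
  have cx : {for y, continuous (fun _ : R => x)} by exact: cst_continuous.
  exact: (continuousM cx co).
Qed.

Let phi (t : R) := t `^ (- (1 + 2 * s)).

Lemma w_even (y : R) : w (- y) = w y.
Proof. by rewrite /w sqrrN. Qed.

Lemma w_ge0 (y : R) : 0 <= w y.
Proof. exact: pospow_ge0. Qed.

Lemma w_le1 (y : R) : w y <= 1.
Proof. by apply: ler_pospow_le1 => //; rewrite gerBl sqr_ge0. Qed.

Lemma w_second_difference (x : R) : 0 <= x -> x < 1 -> exists2 K : R, 0 <= K & forall e : R, 0 <= e ->
  `|2 * w x - w (x + e) - w (x - e)| <= K * Num.min 1 (e ^+ 2).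
Proof.
move=> x0 x1.
have c0 : 0 < 1 - x ^+ 2 by nra.
set c := 1 - x ^+ 2 in c0.
(* The first two terms are the Taylor estimate with p = 2xe and q = e^2 for e < 1, where p^2 + q^2
   <= 5 e^2. The 4 covers e >= 1, because [w] takes values in [0, 1]. *)
pose K := 2 * s * c `^ (s - 1) + 10 * c `^ (s - 2) + 4.
exists K; first by rewrite /K !addr_ge0// !mulr_ge0 ?powR_ge0// ltW.
move=> e e0.
have K1 : 0 <= 2 * s * c `^ (s - 1) by rewrite !mulr_ge0 ?powR_ge0// ltW.
have K2 : 0 <= c `^ (s - 2) by rewrite powR_ge0.
have [e1|e1] := leP 1 e.
  have -> : Num.min 1 (e ^+ 2) = 1 by apply/min_idPl; nra.
  have := w_ge0 x; have := w_ge0 (x + e); have := w_ge0 (x - e).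
  have := w_le1 x; have := w_le1 (x + e); have := w_le1 (x - e).
  by move=> *; rewrite mulr1 ler_norml /K; apply/andP; split; nra.
have -> : Num.min 1 (e ^+ 2) = e ^+ 2 by apply/min_idPr; nra.
have := pospow_second_difference s c (2 * x * e) (e ^+ 2) s0 s1 c0.
have -> : c + 2 * x * e - e ^+ 2 = 1 - (x - e) ^+ 2 by rewrite /c; ring.
have -> : c - 2 * x * e - e ^+ 2 = 1 - (x + e) ^+ 2 by rewrite /c; ring.
rewrite -/(w x) -/(w (x + e)) -/(w (x - e)) addrAC => /le_trans; apply.
rewrite (ger0_norm (sqr_ge0 e)) /K.
set k1 := c `^ (s - 1) in K1 *; set k2 := c `^ (s - 2) in K2 *.
have h1 : (2 * x * e) ^+ 2 + (e ^+ 2) ^+ 2 <= 5 * e ^+ 2.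
  have : x ^+ 2 <= 1 by nra.
  have : e ^+ 2 <= 1 by nra.
  have := sqr_ge0 e; nra.
have h2 : 2 * k2 * ((2 * x * e) ^+ 2 + (e ^+ 2) ^+ 2) <= 2 * k2 * (5 * e ^+ 2).
  by rewrite ler_wpM2l// mulr_ge0.
have := sqr_ge0 e; lra.
Qed.

Lemma measurable_phi : measurable_fun setT phi.
Proof. exact: measurable_powR. Qed.

Lemma measurable_w_shift x : measurable_fun setT (fun t : R => w (x + t)).
Proof.
apply: measurable_fun_pospow; apply: measurable_funB => //.
by apply: measurable_funX; exact: measurable_funD.
Qed.

Lemma measurable_wphi x : measurable_fun setT (fun t : measurableTypeR R => (w (x + t) * phi t)%:E).
Proof.
apply/measurable_EFinP; apply: measurable_funM; last exact: measurable_phi.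
exact: measurable_w_shift.
Qed.

Lemma measurable_corr x : measurable_fun setT (fun t : measurableTypeR R => (corr x t)%:E).
Proof.
apply/measurable_EFinP; apply: measurable_funM; first exact: measurable_w_shift.
apply: measurable_funM; first exact: measurable_powR.
by apply: measurable_fun_inv; apply: measurable_funB => //; exact: measurable_funM.
Qed.

Lemma integral_w_tail (x e : R) : -1 < x -> x < 1 -> 0 < e -> e <= 1 - x ->
  (\int[mu]_(t in `[e, +oo[) (w (x + t) * phi t)%:E =
   \int[mu]_(t in `[e, (1 - x)%R]) (w (x + t) * phi t)%:E)%E.
Proof.
move=> x1 x2 e0 ex.
have -> : `[e, +oo[%classic = `[e, 1 - x]%classic `|` `]1 - x, +oo[%classic.
  by rewrite -itv_bndbnd_setU ?bnd_simp.
rewrite ge0_integral_setU//=.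
- rewrite [X in (_ + X)%E]integral0_eq ?adde0// => t /=; rewrite in_itv/= andbT => xt.
  by rewrite /w pospow_le0 ?mul0r//; nra.
- by apply: measurable_funTS; exact: measurable_wphi.
- by move=> t _; rewrite lee_fin mulr_ge0 ?powR_ge0.
- rewrite disj_set2E; apply/eqP/seteqP; split => // t /=; rewrite !in_itv/= andbT.
  by move=> [/andP[_ t1] /lt_geF]; rewrite t1.
Qed.

Lemma corr_ge0 (x t : R) : -1 < x -> x < 1 -> 0 <= t -> t <= 1 - x -> 0 <= corr x t.
Proof.
move=> x1 x2 t0 tx; rewrite /corr mulr_ge0 ?powR_ge0// divr_ge0 ?powR_ge0//.
by rewrite ltW// quadratic_gt0.
Qed.

(** The involution maps [e, 1 - x] onto [T, 1 + x] with [T] slightly larger than [e], so the two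
    integrals differ by the one over [e, T[. This interval has length 2 x e^2/d with d >= (1-x)^2,
    and the integrand there is at most e^(-2s)/(1-x^2). *)
Lemma corr_integral_gap (x e : R) : 0 <= x -> x < 1 -> 0 < e -> e <= (1 - x) / 2 -> exists2 z : R,
  (\int[mu]_(t in `[e, (1 + x)%R]) (x * corr (- x) t)%:E =
   z%:E + \int[mu]_(t in `[e, (1 - x)%R]) (x * corr x t)%:E)%E &
  0 <= z <= 2 / (1 - x ^+ 2) / (1 - x) ^+ 2 * (e `^ (- (2 * s)) * e ^+ 2).
Proof.
move=> x0 x1 e0 ex.
have xN : -1 < x by lra.
have ex' : e <= 1 - x by lra.
pose c : R := 1 - x ^+ 2; pose d : R := c - 2 * x * e.
have c0 : 0 < c by rewrite /c; nra.
have x10 : 0 < (1 - x) ^+ 2 by rewrite exprn_gt0// subr_gt0.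
have dle : (1 - x) ^+ 2 <= d.
  have := mulr_ge0 x0 (_ : 0 <= 1 - x - e); rewrite subr_ge0 => /(_ ex').
  by rewrite /d /c; nra.
have d0 : 0 < d by rewrite (lt_le_trans x10).
pose T := c * e / d.
have TE : T - e = 2 * x * e ^+ 2 / d by rewrite /T /d; field; rewrite gt_eqF.
have eT : e <= T by rewrite -subr_ge0 TE (divr_ge0 (mulr_ge0 (mulr_ge0 (ler0n R 2) x0) (sqr_ge0 e)) (ltW d0)).
have Tx : T <= 1 + x.
  rewrite /T ler_pdivrMr// -subr_ge0.
  have -> : (1 + x) * d - c * e = (1 + x) ^+ 2 * (1 - x - e) by rewrite /d /c; ring.
  by rewrite mulr_ge0 ?sqr_ge0// subr_ge0.
have mo : measurable_fun setT (fun t : measurableTypeR R => (x * corr (- x) t)%:E).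
  by under eq_fun do rewrite EFinM; apply: emeasurable_funM => //; exact: measurable_corr.
have g0 t : e <= t -> t <= 1 + x -> 0 <= corr (- x) t.
  by move=> et tx; apply: corr_ge0; rewrite ?opprK//; lra.
rewrite -(corr_substitution x e xN x1 e0 ex') -/c -/d -/T.
pose Z := (\int[mu]_(t in `[e, T[) (x * corr (- x) t)%:E)%E.
have Z0 : (0 <= Z)%E.
  apply: integral_ge0 => t /=; rewrite in_itv/= => /andP[et tT].
  by rewrite lee_fin mulr_ge0// g0// ltW// (lt_le_trans tT).
have ZE : (\int[mu]_(t in `[e, (1 + x)%R]) (x * corr (- x) t)%:E =
    Z + \int[mu]_(t in `[T, (1 + x)%R]) (x * corr (- x) t)%:E)%E.
  rewrite /Z -ge0_integral_setU//=.
  - by rewrite -itv_bndbnd_setU ?bnd_simp.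
  - by apply: measurable_funTS.
  - move=> t /= [|] /=; rewrite in_itv/= => /andP[h1 h2]; rewrite lee_fin mulr_ge0// g0//.
      by rewrite ltW// (lt_le_trans h2).
    by rewrite (le_trans eT).
  - rewrite disj_set2E; apply/eqP/seteqP; split => // t /=; rewrite !in_itv/=.
    by move=> [/andP[_ t1] /andP[/(lt_le_trans t1)]]; rewrite ltxx.
set E := e `^ (- (2 * s)).
have E0 : 0 < E by rewrite powR_gt0.
have Zle : (Z <= (2 / c / (1 - x) ^+ 2 * (E * e ^+ 2))%:E)%E.
  apply: (@le_trans _ _ (\int[mu]_(t in `[e, T[) (cst (E / c)%:E t))%E).
    apply: ge0_le_integral => //.
    - move=> t /=; rewrite in_itv/= => /andP[et tT].
      by rewrite lee_fin mulr_ge0// g0// ltW// (lt_le_trans tT).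
    - by apply: measurable_funTS.
    - move=> t /=; rewrite in_itv/= => /andP[et tT]; rewrite lee_fin.
      have t0 : 0 < t by rewrite (lt_le_trans e0).
      have tx : t <= 1 + x by rewrite ltW// (lt_le_trans tT).
      have o0 := g0 t et tx.
      apply: (@le_trans _ _ (corr (- x) t)); first by rewrite ler_piMl// ltW.
      rewrite /corr -[leRHS]mul1r; apply: ler_pM.
      + exact: w_ge0.
      + by rewrite divr_ge0 ?powR_ge0// ltW// quadratic_gt0 ?opprK//; lra.
      + exact: w_le1.
      + apply: ler_pM; rewrite ?powR_ge0 ?invr_ge0//.
        * by rewrite ltW// quadratic_gt0 ?opprK//; lra.
        * rewrite /E !powRN lef_pV2 ?posrE ?powR_gt0// ge0_ler_powR// ?nnegrE ?(ltW e0) ?(ltW t0)//.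
          by rewrite mulr_ge0// ltW.
        * have h : c <= 1 - (- x) ^+ 2 - 2 * - x * t by rewrite /c sqrrN; nra.
          by rewrite lef_pV2 ?posrE// (lt_le_trans c0).
  rewrite integral_cst//= lebesgue_measure_itv/= lte_fin.
  case: ifPn => [_|_]; last first.
    by rewrite mule0 lee_fin ltW// mulr_gt0 ?divr_gt0// mulr_gt0// exprn_gt0.
  rewrite -EFinB -EFinM lee_fin TE.
  have -> : E / c * (2 * x * e ^+ 2 / d) = 2 / c * (x / d) * (E * e ^+ 2) by field; rewrite !gt_eqF.
  rewrite ler_wpM2r ?(mulr_ge0 (ltW E0) (sqr_ge0 e))// ler_wpM2l ?divr_ge0 ?(ltW c0)//.
  by rewrite -[leRHS]mul1r ler_pM ?invr_ge0 ?(ltW d0) ?(ltW x1)// lef_pV2 ?posrE.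
exists (fine Z); first by rewrite ZE fineK// ge0_fin_numE// (le_lt_trans Zle)// ltry.
have ZF : Z = (fine Z)%:E by rewrite fineK// ge0_fin_numE// (le_lt_trans Zle)// ltry.
by move: Z0 Zle; rewrite ZF !lee_fin => -> ->.
Qed.

(** The two half-lines contribute (j1 + j2)/2 + z: the [j] are values of [J], and the corrections
    cancel up to the gap [z]. Replacing each [j] by w(e + x) e^(-2s)/s - B, respectively w(e - x)
    e^(-2s)/s - B, turns the left side into a second difference of [w] with step [e], times
    e^(-2s)/(2s). *)
Lemma truncated_bound (x : R) : 0 <= x -> x < 1 -> exists2 K : R, 0 <= K &
  forall e : R, 0 < e -> e <= (1 - x) / 2 -> exists2 p : R,
    (\int[mu]_(t in `[e, +oo[) (w (x + t) * phi t)%:E +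
     \int[mu]_(t in `[e, +oo[) (w (- x + t) * phi t)%:E = p%:E)%E &
    `|w x * e `^ (- (2 * s)) / s - p - B| <= K * (e `^ (- (2 * s)) * e ^+ 2).
Proof.
move=> x0 x1.
have [K0 K00 HK0] := w_second_difference x x0 x1.
pose Kz := 2 / (1 - x ^+ 2) / (1 - x) ^+ 2.
pose dl : R := (1 - x) / 2.
have dl0 : 0 < dl by rewrite /dl; lra.
have Kz0 : 0 <= Kz by rewrite /Kz !divr_ge0 ?sqr_ge0//; nra.
pose Kt := dl `^ (s - 1) / (1 - s).
have Kt0 : 0 <= Kt by rewrite /Kt divr_ge0 ?powR_ge0// subr_ge0 ltW.
(* Three errors add up: the second difference of [w], the tails of the Beta integrals, and the gap
   between the corrections. *)
exists (K0 / (2 * s) + Kt + Kz).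
  by rewrite !addr_ge0// divr_ge0// mulr_ge0// ltW.
move=> e e0 ex.
have [xN ex' xN1 xN2 exN] : [/\ -1 < x, e <= 1 - x, -1 < - x, - x < 1 & e <= 1 - (- x)] by split; lra.
set E := e `^ (- (2 * s)).
have E0 : 0 < E by rewrite powR_gt0.
have e20 : 0 < e ^+ 2 by rewrite exprn_gt0.
have EK : e `^ (-1) = e^-1 by rewrite powR_inv1// ltW.
(* For M = (1 - (y+e)^2)/e^2 the leading term M^s is w(y+e) e^(-2s). The tail M^(s-1) has the extra
   factor e^2, and s - 1 < 0 lets the base be replaced by its lower bound [dl]. *)
have mbound (y : R) : 1 - (y + e) ^+ 2 >= dl -> exists2 j : R,
    J ((1 - (y + e) ^+ 2) / e ^+ 2) = j%:E &
    w (y + e) * E / s - B <= j <= w (y + e) * E / s - B + Kt * (E * e ^+ 2).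
  move=> yd; have y0 : 0 < 1 - (y + e) ^+ 2 by rewrite (lt_le_trans dl0).
  have M0 : 0 < (1 - (y + e) ^+ 2) / e ^+ 2 by rewrite divr_gt0.
  have [j jE jb] := truncated_beta_bounds _ M0; exists j => //.
  have MsE : ((1 - (y + e) ^+ 2) / e ^+ 2) `^ s = w (y + e) * E.
    rewrite powRM ?invr_ge0 ?(ltW y0) ?(ltW e20)// /w pospowE ?(ltW y0)//.
    rewrite /E; congr (_ * _).
    by rewrite -exprVn -EK -(powR_mulrn 2 (powR_ge0 _ _)) -!powRrM; congr (_ `^ _); ring.
  have := jb; rewrite MsE => /andP[-> h] /=; apply: (le_trans h).
  rewrite lerD2l /Kt powR_splitB1// MsE.
  rewrite [leRHS]mulrAC ler_wpM2r ?invr_ge0 ?subr_ge0 ?(ltW s1)//.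
  have -> : w (y + e) * E / ((1 - (y + e) ^+ 2) / e ^+ 2) =
    (1 - (y + e) ^+ 2) `^ (s - 1) * (E * e ^+ 2).
    by rewrite /w pospowE ?(ltW y0)// powR_splitB1//; field; rewrite !gt_eqF.
  rewrite ler_wpM2r ?(mulr_ge0 (ltW E0) (ltW e20))//.
  have -> : s - 1 = - (1 - s) by rewrite opprB.
  rewrite !powRN lef_pV2 ?posrE ?powR_gt0//.
  have s10 : 0 <= 1 - s by rewrite subr_ge0 ltW.
  by apply: ge0_ler_powR; rewrite ?nnegrE ?s10 ?(ltW dl0) ?(ltW y0).
have [j1 J1 b1] : exists2 j : R, J ((1 - (x + e) ^+ 2) / e ^+ 2) = j%:E &
    w (x + e) * E / s - B <= j <= w (x + e) * E / s - B + Kt * (E * e ^+ 2).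
  by apply: mbound; rewrite /dl; nra.
have [j2 J2 b2] : exists2 j : R, J ((1 - (- x + e) ^+ 2) / e ^+ 2) = j%:E &
    w (- x + e) * E / s - B <= j <= w (- x + e) * E / s - B + Kt * (E * e ^+ 2).
  by apply: mbound; rewrite /dl; nra.
have [z zE zb] := corr_integral_gap x e x0 x1 e0 ex.
have S1 := integral_quadratic_substitution x e xN x1 e0 ex'.
have S2 := integral_quadratic_substitution (- x) e xN1 xN2 e0 exN.
rewrite J1 -EFinM in S1; rewrite J2 -EFinM in S2.
rewrite integral_w_tail// integral_w_tail// opprK.
move: S1 S2 zE.
have mxo y : measurable_fun setT (fun t : measurableTypeR R => (x * corr y t)%:E).
  by under eq_fun do rewrite EFinM; apply: emeasurable_funM => //; exact: measurable_corr.
have phiE t : 0 < t -> phi t = t `^ (- (2 * s)) / t.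
  by move=> t0; rewrite /phi -powR_splitB1//; congr (_ `^ _); ring.
set X := (\int[mu]_(t in `[e, (1 - x)%R]) (x * corr x t)%:E)%E.
set Y := (\int[mu]_(t in `[e, (1 + x)%R]) (x * corr (- x) t)%:E)%E.
set P1 := (\int[mu]_(t in `[e, (1 - x)%R]) (w (x + t) * phi t)%:E)%E.
set P2 := (\int[mu]_(t in `[e, (1 + x)%R]) (w (- x + t) * phi t)%:E)%E.
have P10 : (0 <= P1)%E.
  by apply: integral_ge0 => t _; rewrite lee_fin mulr_ge0 ?powR_ge0.
have X0 : (0 <= X)%E.
  apply: integral_ge0 => t /=; rewrite in_itv/= => /andP[et tx]; rewrite lee_fin mulr_ge0//.
  by rewrite corr_ge0// (le_trans (ltW e0)).
rewrite (_ : (\int[mu]_(_ in `[e, (1 - x)%R]) _ = P1 + X)%E); last first.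
  rewrite -ge0_integralD//=.
  - apply: eq_integral => t _; rewrite -EFinD; congr EFin.
    by rewrite /phi /corr; ring.
  - by move=> t _; rewrite lee_fin mulr_ge0 ?powR_ge0.
  - by apply: measurable_funTS; exact: measurable_wphi.
  - move=> t /=; rewrite in_itv/= => /andP[et tx]; rewrite lee_fin mulr_ge0//.
    by rewrite corr_ge0// (le_trans (ltW e0)).
  - exact: measurable_funTS.
rewrite opprK.
set Q := (\int[mu]_(_ in _) _)%E => S1 S2.
(* At [- x] the correction enters with a minus sign. Moving it to the other side leaves a sum of
   nonnegative integrals, which is additive without knowing finiteness. *)
have P2E : (P2 = Q + Y)%E.
  rewrite /Q /Y -ge0_integralD//=.
  - apply: eq_integral => t _; rewrite -EFinD; congr EFin.
    by rewrite /phi /corr; ring.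
  - move=> t /=; rewrite in_itv/= => /andP[et tx]; rewrite lee_fin mulr_ge0 ?w_ge0//.
    have t0 : 0 < t by rewrite (lt_le_trans e0).
    rewrite -/(phi t) phiE//.
    have D0 : 0 < 1 - (- x) ^+ 2 - 2 * - x * t by apply: quadratic_gt0; rewrite ?opprK// ltW.
    have -> : t `^ (- (2 * s)) / t + - x * (t `^ (- (2 * s)) / (1 - (- x) ^+ 2 - 2 * - x * t)) =
      t `^ (- (2 * s)) * ((1 - x ^+ 2 + x * t) / (t * (1 - (- x) ^+ 2 - 2 * - x * t))).
      by field; rewrite !gt_eqF.
    by rewrite mulr_ge0 ?powR_ge0// divr_ge0//; [nra|rewrite mulr_ge0// ltW].
  - by apply: measurable_funTS; exact: measurable_quadratic.
  - move=> t /=; rewrite in_itv/= => /andP[et tx]; rewrite lee_fin mulr_ge0//.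
    by rewrite corr_ge0 ?opprK// (le_trans (ltW e0)).
  - exact: measurable_funTS.
move=> zE; rewrite P2E S2 zE.
(* [P1] and [X] are nonnegative with a finite sum, so both are finite, and [X] can be cancelled. *)
move: P10 X0 S1; case: (P1) => [p1| |]//=; case: (X) => [X'| |]//= _ _; rewrite -EFinD => -[S1].
rewrite -!EFinD; eexists; first reflexivity.
have D := HK0 e (ltW e0).
have De : `|2 * w x - w (x + e) - w (- x + e)| <= K0 * e ^+ 2.
  have -> : w (- x + e) = w (x - e) by rewrite -w_even opprD opprK.
  by apply: (le_trans D); rewrite ler_wpM2l// ge_min lexx orbT.
have De' : `|(2 * w x - w (x + e) - w (- x + e)) * E / (2 * s)| <= K0 / (2 * s) * (E * e ^+ 2).
  rewrite -mulrA normrM (ger0_norm (x := E / _)); last by rewrite divr_ge0 ?(ltW E0)// mulr_ge0// ltW.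
  have -> : K0 / (2 * s) * (E * e ^+ 2) = K0 * e ^+ 2 * (E / (2 * s)) by ring.
  by rewrite ler_wpM2r// divr_ge0 ?(ltW E0)// mulr_ge0// ltW.
set Ee := E * e ^+ 2 in b1 b2 zb De' *.
have hs : (2 * w x - w (x + e) - w (- x + e)) * E / (2 * s) =
  w x * E / s - (w (x + e) * E / s) / 2 - (w (- x + e) * E / s) / 2 by field; rewrite gt_eqF.
rewrite hs in De'.
move: De' b1 b2 zb; rewrite !ler_norml -/Kz => /andP[d1 d2] /andP[a1 a2] /andP[a3 a4] /andP[a5 a6].
set u0 := w x * E / s in d1 d2 *; set u1 := w (x + e) * E / s in d1 d2 a1 a2 *.
set u2 := w (- x + e) * E / s in d1 d2 a3 a4 *.
have KtE : 0 <= Kt * Ee by rewrite mulr_ge0// /Ee mulr_ge0// ltW.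
by apply/andP; split; lra.
Qed.

Lemma measurable_min1X2 d (T : measurableType d) (f : T -> R) : measurable_fun setT f ->
  measurable_fun setT (fun t => Num.min 1 (f t ^+ 2)).
Proof. by move=> mf; apply: measurable_minr => //; exact: measurable_funX. Qed.

Lemma integral_min1X2_phi :
  (\int[mu]_(t in `]0%R, +oo[) (Num.min 1 (t ^+ 2) * phi t)%:E = (1 / (2 - 2 * s) + 1 / (2 * s))%:E)%E.
Proof.
have p0 : 0 < 2 - 2 * s by move: s1; lra.
have p1 : 0 < 2 * s by rewrite mulr_gt0.
have mG : measurable_fun setT (fun t : measurableTypeR R => (Num.min 1 (t ^+ 2) * phi t)%:E).
  apply/measurable_EFinP; apply: measurable_funM; last exact: measurable_phi.
  exact: measurable_min1X2.
have -> : `]0%R : R, +oo[%classic = `]0%R, 1%R]%classic `|` `]1%R, +oo[%classic.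
  by rewrite -itv_bndbnd_setU ?bnd_simp.
rewrite ge0_integral_setU//=; last 3 first.
- by apply: measurable_funTS; exact: mG.
- by move=> t _; rewrite lee_fin mulr_ge0 ?powR_ge0// le_min ler01 sqr_ge0.
- rewrite disj_set2E; apply/eqP/seteqP; split => // t /=; rewrite !in_itv/= andbT.
  by move=> [/andP[_ t1] /lt_geF]; rewrite t1.
rewrite [X in (_ + X)%E]integral_itv_obnd_cbnd; last by apply: measurable_funTS; exact: mG.
rewrite EFinD; congr (_ + _)%E.
  transitivity (\int[mu]_(t in `]0%R, 1%R]) (t `^ (2 - 2 * s - 1))%:E)%E.
    apply: eq_integral => t; rewrite inE/= in_itv/= => /andP[t0 t1]; congr EFin.
    have -> : Num.min 1 (t ^+ 2) = t `^ 2.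
      by rewrite powR_mulrn ?(ltW t0)//; apply/min_idPr; nra.
    rewrite /phi -powRD; last by rewrite (gt_eqF t0) implybT.
    by congr (_ `^ _); ring.
  by rewrite integral_powR_oc// powR1.
transitivity (\int[mu]_(t in `[1%R, +oo[) (t `^ (- (2 * s) - 1))%:E)%E.
  apply: eq_integral => t; rewrite inE/= in_itv/= andbT => t1; congr EFin.
  have -> : Num.min 1 (t ^+ 2) = 1 by apply/min_idPl; nra.
  by rewrite mul1r /phi; congr (_ `^ _); ring.
by rewrite integral_powR_cy// powR1.
Qed.

(** By evenness of [w] one may take x >= 0. The second difference is dominated by K min(1, t^2), so
    the integral is a real number [L]; it is then compared with [B] by cutting at [e] and letting
    [e] tend to 0. *)
Lemma integral_second_difference (x : R) : -1 < x -> x < 1 ->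
  (\int[mu]_(t in `]0%R, +oo[) ((2 * w x - w (x + t) - w (x - t)) * phi t)%:E = B%:E)%E.
Proof.
wlog x0 : x / 0 <= x.
  move=> H x1 x2; have [x0|x0] := leP 0 x; first exact: H.
  have [y0 y1 y2] : [/\ 0 <= - x, -1 < - x & - x < 1] by split; lra.
  rewrite -(H (- x) y0 y1 y2).
  apply: eq_integral => t _; rewrite w_even.
  have -> : w (- x + t) = w (x - t) by rewrite -w_even opprD opprK.
  have -> : w (- x - t) = w (x + t) by rewrite -w_even opprB opprK addrC.
  by congr (_ * _)%:E; ring.
move=> _ x1.
pose h (t : R) := (2 * w x - w (x + t) - w (x - t)) * phi t.
have [K K0 HK] := w_second_difference x x0 x1.
have mh : measurable_fun setT (fun t : measurableTypeR R => (h t)%:E).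
  apply/measurable_EFinP; apply: measurable_funM; last exact: measurable_phi.
  apply: measurable_funB; first by apply: measurable_funB => //; exact: measurable_w_shift.
  apply: measurable_fun_pospow; apply: measurable_funB => //.
  by apply: measurable_funX; exact: measurable_funB.
have hle (t : R) : 0 < t -> `|h t| <= K * (Num.min 1 (t ^+ 2) * phi t).
  move=> t0; rewrite /h normrM (ger0_norm (powR_ge0 _ _)) mulrA.
  by rewrite ler_wpM2r ?powR_ge0// HK// ltW.
have mm : measurable_fun setT (fun t : measurableTypeR R => (Num.min 1 (t ^+ 2) * phi t)%:E).
  apply/measurable_EFinP; apply: measurable_funM; last exact: measurable_phi.
  exact: measurable_min1X2.
have ih : mu.-integrable `]0%R, +oo[ (fun t => (h t)%:E).
  apply/integrableP; split; first by apply: measurable_funTS; exact: mh.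
  apply: (@le_lt_trans _ _ (\int[mu]_(t in `]0%R, +oo[) (K%:E * (Num.min 1 (t ^+ 2) * phi t)%:E))%E).
    apply: ge0_le_integral => //.
    - by apply: measurable_funTS; apply: measurableT_comp => //; exact: mh.
    - by apply: measurable_funTS; apply: emeasurable_funM.
    - move=> t /=; rewrite in_itv/= andbT => t0.
      by rewrite -EFinM lee_fin hle.
  rewrite ge0_integralZl//=.
  - by rewrite integral_min1X2_phi -EFinM ltry.
  - by apply: measurable_funTS; exact: mm.
  - by move=> t _; rewrite lee_fin mulr_ge0 ?powR_ge0// le_min ler01 sqr_ge0.
have /fineK LE : (\int[mu]_(t in `]0%R, +oo[) (h t)%:E)%E \is a fin_num.
  exact: integrable_fin_num.
set L := fine _ in LE.
have [K2 K20 HK2] := truncated_bound x x0 x1.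
(* The part over ]0, e] is at most K e^(2-2s)/(2-2s). Beyond [e] the three terms are integrable
   separately, and [truncated_bound] applies. *)
have main (e : R) : 0 < e -> e <= (1 - x) / 2 ->
    `|L - B| <= (K / (2 - 2 * s) + K2) * e `^ (2 - 2 * s).
  move=> e0 ex.
  have [p pE pb] := HK2 e e0 ex.
  have EE : e `^ (2 - 2 * s) = e `^ (- (2 * s)) * e ^+ 2.
    rewrite -(powR_mulrn 2 (ltW e0)) -powRD; last by rewrite (gt_eqF e0) implybT.
    by congr (_ `^ _); ring.
  have spl : `]0%R : R, +oo[%classic = `]0%R, e]%classic `|` `]e, +oo[%classic.
    by rewrite -itv_bndbnd_setU ?bnd_simp// ltW.
  move: LE; rewrite spl integral_setU//=; last 2 first.
  - by apply: measurable_funTS; exact: mh.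
  - rewrite disj_set2E; apply/eqP/seteqP; split => // t /=; rewrite !in_itv/= andbT.
    by move=> [/andP[_ t1] /lt_geF]; rewrite t1.
  rewrite [X in (_ + X)%E]integral_itv_obnd_cbnd; last by apply: measurable_funTS; exact: mh.
  have p0 : 0 < 2 - 2 * s by move: s1; lra.
  have p1 : 0 < 2 * s by rewrite mulr_gt0.
  have : (`|\int[mu]_(t in `]0%R, e]) (h t)%:E| <= (K * (e `^ (2 - 2 * s) / (2 - 2 * s)))%:E)%E.
    apply: (le_trans (le_abse_integral _ _ _)) => //.
      by apply: measurable_funTS; exact: mh.
    rewrite EFinM -integral_powR_oc// -ge0_integralZl//=; last 2 first.
    - by apply/measurable_funTS/measurable_EFinP; exact: measurable_powR.
    - by move=> t _; rewrite lee_fin powR_ge0.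
    apply: ge0_le_integral => //.
    - apply/measurable_funTS/measurable_EFinP; apply: measurableT_comp => //.
      exact/measurable_EFinP.
    - apply/measurable_funTS; apply: emeasurable_funM => //.
      by apply/measurable_EFinP; exact: measurable_powR.
    - move=> t /=; rewrite in_itv/= => /andP[t0 _]; rewrite -EFinM lee_fin.
      apply: (le_trans (hle t t0)); rewrite ler_wpM2l//.
      have -> : t `^ (2 - 2 * s - 1) = t `^ 2 * phi t.
        rewrite /phi -powRD; last by rewrite (gt_eqF t0) implybT.
        by congr (_ `^ _); ring.
      by rewrite ler_wpM2r ?powR_ge0// powR_mulrn ?(ltW t0)// ge_min lexx orbT.
  have ph0 (t : R) : 0 <= phi t by exact: powR_ge0.
  have phiE : (\int[mu]_(t in `[e, +oo[) (2 * w x * phi t)%:E = (w x * e `^ (- (2 * s)) / s)%:E)%E.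
    under eq_integral do rewrite EFinM.
    rewrite ge0_integralZl//=; last 3 first.
    - by apply/measurable_funTS/measurable_EFinP; exact: measurable_phi.
    - by move=> t _; rewrite lee_fin.
    - by rewrite lee_fin mulr_ge0// w_ge0.
    rewrite (eq_integral (fun t : measurableTypeR R => (t `^ (- (2 * s) - 1))%:E)); last first.
      by move=> t _; rewrite /phi; congr (_ `^ _)%:E; ring.
    by rewrite integral_powR_cy// -EFinM; congr EFin; field; rewrite gt_eqF.
  have m1 : measurable_fun setT (fun t : measurableTypeR R => (2 * w x * phi t)%:E).
    by apply/measurable_EFinP; apply: measurable_funM => //; exact: measurable_phi.
  have m2 : measurable_fun setT (fun t : measurableTypeR R => ((w (x + t) + w (- x + t)) * phi t)%:E).
    apply/measurable_EFinP; apply: measurable_funM; last exact: measurable_phi.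
    by apply: measurable_funD; exact: measurable_w_shift.
  have i1 : mu.-integrable `[e, +oo[ (EFin \o (fun t : R => 2 * w x * phi t)).
    apply/integrableP; split; first by apply: measurable_funTS; exact: m1.
    rewrite (eq_integral (fun t : measurableTypeR R => (2 * w x * phi t)%:E)) ?phiE ?ltry//.
    by move=> t _; rewrite gee0_abs// lee_fin !mulr_ge0// w_ge0.
  have pE' : (\int[mu]_(t in `[e, +oo[) ((w (x + t) + w (- x + t)) * phi t)%:E = p%:E)%E.
    rewrite -pE -ge0_integralD//=.
    - by apply: eq_integral => t _; rewrite mulrDl.
    - by move=> t _; rewrite lee_fin mulr_ge0// w_ge0.
    - by apply: measurable_funTS; exact: measurable_wphi.
    - by move=> t _; rewrite lee_fin mulr_ge0// w_ge0.
    - by apply: measurable_funTS; exact: measurable_wphi.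
  have i2 : mu.-integrable `[e, +oo[ (EFin \o (fun t : R => (w (x + t) + w (- x + t)) * phi t)).
    apply/integrableP; split; first by apply: measurable_funTS; exact: m2.
    rewrite (eq_integral (fun t : measurableTypeR R => ((w (x + t) + w (- x + t)) * phi t)%:E)) ?pE' ?ltry//.
    by move=> t _; rewrite gee0_abs// lee_fin !mulr_ge0// addr_ge0// w_ge0.
  have -> : (\int[mu]_(t in `[e, +oo[) (h t)%:E = (w x * e `^ (- (2 * s)) / s - p)%:E)%E.
    rewrite EFinB -phiE -pE' -integralB_EFin//; apply: eq_integral => t _; rewrite -EFinB /h.
    have -> : w (- x + t) = w (x - t) by rewrite -w_even opprD opprK.
    by congr EFin; ring.
  case: (\int[mu]_(t in `]0%R, e]) (h t)%:E)%E => [r| |]//= rb; rewrite -EFinD => -[->].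
  rewrite lee_fin in rb; move: rb pb; rewrite EE.
  set Q := (e `^ _ * _).
  move: (w x * _ / s) => W.
  have -> : K * (Q / (2 - 2 * s)) = K / (2 - 2 * s) * Q by ring.
  by rewrite !ler_norml => /andP[a1 a2] /andP[a3 a4]; apply/andP; split; lra.
rewrite -LE; congr EFin; apply/eqP/negPn/negP => LB.
have a0 : 0 < `|L - B| by rewrite normr_gt0 subr_eq0.
set a := `|L - B| in a0 main.
have p0 : 0 < 2 - 2 * s by move: s1; lra.
pose C := K / (2 - 2 * s) + K2.
have C0 : 0 <= C by rewrite addr_ge0// divr_ge0// ltW.
(* Chosen so that C e1^(2-2s) = C a/(2(C+1)) < a; the 1 keeps the denominator positive when C =
   0. *)
pose e1 := (a / (2 * (C + 1))) `^ (2 - 2 * s)^-1.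
have e10 : 0 < e1 by rewrite powR_gt0// divr_gt0// mulr_gt0// ltr_wpDl.
pose e := Num.min e1 ((1 - x) / 2).
have e0 : 0 < e by rewrite lt_min e10/= divr_gt0// subr_gt0.
have ex : e <= (1 - x) / 2 by rewrite ge_min lexx orbT.
have := main e e0 ex; rewrite -/C leNgt => /negP; apply.
have h1 : e `^ (2 - 2 * s) <= a / (2 * (C + 1)).
  have -> : a / (2 * (C + 1)) = e1 `^ (2 - 2 * s).
    by rewrite /e1 -powRrM mulVf ?gt_eqF// powRr1// divr_ge0 ?(ltW a0)// mulr_ge0// addr_ge0.
  apply: ge0_ler_powR; rewrite ?nnegrE ?(ltW p0) ?(ltW e0) ?(ltW e10)//.
  by rewrite ge_min lexx.
apply: (@le_lt_trans _ _ (C * (a / (2 * (C + 1))))); first by rewrite ler_wpM2l.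
rewrite mulrA ltr_pdivrMr ?mulr_gt0 ?ltr_wpDl//.
nra.
Qed.

End one_dimensional.

(** * Cone coordinates *)

Section measurable_rows.
Context {R : realType}.
Notation mT := (measurableTypeR R).
Notation mu := (@lebesgue_measure R).

Lemma mx_norm_le n (v : 'rV[R]_n) (e : R) : 0 <= e ->
  (forall i, `|v ord0 i| <= e) -> `|v| <= e.
Proof.
move=> e0 H; rewrite [leLHS]/Num.Def.normr /= mx_normrE; apply/bigmax_leP; split => // -[i j] _ /=.
by rewrite (ord1 i).
Qed.

Definition row_of_tuple n (t : n.-tuple R) : 'rV[R]_n := \row_i tnth t i.

(* Continuous functions are limits of functions that factor through the
   countably valued map [t |-> floor (k t)]. *)
Lemma continuous_measurable_row n (u : 'rV[R]_n -> R) : continuous u ->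
  measurable_fun setT (fun t : n.-tuple mT => u (row_of_tuple n t)).
Proof.
move=> cu.
pose q (k : nat) (j : n.-tuple int) : 'rV[R]_n := \row_i ((tnth j i)%:~R / k.+1%:R).
pose fl (k : nat) (t : n.-tuple mT) : n.-tuple int := [tuple of map (fun x : R => Num.floor (k.+1%:R * x)) t].
apply: (measurable_fun_cvg (h := fun k t => u (q k (fl k t)))).
- move=> k _ Y mY; rewrite setTI.
  rewrite (_ : _ @^-1` Y = \bigcup_(j in [set: n.-tuple int])
      (if `[< Y (u (q k j)) >] then fl k @^-1` [set j] else set0)); last first.
    apply/seteqP; split => [t Yt|t [j _]].
      by exists (fl k t) => //; rewrite asboolT.
    case: ifPn => // /asboolP Yj /= fj; by rewrite /= fj.
  apply: countable_bigcupT_measurable; first exact: countableP.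
  move=> j; case: ifPn => // _.
  rewrite (_ : _ @^-1` _ = \bigcap_(i in [set: 'I_n])
    ((fun t : n.-tuple mT => tnth t i) @^-1`
       `[((tnth j i)%:~R / k.+1%:R)%R, ((tnth j i + 1)%:~R / k.+1%:R)%R[)); last first.
    apply/seteqP; split => [t /= tj i _|t H] /=.
      rewrite in_itv/= -tj tnth_map ler_pdivrMr// ltr_pdivlMr// mulrC.
      exact: floor_itv.
    apply: eq_from_tnth => i; rewrite tnth_map.
    have := H i I; rewrite /= in_itv/= ler_pdivrMr// ltr_pdivlMr// mulrC.
    exact: floor_def.
  apply: fin_bigcap_measurable => // i _; rewrite -[X in measurable X]setTI.
  exact: measurable_tnth.
- move=> t _; apply: (@continuous_cvg _ _ _ _ _ (fun k => q k (fl k t)) u) => //; first exact: cu.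
  apply/cvgrPdist_le => e e0; near=> k.
  apply: mx_norm_le; first exact: ltW.
  move=> i; rewrite !mxE tnth_map.
  have k0 : 0 < k.+1%:R :> R by [].
  have -> : tnth t i - (Num.floor (k.+1%:R * tnth t i))%:~R / k.+1%:R =
    (k.+1%:R * tnth t i - (Num.floor (k.+1%:R * tnth t i))%:~R) / k.+1%:R :> R.
    by field.
  rewrite normrM normfV (ger0_norm (ltW k0)) ler_pdivrMr//.
  apply: (@le_trans _ _ 1).
    have /andP[h1 h2] := floor_itv (k.+1%:R * tnth t i).
    by rewrite intrD in h2; rewrite ger0_norm ?subr_ge0// lerBlDl ltW.
  rewrite -ler_pdivrMl// mulr1.
  by near: k; move/cvgryPge : (@cvgr_natS R); exact.
Unshelve. all: by end_near. Qed.

End measurable_rows.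

Lemma measurable_fun_pairI d d1 d2 (T : measurableType d) (T1 : measurableType d1)
    (T2 : measurableType d2) (f : T -> T1) (g : T -> T2) :
  measurable_fun setT f -> measurable_fun setT g -> measurable_fun setT (fun x => (f x, g x)).
Proof. by move=> mf mg; apply/measurable_fun_pairP. Qed.

(** * Iterated Lebesgue integrals and the cone decomposition *)

Section lebesgue_tuple_theory.
Context {R : realType}.
Notation mT := (measurableTypeR R).
Notation mu := (@lebesgue_measure R).
Notation lam := (lebesgue_tuple R).
Local Open Scope ereal_scope.

Lemma ge0_integral_tcons n (F : n.+1.-tuple mT -> \bar R) :
  measurable_fun setT F -> (forall t, 0 <= F t) ->
  \int[lam n.+1]_t F t = \int[mu]_a \int[lam n]_t F (tcons (a, t)).
Proof.
move=> mF F0.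
transitivity (\int[mu \x lam n]_p F (tcons p)).
  by rewrite (ge0_integral_pushforward (@measurable_tcons R n)).
by rewrite (fubini_tonelli1 (F \o @tcons R n))//=; apply: measurableT_comp => //; exact: measurable_tcons.
Qed.

Definition scale_tuple n (a : R) (t : n.-tuple mT) : n.-tuple mT :=
  [tuple of map ( *%R a) t].

Lemma measurable_scale_tuple n (d : measure_display) (T : measurableType d) (f : T -> R) (g : T -> n.-tuple mT) :
  measurable_fun setT f -> measurable_fun setT g ->
  measurable_fun setT (fun x => scale_tuple n (f x) (g x)).
Proof.
move=> mf mg; apply/measurable_fun_tnthP => i.
rewrite (_ : _ \o _ = fun x => (f x * tnth (g x) i)%R); last by apply/funext => x /=; rewrite tnth_map.
apply: measurable_funM => //.
exact: (measurableT_comp (measurable_tnth i)).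
Qed.

Lemma scale_tcons n (a b : R) (t : n.-tuple mT) :
  scale_tuple n.+1 a (tcons (b, t)) = tcons ((a * b)%R, scale_tuple n a t).
Proof. exact/val_inj. Qed.

Lemma ge0_integral_scale_tuple n (a : R) (F : n.-tuple mT -> \bar R) : a != 0%R ->
  measurable_fun setT F -> (forall t, 0 <= F t) ->
  \int[lam n]_t F t = (`|a| ^+ n)%:E * \int[lam n]_t F (scale_tuple n a t).
Proof.
move=> a0; elim: n F => [|n IH] F mF F0.
  by rewrite expr0 mul1e; apply: eq_integral => t _; rewrite (tuple0 t) (tuple0 (scale_tuple _ _ _)).
have mFs : measurable_fun setT (fun p : mT * n.-tuple mT => F (tcons (p.1, scale_tuple n a p.2))).
  apply: (measurableT_comp mF); apply: (measurableT_comp (@measurable_tcons R n)).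
  apply: measurable_fun_pairI; first exact: measurable_fst.
  by apply: measurable_scale_tuple => //; exact: measurable_snd.
have mFs2 : measurable_fun setT (fun t => F (scale_tuple n.+1 a t)).
  by apply: (measurableT_comp mF); exact: measurable_scale_tuple.
rewrite ge0_integral_tcons// [in RHS]ge0_integral_tcons//.
transitivity (\int[mu]_b ((`|a| ^+ n)%:E * \int[lam n]_t F (tcons (b, scale_tuple n a t)))).
  apply: eq_integral => b _; rewrite (IH (fun t => F (tcons (b, t))))//.
  apply: (measurableT_comp mF); apply: (measurableT_comp (@measurable_tcons R n)).
  exact: measurable_fun_pairI.
have mH : measurable_fun setT (fun b : mT => \int[lam n]_t F (tcons (b, scale_tuple n a t))).
  exact: (measurable_fun_fubini_tonelli_F (m2 := lam n) _ mFs).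
have H0 b : 0 <= \int[lam n]_t F (tcons (b, scale_tuple n a t)) by exact: integral_ge0.
rewrite (ge0_integralZl _ _ mH)//.
rewrite (ge0_integral_dilation a setT)// preimage_setT muleA -EFinM -exprSr.
by congr (_ * _); apply: eq_integral => b _; apply: eq_integral => t _; rewrite scale_tcons.
Qed.

Definition cone n (b : R) (z : n.-tuple mT) : n.+1.-tuple mT := tcons (b, scale_tuple n b z).

Lemma measurable_cone n : measurable_fun setT (fun p : n.-tuple mT * mT => cone n p.2 p.1).
Proof.
apply: (measurableT_comp (@measurable_tcons R n)).
apply: measurable_fun_pairI; first exact: measurable_snd.
apply: measurable_scale_tuple; [exact: measurable_snd|exact: measurable_fst].
Qed.

Lemma measurable_cone_r n (z : n.-tuple mT) : measurable_fun setT (fun b : mT => cone n b z).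
Proof.
have mz : measurable_fun setT (fun b : mT => (z, b)) by exact: measurable_fun_pairI.
exact: (measurableT_comp (@measurable_cone n) mz).
Qed.

(** For a fixed nonzero first coordinate [b], dilating the other n coordinates by [b] has Jacobian
    |b|^n; Tonelli then puts the integral over [b] inside. *)
Lemma ge0_integral_cone n (F : n.+1.-tuple mT -> \bar R) :
  measurable_fun setT F -> (forall t, 0 <= F t) ->
  \int[lam n.+1]_t F t = \int[lam n]_z \int[mu]_b ((`|b| ^+ n)%:E * F (cone n b z)).
Proof.
move=> mF F0; rewrite ge0_integral_tcons//.
have mG : measurable_fun setT (fun p : n.-tuple mT * mT => (`|p.2| ^+ n)%:E * F (cone n p.2 p.1)).
  apply: emeasurable_funM.
    apply/measurable_EFinP; apply: measurable_funX; exact: measurableT_comp.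
  by apply: (measurableT_comp mF); exact: measurable_cone.
have G0 (p : n.-tuple mT * mT) : 0 <= (`|p.2| ^+ n)%:E * F (cone n p.2 p.1).
  by rewrite mule_ge0// lee_fin exprn_ge0.
rewrite (fubini_tonelli (m1 := lam n) (m2 := mu) _ mG G0)/=.
have mF1 : measurable_fun setT (fun p : mT * n.-tuple mT => F (tcons p)).
  by apply: (measurableT_comp mF); exact: measurable_tcons.
(* The value b = 0, where the dilation degenerates, is a null set and is removed on both sides. *)
have E (f : mT -> \bar R) : measurable_fun setT f ->
    \int[mu]_x f x = \int[mu]_(x in [set: mT] `\ 0%R) f x.
  move=> mf; rewrite integral_setD1//; first exact: measurableD.
  exact: measurable_funTS.
have mL : measurable_fun setT (fun a : mT => \int[lam n]_t F (tcons (a, t))).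
  exact: (measurable_fun_fubini_tonelli_F (m2 := lam n) _ mF1).
have mR : measurable_fun setT (fun b : mT => \int[lam n]_z ((`|b| ^+ n)%:E * F (cone n b z))).
  exact: (measurable_fun_fubini_tonelli_G (m1 := lam n) _ mG).
rewrite (E _ mL) [RHS](E _ mR); apply: eq_integral => b; rewrite inE/= => -[_ /eqP b0].
have mFb : measurable_fun setT (fun t : n.-tuple mT => F (tcons (b, t))).
  by apply: (measurableT_comp mF1); exact: measurable_fun_pairI.
rewrite (ge0_integral_scale_tuple n b (fun t => F (tcons (b, t))))// ge0_integralZl//.
  by apply: (measurableT_comp mFb); exact: measurable_scale_tuple.
Qed.

(** The decomposition for nonnegative functions is applied to both parts of [F]. Evenness makes the
    integral over each line twice the one over its half-line, and the absolute integrability of [F]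
    makes the negative contribution finite, so that it cancels. *)
Lemma integral_cone n (F : n.+1.-tuple mT -> R) (h : n.-tuple mT -> R) :
  measurable_fun setT F -> (forall t, F (scale_tuple _ (-1)%R t) = F t) ->
  measurable_fun setT h -> (forall z, 0 <= h z)%R ->
  (forall z, \int[mu]_(b in `]0%R, +oo[) (b ^+ n * F (cone n b z))%:E = (h z)%:E) ->
  \int[lam n.+1]_t `|F t|%:E < +oo ->
  \int[lam n.+1]_t (F t)%:E = 2%:E * \int[lam n]_z (h z)%:E.
Proof.
move=> mF Fe mh h0 Fh Foo.
have mEF : measurable_fun setT (fun t => (F t)%:E) by exact/measurable_EFinP.
set F1 := (fun t => (F t)%:E)^\+; set F2 := (fun t => (F t)%:E)^\-.
have mF1 : measurable_fun setT F1 by exact: measurable_funepos.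
have mF2 : measurable_fun setT F2 by exact: measurable_funeneg.
pose A1 z := \int[mu]_b ((`|b| ^+ n)%:E * F1 (cone n b z)).
pose A2 z := \int[mu]_b ((`|b| ^+ n)%:E * F2 (cone n b z)).
have norm0 (b : R) : 0 <= (`|b| ^+ n)%:E by rewrite lee_fin exprn_ge0.
have F10 t : 0 <= F1 t by exact: funepos_ge0.
have F20 t : 0 <= F2 t by exact: funeneg_ge0.
have A20 z : 0 <= A2 z by apply: integral_ge0 => b _; rewrite mule_ge0.
have mA2 : measurable_fun setT A2.
  apply: (measurable_fun_fubini_tonelli_F (m2 := mu)
    (fun p : n.-tuple mT * mT => (`|p.2| ^+ n)%:E * F2 (cone n p.2 p.1))).
  - apply: emeasurable_funM.
      by apply/measurable_EFinP; apply: measurable_funX; exact: measurableT_comp.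
    exact: (measurableT_comp mF2 (@measurable_cone n)).
  - by move=> p; rewrite mule_ge0.
(* The difference of the two parts along a line is the real number 2 h(z), which excludes infinite
   parts, so the relation can be stated as a sum and integrated in [z]. *)
have A12 z : A1 z = (2 * h z)%:E + A2 z.
  have mFz : measurable_fun setT (fun b : mT => (`|b| ^+ n * F (cone n b z))%:E).
    apply/measurable_EFinP; apply: measurable_funM.
      by apply: measurable_funX; exact: normr_measurable.
    exact: (measurableT_comp mF (measurable_cone_r n z)).
  have : \int[mu]_b (`|b| ^+ n * F (cone n b z))%:E = (2 * h z)%:E.
    rewrite (integralT_even _ mFz).
      rewrite EFinM -Fh; congr (_ * _); apply: eq_integral => b.
      by rewrite inE/= in_itv/= andbT => b0; rewrite gtr0_norm.
    move=> b; rewrite normrN; congr (_ * _)%:E; rewrite -[RHS]Fe; congr F.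
    rewrite /cone scale_tcons mulN1r; congr (tcons (_, _)).
    by apply: eq_from_tnth => i; rewrite !tnth_map mulN1r mulNr.
  rewrite integralE.
  rewrite (_ : \int[mu]_b (_)^\+ b = A1 z); last first.
    apply: eq_integral => b _; rewrite /F1 !funeposE EFinM -[0%R in LHS](mule0 (`|b| ^+ n)%:E).
    by rewrite maxe_pMr.
  rewrite (_ : \int[mu]_b (_)^\- b = A2 z); last first.
    apply: eq_integral => b _; rewrite /F2 !funenegE EFinM -[0%R in LHS](mule0 (`|b| ^+ n)%:E).
    by rewrite -muleN maxe_pMr.
  have := A20 z; case: (A1 z) (A2 z) => [a1| |] [a2| |]//= _ [<-].
  by rewrite -EFinD subrK.
rewrite integralE (ge0_integral_cone n _ mF1)// (ge0_integral_cone n _ mF2)//.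
rewrite -/A1 -/A2.
have -> : \int[lam n]_z A1 z = \int[lam n]_z (2%:E * (h z)%:E + A2 z).
  by apply: eq_integral => z _; rewrite A12 EFinM.
have mh2 : measurable_fun setT (fun z => (h z)%:E) by exact/measurable_EFinP.
rewrite ge0_integralD//=; last 2 first.
- by move=> z _; rewrite -EFinM lee_fin mulr_ge0.
- exact: emeasurable_funM.
rewrite ge0_integralZl//=; last by move=> z _; rewrite lee_fin.
have : \int[lam n]_z A2 z < +oo.
  rewrite /A2 -(ge0_integral_cone n _ mF2)//; apply: le_lt_trans Foo.
  apply: ge0_le_integral => //.
  - by apply/measurable_EFinP; exact: measurableT_comp.
  - move=> t _; rewrite /F2 funenegE ge_max !lee_fin normr_ge0 andbT.
    by rewrite -normrN ler_norm.
have : 0 <= \int[lam n]_z A2 z by exact: integral_ge0.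
have : 0 <= \int[lam n]_z (h z)%:E by apply: integral_ge0 => z _; rewrite lee_fin.
case: (\int[lam n]_z A2 z) => [a2| |]//; case: (\int[lam n]_z (h z)%:E) => [hh| |]// _ _ _.
  by rewrite -!EFinM -!EFinD; congr EFin; ring.
by rewrite /= gt0_muley ?lte_fin.
Qed.

Definition sqnorm n (t : n.-tuple R) : R := (\sum_(i < n) tnth t i ^+ 2)%R.

Lemma measurable_sqnorm n : measurable_fun setT (fun t : n.-tuple mT => sqnorm n t).
Proof.
apply: measurable_sum => i; apply: measurable_funX; exact: measurable_tnth.
Qed.

Lemma sqnorm_ge0 n (t : n.-tuple R) : (0 <= sqnorm n t)%R.
Proof. by apply: sumr_ge0 => i _; exact: sqr_ge0. Qed.

Lemma sqnorm_tcons n (a : R) (t : n.-tuple mT) : sqnorm n.+1 (tcons (a, t)) = (a ^+ 2 + sqnorm n t)%R.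
Proof.
rewrite /sqnorm big_ord_recl; congr (_ + _)%R.
by apply: eq_bigr => i _; rewrite tnthS.
Qed.

Lemma sqnorm_scale n (a : R) (t : n.-tuple mT) : sqnorm n (scale_tuple n a t) = (a ^+ 2 * sqnorm n t)%R.
Proof.
by rewrite /sqnorm mulr_sumr; apply: eq_bigr => i _; rewrite tnth_map exprMn.
Qed.

Lemma sqnorm_cone n (a : R) (z : n.-tuple mT) : sqnorm n.+1 (cone n a z) = (a ^+ 2 * (1 + sqnorm n z))%R.
Proof. by rewrite /cone sqnorm_tcons sqnorm_scale mulrDr mulr1. Qed.

Lemma integral_tuple_gauss n :
  \int[lam n]_t (expR (- sqnorm n t))%:E = ((Num.sqrt pi) ^+ n)%:E.
Proof.
have mE k : measurable_fun setT (fun t : k.-tuple mT => (expR (- sqnorm k t))%:E).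
  apply/measurable_EFinP; apply: measurableT_comp => //; apply: measurableT_comp => //.
  exact: measurable_sqnorm.
have E0 k (t : k.-tuple mT) : 0 <= (expR (- sqnorm k t))%:E by rewrite lee_fin expR_ge0.
elim: n => [|n IH].
  rewrite expr0 (eq_integral (cst 1)).
    by rewrite integral_cst//= mul1e diracT.
  by move=> t _; rewrite /sqnorm big_ord0 oppr0 expR0.
rewrite ge0_integral_tcons//.
transitivity (\int[mu]_a ((Num.sqrt pi ^+ n)%:E * (gauss_fun a)%:E)).
  apply: eq_integral => a _; rewrite -IH muleC -ge0_integralZl//=.
  - by apply: eq_integral => t _; rewrite sqnorm_tcons opprD expRD EFinM.
  - exact: mE.
  - by rewrite lee_fin gauss_fun_ge0.
rewrite ge0_integralZl//=.
- by rewrite integralT_gauss -EFinM exprSr.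
- by apply/measurable_EFinP; exact: measurable_gauss_fun.
- by move=> a _; rewrite lee_fin gauss_fun_ge0.
Qed.

(* The cone decomposition of the Gaussian integral in dimension [n + 1]. *)
Lemma integral_hemisphere n :
  \int[lam n]_z ((1 + sqnorm n z) `^ (- (n.+1%:R / 2)))%:E =
  (pi `^ (n.+1%:R / 2) / Gamma (n.+1%:R / 2))%:E.
Proof.
pose p : R := (n.+1%:R / 2)%R.
have p0 : (0 < p)%R by rewrite /p divr_gt0.
have G0 := Gamma_gt0 p p0.
have mE k : measurable_fun setT (fun t : k.-tuple mT => (expR (- sqnorm k t))%:E).
  apply/measurable_EFinP; apply: measurableT_comp => //; apply: measurableT_comp => //.
  exact: measurable_sqnorm.
have mz : measurable_fun setT (fun z : n.-tuple mT => ((1 + sqnorm n z) `^ (- p))%:E).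
  apply/measurable_EFinP; apply: measurable_fun_powR; apply: measurable_funD => //.
  exact: measurable_sqnorm.
(* On the line of slope [z] the moment of e^(-b^2 (1+|z|^2)) against |b|^n is Gamma p
   (1+|z|^2)^(-p), while the whole Gaussian integral is pi^p. *)
have : \int[lam n]_z ((Gamma p)%:E * ((1 + sqnorm n z) `^ (- p))%:E) = (pi `^ p)%:E.
  have -> : (pi `^ p = (Num.sqrt pi) ^+ n.+1 :> R)%R.
    by rewrite -powR12_sqrt ?pi_ge0// -powR_mulrn ?powR_ge0// -powRrM mulrC.
  rewrite -integral_tuple_gauss ge0_integral_cone//.
  apply: eq_integral => z _.
  have z10 : (0 < 1 + sqnorm n z)%R by rewrite ltr_wpDr// sqnorm_ge0.
  under eq_integral do rewrite sqnorm_cone mulrC -EFinM.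
  rewrite integralT_even; last 2 first.
  - apply/measurable_EFinP; apply: measurable_funM.
      by apply: measurable_funX; exact: normr_measurable.
    apply: measurableT_comp => //; apply: measurableT_comp => //.
    by apply: measurable_funM => //; apply: measurable_funX.
  - by move=> b; rewrite normrN sqrrN.
  rewrite integral_gauss_moment// -EFinM; congr EFin; rewrite -/p; by field.
rewrite ge0_integralZl//=; last 2 first.
- by move=> z _; rewrite lee_fin powR_ge0.
- by rewrite lee_fin ltW.
rewrite -/p; case: (\int[lam n]_z _) => [r| |]//=.
- by rewrite -EFinM => -[<-]; congr EFin; field; rewrite gt_eqF.
- by rewrite gt0_muley ?lte_fin.
- by rewrite gt0_muleNy ?lte_fin.
Qed.

End lebesgue_tuple_theory.

(** * Regularity of the solution *)

Section enorm_theory.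
Context {R : realType} {n : nat}.
Implicit Types x y : 'rV[R]_n.

Lemma enorm_ge0 x : 0 <= enorm x.
Proof. exact: sqrtr_ge0. Qed.

Lemma sqr_enorm x : enorm x ^+ 2 = \sum_i x ord0 i ^+ 2.
Proof. by rewrite /enorm sqr_sqrtr// sumr_ge0// => i _; exact: sqr_ge0. Qed.

Lemma enorm_row_of_tuple (t : n.-tuple R) :
  enorm (row_of_tuple n t) ^+ 2 = sqnorm n t.
Proof. by rewrite sqr_enorm; apply: eq_bigr => i _; rewrite mxE. Qed.

Lemma enormN x : enorm (- x) = enorm x.
Proof. by rewrite /enorm; congr Num.sqrt; apply: eq_bigr => i _; rewrite mxE sqrrN. Qed.

Lemma coord_le_enorm x i : `|x ord0 i| <= enorm x.
Proof.
rewrite -(ler_pXn2r (isT : (0 < 2)%N)) ?nnegrE ?enorm_ge0 ?normr_ge0//.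
rewrite real_normK ?num_real// sqr_enorm (bigD1 i)//= lerDl.
by apply: sumr_ge0 => j _; exact: sqr_ge0.
Qed.

Lemma sqr_enormD x y :
  enorm (x + y) ^+ 2 = enorm x ^+ 2 + 2 * (\sum_i x ord0 i * y ord0 i) + enorm y ^+ 2.
Proof.
rewrite !sqr_enorm mulr_sumr -!big_split/=; apply: eq_bigr => i _.
by rewrite mxE; ring.
Qed.

Lemma sqr_enormB x y :
  enorm (x - y) ^+ 2 = enorm x ^+ 2 - 2 * (\sum_i x ord0 i * y ord0 i) + enorm y ^+ 2.
Proof.
rewrite sqr_enormD enormN; congr (_ + _ + _); rewrite -mulrN; congr (_ * _).
by rewrite -sumrN; apply: eq_bigr => i _; rewrite mxE mulrN.
Qed.

(** A coarse Cauchy-Schwarz inequality with the 1-norm of [x]; since [x] is fixed in the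
    application, only the linear growth in [y] matters. *)
Lemma dot_le x y : `|\sum_i x ord0 i * y ord0 i| <= (\sum_i `|x ord0 i|) * enorm y.
Proof.
apply: (le_trans (ler_norm_sum _ _ _)); rewrite mulr_suml; apply: ler_sum => i _.
by rewrite normrM ler_wpM2l// coord_le_enorm.
Qed.

(** By the parallelogram law, |x-y|^2 = 2|x|^2 + 2|y|^2 - |x+y|^2 <= 4 d^2. *)
Lemma enormB_le x y (d : R) : 0 <= d -> enorm x <= d -> enorm y <= d -> enorm (x - y) <= 2 * d.
Proof.
move=> d0 xd yd; rewrite -(ler_pXn2r (isT : (0 < 2)%N)) ?nnegrE ?enorm_ge0 ?mulr_ge0//.
have h1 := sqr_enormB x y; have h2 := sqr_enormD x y.
have h3 := sqr_ge0 (enorm (x + y)).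
have h4 : enorm x ^+ 2 <= d ^+ 2 by rewrite ler_pXn2r// nnegrE enorm_ge0.
have h5 : enorm y ^+ 2 <= d ^+ 2 by rewrite ler_pXn2r// nnegrE enorm_ge0.
by rewrite exprMn; lra.
Qed.

Lemma differentiable_sqr_enormB x0 x : differentiable (fun y : 'rV[R]_n => enorm (y - x0) ^+ 2) x.
Proof.
rewrite (_ : (fun y => _) = \sum_(i < n) (fun y : 'rV[R]_n => y ord0 i - x0 ord0 i) ^+ 2); last first.
  apply/funext => y; rewrite sqr_enorm fct_sumE; apply: eq_bigr => i _.
  by rewrite !mxE.
apply: differentiable_sum => i; apply: differentiableX.
by apply: differentiableB; [exact: differentiable_coord|exact: differentiable_cst].
Qed.

Lemma continuous_sqr_enormB x0 : continuous (fun y : 'rV[R]_n => enorm (y - x0) ^+ 2).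
Proof. by move=> x; exact/differentiable_continuous/differentiable_sqr_enormB. Qed.

Lemma enormE x : enorm x = Num.sqrt (enorm x ^+ 2).
Proof. by rewrite sqrtr_sqr ger0_norm// enorm_ge0. Qed.

Lemma continuous_enorm : continuous (@enorm R n).
Proof.
rewrite (_ : @enorm R n = Num.sqrt \o (fun y : 'rV[R]_n => enorm (y - 0) ^+ 2)).
  move=> x; apply: continuous_comp; first exact: continuous_sqr_enormB.
  exact: sqrt_continuous.
by apply/funext => x /=; rewrite subr0 -enormE.
Qed.

End enorm_theory.

(** * Lipschitz functions for the Euclidean norm *)

Section lipschitz.
Context {R : realType} {n : nat}.
Implicit Types (K : set 'rV[R]_n) (f g : 'rV[R]_n -> R).

Definition elipschitz K f := exists2 C : R, 0 <= C &
  forall x y, K x -> K y -> `|f x - f y| <= C * enorm (x - y).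

Lemma elipschitz_cst K c : elipschitz K (fun=> c).
Proof. by exists 0 => // x y _ _; rewrite subrr normr0 mul0r. Qed.

Lemma elipschitz_coord K i : elipschitz K (fun x => x ord0 i).
Proof.
exists 1 => // x y _ _; rewrite mul1r; apply: le_trans (coord_le_enorm _ i).
by rewrite !mxE.
Qed.

Lemma elipschitzB K f g : elipschitz K f -> elipschitz K g -> elipschitz K (fun x => f x - g x).
Proof.
move=> [C C0 fC] [D D0 gD]; exists (C + D); first exact: addr_ge0.
move=> x y Kx Ky; rewrite (_ : _ - _ = (f x - f y) - (g x - g y)); last by ring.
by rewrite (le_trans (ler_normB _ _))// mulrDl lerD// ?fC ?gD.
Qed.

Lemma elipschitzM K f g (M : R) : 0 <= M -> (forall x, K x -> `|f x| <= M) ->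
  (forall x, K x -> `|g x| <= M) ->
  elipschitz K f -> elipschitz K g -> elipschitz K (fun x => f x * g x).
Proof.
move=> M0 fM gM [C C0 fC] [D D0 gD]; exists (M * D + C * M).
  by rewrite addr_ge0// mulr_ge0.
move=> x y Kx Ky.
rewrite (_ : _ - _ = f x * (g x - g y) + (f x - f y) * g y); last by ring.
rewrite (le_trans (ler_normD _ _))// !normrM mulrDl lerD//.
  by rewrite -mulrA ler_pM// ?fM ?gD.
by rewrite mulrAC ler_pM// ?gM ?fC.
Qed.

Lemma elipschitz_sum K m (f : 'I_m -> 'rV[R]_n -> R) :
  (forall i, elipschitz K (f i)) -> elipschitz K (fun x => \sum_i f i x).
Proof.
move=> H; have /choice[C HC] : forall i, exists C : R, 0 <= C /\
    forall x y, K x -> K y -> `|f i x - f i y| <= C * enorm (x - y).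
  by move=> i; have [C ? ?] := H i; exists C.
exists (\sum_i C i); first by apply: sumr_ge0 => i _; have [] := HC i.
move=> x y Kx Ky; rewrite -sumrB (le_trans (ler_norm_sum _ _ _))// mulr_suml.
by apply: ler_sum => i _; have [_ ->] := HC i.
Qed.

(** Mean value theorem: as p <= 1, the derivative p c^(p-1) is largest in absolute value at the
    lower bound [d]. Negative [p] is allowed, for the exponent s - 1 of the gradient. *)
Lemma powR_lipschitz (p d a b : R) : 0 < d -> p <= 1 -> d <= a -> d <= b ->
  `|a `^ p - b `^ p| <= `|p| * d `^ (p - 1) * `|a - b|.
Proof.
move=> d0 p1; wlog ab : a b / a <= b.
  move=> H da db; have [ab|/ltW ba] := leP a b; first exact: H.
  by rewrite distrC [X in _ * X]distrC H.
move=> da db; rewrite distrC [X in _ * X]distrC.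
have a0 : 0 < a := lt_le_trans d0 da.
have [c|c|c cab ->] := @MVT_segment R (@powR R ^~ p) (fun c => p * c `^ (p - 1)) a b ab.
- rewrite in_itv/= => /andP[ac _]; apply: is_derive1_powR; exact: lt_trans ac.
- apply: continuous_at_within => z; rewrite /= in_itv/= => /andP[az _].
  by apply: continuous_powR; exact: lt_le_trans az.
move: cab; rewrite in_itv/= => /andP[ac _].
rewrite !normrM ler_wpM2r// ler_wpM2l// ger0_norm ?powR_ge0//.
rewrite -(opprB 1 p) !powRN lef_pV2 ?posrE ?powR_gt0//; last exact: lt_le_trans ac.
by apply: ge0_ler_powR; rewrite ?nnegrE ?subr_ge0//; [exact: ltW|exact: ltW (lt_le_trans _ ac)|exact: le_trans ac].
Qed.

Lemma elipschitz_powR K f (p d : R) : 0 < d -> p <= 1 -> (forall x, K x -> d <= f x) ->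
  elipschitz K f -> elipschitz K (fun x => f x `^ p).
Proof.
move=> d0 p1 df [C C0 fC]; exists (`|p| * d `^ (p - 1) * C).
  by rewrite !mulr_ge0// powR_ge0.
move=> x y Kx Ky; apply: (le_trans (powR_lipschitz p d _ _ d0 p1 (df x Kx) (df y Ky))).
by rewrite -[leRHS]mulrA ler_wpM2l ?fC// mulr_ge0// powR_ge0.
Qed.

(** On a set of diameter at most [D], |x-y| = |x-y|^(1-a) |x-y|^a <= D^(1-a) |x-y|^a. *)
Lemma elipschitz_holder K f (a D : R) : 0 <= a -> a <= 1 -> 0 <= D ->
  (forall x y, K x -> K y -> enorm (x - y) <= D) -> elipschitz K f ->
  exists C : R, forall x y, K x -> K y -> `|f x - f y| <= C * enorm (x - y) `^ a.
Proof.
move=> a0 a1 D0 KD [C C0 fC]; exists (C * D `^ (1 - a)) => x y Kx Ky.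
apply: (le_trans (fC x y Kx Ky)); rewrite -mulrA ler_wpM2l//.
have [xy0|xy0] := eqVneq (enorm (x - y)) 0.
  by rewrite xy0 mulr_ge0// powR_ge0.
have xygt0 : 0 < enorm (x - y) by rewrite lt_def xy0 enorm_ge0.
rewrite -{1}(powRr1 (enorm_ge0 _)) -{1}(subrK a 1) powRD ?xy0 ?implybT//.
by rewrite ler_wpM2r ?powR_ge0// ge0_ler_powR// ?nnegrE ?subr_ge0// ?enorm_ge0// KD.
Qed.

End lipschitz.

Section regularity.
Context {R : realType} {n : nat}.
Variables (s : R) (x0 : 'rV[R]_n) (r : R).
Hypotheses (s0 : 0 < s) (s1 : s < 1) (r0 : 0 < r).

Let rho (x : 'rV[R]_n) : R := r ^+ 2 - enorm (x - x0) ^+ 2.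

Lemma is_derive_pospow (p c : R) : 0 < c ->
  is_derive c 1 (fun y : R => pospow y p) (p * c `^ (p - 1)).
Proof.
move=> c0; have := is_derive1_powR p c0; apply: near_eq_is_derive.
near=> y; rewrite /pospow max_l// ltW//.
near: y; exact: lt_nbhsr.
Unshelve. all: by end_near. Qed.

Lemma eball_gt0 x : eball x0 r x -> 0 < rho x.
Proof.
by rewrite /eball/= => xr; rewrite subr_gt0 ltr_pXn2r// nnegrE ?enorm_ge0// ltW.
Qed.

Lemma continuous_rho : continuous rho.
Proof.
move=> x; apply: differentiable_continuous.
by apply: differentiableB; [exact: differentiable_cst|exact: differentiable_sqr_enormB].
Qed.

Lemma differentiable_pospow_ball k x : eball x0 r x ->
  differentiable (fun x => k * pospow (rho x) s) x.
Proof.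
move=> /eball_gt0 rx.
apply: (@differentiable_comp _ _ _ _ (fun x => pospow (rho x) s) (fun y : R => k * y)); last first.
  by apply/derivable1_diffP; exact: ex_derive.
apply: (@differentiable_comp _ _ _ _ rho (fun y : R => pospow y s)).
  by apply: differentiableB; [exact: differentiable_cst|exact: differentiable_sqr_enormB].
by apply/derivable1_diffP; have [] := is_derive_pospow s (rho x) rx.
Qed.

(** Restriction to a line makes the one-variable chain rule available; along a coordinate axis [rho]
    is a quadratic polynomial. *)
Lemma derive_line (f : 'rV[R]_n -> R) x v :
  'D_v f x = 'D_1 (fun h : R => f (h *: v + x)) 0.
Proof.
rewrite /derive.
suff -> : (fun h : R => h^-1 *: ((f \o shift x) (h *: v) - f x)) =
  (fun h : R => h^-1 *: (((fun h : R => f (h *: v + x)) \o shift (0 : R)) (h *: (1 : R)) - f (0 *: v + x))) by [].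
by apply/funext => h /=; rewrite scale0r add0r addr0 [_%:A]mulr1.
Qed.

Lemma rho_line x i h :
  rho (h *: delta_mx ord0 i + x) = rho x - 2 * (x ord0 i - x0 ord0 i) * h - h ^+ 2.
Proof.
rewrite /rho -addrA (sqr_enormD (h *: _)).
have -> : enorm (h *: delta_mx ord0 i : 'rV[R]_n) ^+ 2 = h ^+ 2.
  rewrite sqr_enorm (bigD1 i)//= big1 ?addr0.
    by rewrite !mxE !eqxx mulr1.
  by move=> j ji; rewrite !mxE eqxx (negbTE ji) mulr0 expr0n.
have -> : \sum_j (h *: delta_mx ord0 i : 'rV[R]_n) ord0 j * (x - x0) ord0 j = h * (x ord0 i - x0 ord0 i).
  rewrite (bigD1 i)//= big1 ?addr0.
    by rewrite !mxE !eqxx mulr1.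
  by move=> j ji; rewrite !mxE eqxx (negbTE ji) mulr0 mul0r.
ring.
Qed.

Lemma derive_pospow_ball k x i : eball x0 r x ->
  'D_(delta_mx ord0 i) (fun x => k * pospow (rho x) s) x =
  k * (s * rho x `^ (s - 1)) * ((- 2) * (x ord0 i - x0 ord0 i)).
Proof.
move=> /eball_gt0 rx; rewrite derive_line.
under [fun h : R => _]eq_fun do rewrite rho_line.
have d1 : is_derive (0 : R) 1 (fun h : R => rho x - 2 * (x ord0 i - x0 ord0 i) * h - h ^+ 2)
    ((- 2) * (x ord0 i - x0 ord0 i)).
  apply: is_derive_eq; rewrite /GRing.scale /=; ring.
have d2 : is_derive (rho x - 2 * (x ord0 i - x0 ord0 i) * 0 - 0 ^+ 2) 1 (fun y : R => k * pospow y s)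
    (k * (s * rho x `^ (s - 1))).
  rewrite mulr0 expr0n !subr0.
  have d3 := is_derive_pospow s (rho x) rx.
  exact: is_deriveZ.
have := @is_derive1_comp _ (fun y : R => k * pospow y s)
  (fun h : R => rho x - 2 * (x ord0 i - x0 ord0 i) * h - h ^+ 2) _ _ _ d2 d1.
by move=> /@derive_val ->.
Qed.

(** [rho] attains a positive minimum on a compact subset of the open ball, which keeps its powers
    away from their singularity at 0. *)
Lemma eball_compact_gap K : compact K -> K `<=` eball x0 r ->
  exists2 d : R, 0 < d & forall x, K x -> d <= rho x.
Proof.
move=> cK Kr; have [->|/set0P K0] := eqVneq K set0; first by exists 1.
have [|c cK' H] := @compact_EVT_min _ R rho K K0 cK.
  exact: continuous_subspaceT continuous_rho.
exists (rho c); first by apply: eball_gt0; apply: Kr; exact: set_mem.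
by move=> x Kx; apply: H; exact: mem_set.
Qed.

Lemma elipschitz_rho K : K `<=` eball x0 r -> elipschitz K rho.
Proof.
move=> Kr; have -> : rho = fun x => r ^+ 2 - \sum_i (x ord0 i - x0 ord0 i) * (x ord0 i - x0 ord0 i).
  apply/funext => x; rewrite /rho sqr_enorm; congr (_ - _).
  by apply: eq_bigr => i _; rewrite !mxE expr2.
apply: elipschitzB; first exact: elipschitz_cst.
apply: elipschitz_sum => i.
have b x : K x -> `|x ord0 i - x0 ord0 i| <= r.
  move=> /Kr/ltW; apply: le_trans; have := coord_le_enorm (x - x0) i.
  by rewrite !mxE.
by apply: (elipschitzM _ _ _ r) => //; [exact: ltW| |];
  apply: elipschitzB; [exact: elipschitz_coord|exact: elipschitz_cst
    |exact: elipschitz_coord|exact: elipschitz_cst].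
Qed.

Lemma eball_diameter K : K `<=` eball x0 r -> forall x y, K x -> K y -> enorm (x - y) <= 2 * r.
Proof.
move=> Kr x y /Kr/ltW xr /Kr/ltW yr.
rewrite (_ : x - y = (x - x0) - (y - x0)); first by rewrite enormB_le// ltW.
by rewrite opprB addrA subrK.
Qed.

Lemma elipschitz_loc_holder (a : R) f : 0 <= a -> a <= 1 ->
  (forall K, compact K -> K `<=` eball x0 r -> elipschitz K f) -> loc_holder a (eball x0 r) f.
Proof.
move=> a0 a1 H K cK Kr; apply: (elipschitz_holder _ _ a (2 * r)) => //.
- by rewrite mulr_ge0// ltW.
- exact: eball_diameter.
- exact: H.
Qed.

Lemma loc_regular_pospow k : loc_regular s (eball x0 r) (fun x => k * pospow (rho x) s).
Proof.
have powlip (p : R) K : p <= 1 -> compact K -> K `<=` eball x0 r ->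
    elipschitz K (fun x => rho x `^ p).
  move=> p1 cK Kr; have [d d0 dK] := eball_compact_gap K cK Kr.
  by apply: (elipschitz_powR _ _ _ d) => //; exact: elipschitz_rho.
have scal (K : set 'rV[R]_n) f c : elipschitz K f -> elipschitz K (fun x => c * f x).
  move=> [C C0 fC]; exists (`|c| * C); first by rewrite mulr_ge0.
  by move=> x y Kx Ky; rewrite -mulrBr normrM -mulrA ler_wpM2l// fC.
have ext (K : set 'rV[R]_n) f g : (forall x, K x -> f x = g x) -> elipschitz K f -> elipschitz K g.
  move=> fg [C C0 fC]; exists C => // x y Kx Ky; rewrite -!fg//; exact: fC.
rewrite /loc_regular; case: ltP => s2.
  (* The Hölder exponent becomes (1 + 2s)/2 < 1, and the function is even Lipschitz on compact
     subsets. *)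
  exists ((1 - 2 * s) / 2); split; [lra|move: s0; lra|split; first lra].
  apply: elipschitz_loc_holder; [move: s0; lra|lra|move=> K cK Kr].
  apply: (scal); apply: (ext _ (fun x => rho x `^ s)); last exact: powlip (ltW s1) _ _.
  by move=> x /Kr /eball_gt0 /ltW rx; rewrite pospowE.
(* The exponent for the partial derivatives becomes [s]; they are Lipschitz on compact subsets. *)
exists (1 - s); split; [move: s1; lra|move: s0; lra|split; first by move: s1; lra].
split; first by move=> x Ox; exact: differentiable_pospow_ball.
move=> i; apply: elipschitz_loc_holder; [move: s0; lra|move: s1; lra|move=> K cK Kr].
apply: (ext _ (fun x => k * ((s * rho x `^ (s - 1)) * ((- 2) * (x ord0 i - x0 ord0 i))))).
  by move=> x /Kr Ox; rewrite derive_pospow_ball// mulrA.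
apply: (scal); have [d d0 dK] := eball_compact_gap K cK Kr.
have sle1 : s - 1 <= 1 by move: s1; lra.
have b x : K x -> `|x ord0 i - x0 ord0 i| <= r.
  move=> /Kr/ltW; apply: le_trans; have := coord_le_enorm (x - x0) i.
  by rewrite !mxE.
(* The first summand bounds s rho^(s-1) and the second the linear factor; the sum is one bound valid
   for both. *)
apply: (elipschitzM _ _ _ (s * d `^ (s - 1) + 2 * r)).
- by rewrite addr_ge0// mulr_ge0// ?powR_ge0// ltW.
- move=> x Kx; rewrite ger0_norm; last by rewrite mulr_ge0 ?powR_ge0// ltW.
  apply: (@le_trans _ _ (s * d `^ (s - 1))); last by rewrite lerDl mulr_ge0// ltW.
  rewrite ler_pM2l// -(opprB 1 s) !powRN lef_pV2 ?posrE ?powR_gt0//.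
    apply: ge0_ler_powR; rewrite ?nnegrE ?(ltW d0) ?dK//; first by move: s1; lra.
    exact: le_trans (ltW d0) (dK x Kx).
  by rewrite (lt_le_trans d0)// dK.
- move=> x Kx; rewrite normrM normrN normr_nat.
  apply: (@le_trans _ _ (2 * r)); first by rewrite ler_pM2l// b.
  by rewrite lerDr mulr_ge0 ?powR_ge0// ltW.
- by apply: (scal); exact: powlip.
- by apply: (scal); apply: elipschitzB; [exact: elipschitz_coord|exact: elipschitz_cst].
Qed.

Lemma continuous_pospow_rho k : continuous (fun x => k * pospow (rho x) s).
Proof.
move=> x; apply: (@continuous_comp _ _ _ (fun x => pospow (rho x) s) ( *%R k)); last first.
  exact: mulrl_continuous.
apply: (@continuous_comp _ _ _ rho (fun c : R => pospow c s)); first exact: continuous_rho.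
exact: continuous_pospow.
Qed.

Lemma pospow_outside x : ~ eball x0 r x -> pospow (rho x) s = 0.
Proof.
move=> /negP; rewrite /eball/= -leNgt => rx; apply: pospow_le0 => //.
by rewrite subr_le0 ler_pXn2r// nnegrE ?enorm_ge0// ltW.
Qed.

End regularity.

(** * The fractional Laplacian of the solution *)

(** The integral is the difference of those of the two parts, and a difference of infinities is
    again infinite; a finite value therefore forces both parts to be finite. *)
Lemma fin_num_integrable d (T : measurableType d) (R : realType)
    (m : {measure set T -> \bar R}) (D : set T) (f : T -> \bar R) :
  measurable D -> measurable_fun D f -> (\int[m]_(x in D) f x \is a fin_num)%E -> m.-integrable D f.
Proof.
move=> mD mf; rewrite integralE fin_numD fin_numN => /andP[fp fn].
apply/integrableP; split => //.
rewrite -[fun x => _]/(abse \o f) fune_abse.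
rewrite ge0_integralD//=; last 2 first.
- exact: measurable_funepos.
- exact: measurable_funeneg.
by rewrite ltey_eq fin_numD fp fn.
Qed.

(** * Integrals along a ray through the ball *)

Section ray.
Context {R : realType}.
Notation mu := (@lebesgue_measure R).
Variable s : R.
Hypotheses (s0 : 0 < s) (s1 : s < 1).
Local Open Scope ereal_scope.

Lemma integral_dilation_0y (a : R) (f : R -> \bar R) : (0 < a)%R -> measurable_fun setT f ->
  \int[mu]_(b in `]0%R, +oo[) f b = a%:E * \int[mu]_(t in `]0%R, +oo[) f (a * t)%R.
Proof.
move=> a0 mf; rewrite (integral_dilation a `]0%R, +oo[%classic f)//; last 2 first.
- by rewrite gt_eqF.
- exact: measurable_funTS.
rewrite gtr0_norm//; congr (_ * _); congr (integral _ _ _).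
apply/seteqP; split => t /=; rewrite !in_itv/= !andbT; first by rewrite pmulr_rgt0.
by move=> t0; rewrite mulr_gt0.
Qed.

Lemma measurable_ray (c d V : R) : measurable_fun setT (fun b : measurableTypeR R =>
  ((2 * pospow c s - pospow (c - 2 * b * d - b ^+ 2 * V) s
     - pospow (c + 2 * b * d - b ^+ 2 * V) s) * b `^ (- (1 + 2 * s)))%:E).
Proof.
apply/measurable_EFinP; apply: measurable_funM; last exact: measurable_powR.
apply: measurable_funB.
  apply: measurable_funB => //; apply: measurable_fun_pospow; apply: measurable_funB.
    by apply: measurable_funB => //; apply: measurable_funM => //; exact: measurable_funM.
  by apply: measurable_funM => //; exact: measurable_funX.
apply: measurable_fun_pospow; apply: measurable_funB.
  by apply: measurable_funD => //; apply: measurable_funM => //; exact: measurable_funM.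
by apply: measurable_funM => //; exact: measurable_funX.
Qed.

(* On a ray, [c - 2 b d - b^2 V = V A^2 (1 - ((b + beta) / A)^2)]. *)
Lemma integral_ray (c d V : R) : (0 < c)%R -> (0 < V)%R ->
  \int[mu]_(b in `]0%R, +oo[)
    ((2 * pospow c s - pospow (c - 2 * b * d - b ^+ 2 * V) s
       - pospow (c + 2 * b * d - b ^+ 2 * V) s) * b `^ (- (1 + 2 * s)))%:E =
  (V `^ s * (Gamma s * Gamma (1 - s)))%:E.
Proof.
move=> c0 V0.
pose beta : R := (d / V)%R; pose A : R := Num.sqrt (c / V + beta ^+ 2).
have A2 : (A ^+ 2 = c / V + beta ^+ 2)%R.
  by rewrite sqr_sqrtr// addr_ge0 ?sqr_ge0// divr_ge0 ?ltW.
have A0 : (0 < A)%R by rewrite sqrtr_gt0 ltr_wpDr ?sqr_ge0// divr_gt0.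
have dE : (d = V * beta)%R by rewrite /beta mulrCA divff ?gt_eqF// mulr1.
have cE : (c = V * A ^+ 2 - V * beta ^+ 2)%R.
  by rewrite A2 mulrDr addrK mulrCA divff ?gt_eqF// mulr1.
(* [A] is the half-length of the chord in the parameter [b], and [beta / A] the position of the base
   point on the normalized chord; it is interior because c > 0. *)
have bA : (-1 < beta / A < 1)%R.
  rewrite -ltr_norml normrM normfV (gtr0_norm A0) ltr_pdivrMr// mul1r.
  rewrite -(ltr_pXn2r (isT : (0 < 2)%N)) ?nnegrE ?normr_ge0 ?ltW//.
  by rewrite real_normK ?num_real// A2 ltrDr divr_gt0.
case/andP : bA => bA1 bA2.
rewrite (integral_dilation_0y A)//; last exact: measurable_ray.
(* The profile contributes V^s A^(2s) and the kernel A^(-1-2s). With the factor [A] from the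
   dilation all powers of [A] cancel, so the result depends on neither [c] nor [d]. *)
transitivity (A%:E * \int[mu]_(t in `]0%R, +oo[) ((V `^ s / A)%:E *
  ((2 * pospow (1 - (beta / A) ^+ 2) s - pospow (1 - (beta / A + t) ^+ 2) s
    - pospow (1 - (beta / A - t) ^+ 2) s) * t `^ (- (1 + 2 * s)))%:E)).
  congr (_ * _); apply: eq_integral => t.
  rewrite inE/= in_itv/= andbT => t0.
  have An := lt0r_neq0 A0.
  have E1 : (c = V * A ^+ 2 * (1 - (beta / A) ^+ 2))%R by rewrite {1}cE; field.
  have E2 : (c - 2 * (A * t) * d - (A * t) ^+ 2 * V = V * A ^+ 2 * (1 - (beta / A + t) ^+ 2))%R.
    by rewrite {1}cE dE; field.
  have E3 : (c + 2 * (A * t) * d - (A * t) ^+ 2 * V = V * A ^+ 2 * (1 - (beta / A - t) ^+ 2))%R.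
    by rewrite {1}cE dE; field.
  have VA : (0 <= V * A ^+ 2)%R by rewrite mulr_ge0 ?sqr_ge0 ?ltW.
  rewrite E2 E3 {1}E1 !(pospowM _ _ _ VA).
  have -> : ((A * t) `^ (- (1 + 2 * s)) = A^-1 * (A ^+ 2) `^ (- s) * t `^ (- (1 + 2 * s)))%R.
    rewrite powRM ?(ltW A0) ?(ltW t0)//; congr (_ * _)%R.
    rewrite -powR_mulrn ?(ltW A0)// -powRrM -(powR_inv1 (ltW A0)) -powRD ?An ?implybT//.
    by congr (_ `^ _)%R; ring.
  have P0 : (0 < (A ^+ 2) `^ s)%R by rewrite powR_gt0// exprn_gt0.
  rewrite (powRM _ (ltW V0) (sqr_ge0 A)) powRN -EFinM; congr EFin; field.
  by rewrite An gt_eqF.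
have iD : mu.-integrable `]0%R, +oo[ (fun t => ((2 * pospow (1 - (beta / A) ^+ 2) s - pospow (1 - (beta / A + t) ^+ 2) s
    - pospow (1 - (beta / A - t) ^+ 2) s) * t `^ (- (1 + 2 * s)))%:E).
  apply: fin_num_integrable => //; last by rewrite integral_second_difference.
  apply: measurable_funTS; apply/measurable_EFinP; apply: measurable_funM; last exact: measurable_powR.
  by apply: measurable_funB; [apply: measurable_funB => //|];
    apply: measurable_fun_pospow; apply: measurable_funB => //; apply: measurable_funX;
    [exact: measurable_funD|exact: measurable_funB].
rewrite integralZl//= integral_second_difference// -!EFinM; congr EFin.
by field; rewrite gt_eqF.
Qed.

Lemma integrable_ray (c d V : R) : (0 < c)%R -> (0 < V)%R ->
  mu.-integrable `]0%R, +oo[ (fun b =>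
    ((2 * pospow c s - pospow (c - 2 * b * d - b ^+ 2 * V) s
       - pospow (c + 2 * b * d - b ^+ 2 * V) s) * b `^ (- (1 + 2 * s)))%:E).
Proof.
move=> c0 V0; apply: fin_num_integrable => //; last by rewrite integral_ray.
by apply: measurable_funTS; exact: measurable_ray.
Qed.

Lemma measurable_min1_ray (V : R) : measurable_fun setT (fun b : measurableTypeR R =>
  (Num.min 1 (b ^+ 2 * V) * b `^ (- (1 + 2 * s)))%:E).
Proof.
apply/measurable_EFinP; apply: measurable_funM; last exact: measurable_powR.
by apply: measurable_minr => //; apply: measurable_funM => //; exact: measurable_funX.
Qed.

(** The dilation by V^(-1/2) removes [V] from the minimum and leaves the factor V^s. *)
Lemma integral_min1_ray (V : R) : (0 < V)%R ->
  \int[mu]_(b in `]0%R, +oo[) (Num.min 1 (b ^+ 2 * V) * b `^ (- (1 + 2 * s)))%:E =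
  (V `^ s * (1 / (2 - 2 * s) + 1 / (2 * s)))%:E.
Proof.
move=> V0; pose a := (Num.sqrt V)^-1%R.
have a0 : (0 < a)%R by rewrite invr_gt0 sqrtr_gt0.
have aV : (a ^+ 2 * V = 1)%R by rewrite /a exprVn sqr_sqrtr ?ltW// mulVf// gt_eqF.
have aE : (a `^ (- (1 + 2 * s)) * a = V `^ s)%R.
  rewrite -{2}(powRr1 (ltW a0)) -powRD; last by rewrite (gt_eqF a0) implybT.
  have -> : V = (a `^ (- 2))%R.
    by rewrite powRN powR_mulrn ?(ltW a0)//; apply: (mulfI (lt0r_neq0 (exprn_gt0 2 a0)));
      rewrite aV divff// gt_eqF// exprn_gt0.
  by rewrite -powRrM; congr (_ `^ _)%R; ring.
rewrite (integral_dilation_0y a)//; last exact: measurable_min1_ray.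
transitivity (a%:E * \int[mu]_(t in `]0%R, +oo[) ((a `^ (- (1 + 2 * s)))%:E *
    (Num.min 1 (t ^+ 2) * t `^ (- (1 + 2 * s)))%:E)).
  congr (_ * _); apply: eq_integral => t; rewrite inE/= in_itv/= andbT => t0.
  rewrite powRM ?(ltW a0) ?(ltW t0)// exprMn mulrAC aV mul1r -EFinM; congr EFin; ring.
rewrite ge0_integralZl//=; last 3 first.
- apply: measurable_funTS; apply/measurable_EFinP; apply: measurable_funM; last exact: measurable_powR.
  exact: measurable_min1X2.
- by move=> t _; rewrite lee_fin mulr_ge0 ?powR_ge0// le_min ler01 sqr_ge0.
- by rewrite lee_fin powR_ge0.
by rewrite integral_min1X2_phi// -!EFinM -aE; congr EFin; ring.
Qed.

End ray.

Lemma measurable_second_difference {R : realType} {n : nat} (u : 'rV[R]_n -> R) x p :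
  continuous u -> measurable_fun setT (fun t : n.-tuple (measurableTypeR R) =>
    (2 * u x - u (x + row_of_tuple n t) - u (x - row_of_tuple n t)) / enorm (row_of_tuple n t) `^ p).
Proof.
move=> cu; apply: measurable_funM; last first.
  apply: measurable_fun_inv; apply: measurable_fun_powR.
  exact: (continuous_measurable_row n (@enorm R n) continuous_enorm).
apply: measurable_funB; first apply: measurable_funB => //.
- apply: (continuous_measurable_row n (fun y => u (x + y))) => y.
  apply: (@continuous_comp _ _ _ (fun y => x + y) u); last exact: cu.
  by apply: differentiable_continuous; exact: ex_diff.
- apply: (continuous_measurable_row n (fun y => u (x - y))) => y.
  have : {for y, continuous (u \o (fun y : 'rV[R]_n => x - y))} by apply: continuous_comp;
    [apply: differentiable_continuous; exact: ex_diff|exact: cu].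
  by [].
Qed.

(** * The integral of the second difference over the whole space *)

Section fraclap_pospow.
Context {R : realType} {m : nat}.
Notation n := m.+1.
Notation mT := (measurableTypeR R).
Notation mu := (@lebesgue_measure R).
Notation lam := (lebesgue_tuple R).
Variables (s : R) (x0 : 'rV[R]_n) (r : R).
Hypotheses (s0 : 0 < s) (s1 : s < 1) (r0 : 0 < r).
Let rho (x : 'rV[R]_n) : R := r ^+ 2 - enorm (x - x0) ^+ 2.
Let U (x : 'rV[R]_n) : R := pospow (rho x) s.
Variable x : 'rV[R]_n.
Hypothesis xr : eball x0 r x.
Let c : R := rho x.
Let dot (y : 'rV[R]_n) : R := \sum_i (x - x0) ord0 i * y ord0 i.
Let p : R := n%:R + 2 * s.
Let G (y : 'rV[R]_n) : R := 2 * U x - U (x + y) - U (x - y).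
Let F (t : n.-tuple mT) : R := G (row_of_tuple n t) / enorm (row_of_tuple n t) `^ p.
Let V (z : m.-tuple mT) : R := 1 + sqnorm m z.

Let c0 : 0 < c. Proof. exact: eball_gt0 _ _ r0 _ xr. Qed.

Let V0 z : 0 < V z. Proof. by rewrite ltr_wpDr// sqnorm_ge0. Qed.

Let G_dot y : G y = 2 * pospow c s - pospow (c - 2 * dot y - enorm y ^+ 2) s
  - pospow (c + 2 * dot y - enorm y ^+ 2) s.
Proof.
rewrite /G /U -/c /rho [x + y - x0]addrAC [x - y - x0]addrAC (sqr_enormD (x - x0) y) (sqr_enormB (x - x0) y) -/(dot y).
by congr (_ - pospow _ s - pospow _ s); rewrite /c /rho; ring.
Qed.

Let G_even y : G (- y) = G y.
Proof. by rewrite /G opprK; exact: addrAC. Qed.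

Lemma powR_enorm k (y : 'rV[R]_k) (q : R) : enorm y `^ q = (enorm y ^+ 2) `^ (q / 2).
Proof.
by rewrite -powR_mulrn ?enorm_ge0// -powRrM; congr (_ `^ _); field.
Qed.

Let FE t : F t = G (row_of_tuple n t) * sqnorm n t `^ (- (p / 2)).
Proof. by rewrite /F powR_enorm enorm_row_of_tuple powRN. Qed.

Let row_scale k (a : R) (t : k.-tuple mT) : row_of_tuple k (scale_tuple k a t) = a *: row_of_tuple k t.
Proof. by apply/rowP => i; rewrite !mxE tnth_map. Qed.

Let cone_scale (b : R) (z : m.-tuple mT) : cone m b z = scale_tuple n b (cone m 1 z).
Proof.
rewrite /cone scale_tcons mulr1; congr (tcons (_, _)).
by apply: eq_from_tnth => i; rewrite !tnth_map mul1r.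
Qed.

(** The Jacobian b^m turns the n-dimensional kernel into the one-dimensional one, since m - p = -(1
    + 2s). *)
Let powR_cone (b : R) z : 0 < b ->
  b ^+ m * (b ^+ 2 * V z) `^ (- (p / 2)) = b `^ (- (1 + 2 * s)) * V z `^ (- (p / 2)).
Proof.
move=> b0; rewrite powRM ?sqr_ge0 ?(ltW (V0 z))// mulrA; congr (_ * _).
rewrite -!powR_mulrn ?(ltW b0)// -powRrM -powRD; last by rewrite (gt_eqF b0) implybT.
by congr (_ `^ _); rewrite /p -natr1; field.
Qed.

Let F_cone (b : R) z : 0 < b -> let d := dot (row_of_tuple n (cone m 1 z)) in
  b ^+ m * F (cone m b z) = V z `^ (- (p / 2)) *
  ((2 * pospow c s - pospow (c - 2 * b * d - b ^+ 2 * V z) s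
     - pospow (c + 2 * b * d - b ^+ 2 * V z) s) * b `^ (- (1 + 2 * s))).
Proof.
move=> b0 d; rewrite FE sqnorm_cone -/(V z) mulrCA powR_cone// G_dot enorm_row_of_tuple sqnorm_cone -/(V z).
have -> : dot (row_of_tuple n (cone m b z)) = b * d.
  rewrite cone_scale row_scale /dot /d mulr_sumr; apply: eq_bigr => i _.
  by rewrite !mxE mulrCA.
by rewrite !mulrA; ring.
Qed.

Let U_ge0 y : 0 <= U y. Proof. exact: pospow_ge0. Qed.

Let U_le y : U y <= pospow (r ^+ 2) s.
Proof. by apply: ler_pospow; [exact: ltW|rewrite gerBl sqr_ge0]. Qed.

Let G_bound : exists2 K : R, 0 <= K & forall y, `|G y| <= K * Num.min 1 (enorm y ^+ 2).
Proof.
pose S := \sum_i `|(x - x0) ord0 i|.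
have S0 : 0 <= S by exact: sumr_ge0.
(* For |y| <= 1 the Taylor estimate applies with p = -2 x.y, relative to the center, and q = |y|^2,
   where p^2 <= 4 S^2 |y|^2 and q^2 <= |y|^2. For larger [y], [K2] comes from the supremum of
   [U]. *)
pose K1 := 2 * s * c `^ (s - 1) + 2 * c `^ (s - 2) * (4 * S ^+ 2 + 1).
pose K2 := 4 * pospow (r ^+ 2) s.
have c1 : 0 <= 2 * s * c `^ (s - 1) by rewrite !mulr_ge0 ?powR_ge0// ltW.
have c2 : 0 <= 2 * c `^ (s - 2) by rewrite !mulr_ge0 ?powR_ge0.
have K10 : 0 <= K1 by rewrite addr_ge0// mulr_ge0// addr_ge0// mulr_ge0// sqr_ge0.
have K20 : 0 <= K2 by rewrite mulr_ge0// pospow_ge0.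
exists (K1 + K2) => [|y]; first exact: addr_ge0.
have [y1|y1] := leP (enorm y ^+ 2) 1.
  apply: (@le_trans _ _ (K1 * enorm y ^+ 2)); last first.
    by rewrite ler_wpM2r ?sqr_ge0// lerDl.
  have := pospow_second_difference s c (- (2 * dot y)) (enorm y ^+ 2) s0 s1 c0.
  rewrite opprK -G_dot (ger0_norm (sqr_ge0 _)) => /le_trans; apply.
  have dle := dot_le (x - x0) y; rewrite -/(dot y) -/S in dle.
  have d2 : dot y ^+ 2 <= S ^+ 2 * enorm y ^+ 2.
    rewrite -exprMn -(real_normK (num_real (dot y))) ler_pXn2r// nnegrE//.
    by rewrite mulr_ge0// enorm_ge0.
  have y4 : (enorm y ^+ 2) ^+ 2 <= enorm y ^+ 2.
    by rewrite expr2 ler_piMl// sqr_ge0.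
  rewrite /K1 (mulrDl (2 * s * c `^ (s - 1))) lerD2l -[leRHS]mulrA ler_wpM2l// sqrrN exprMn mulrDl mul1r.
  by rewrite lerD// -natrX -mulrA ler_wpM2l.
rewrite mulr1 (@le_trans _ _ K2)// ?lerDr// /K2 /G ler_norml.
have := U_ge0 x; have := U_ge0 (x + y); have := U_ge0 (x - y).
have := U_le x; have := U_le (x + y); have := U_le (x - y); rewrite /K2.
by move: (pospow (r ^+ 2) s) (U x) (U (x + y)) (U (x - y)) => M a b d *; apply/andP; split; lra.
Qed.

Let measurable_F : measurable_fun setT F.
Proof.
have cU : continuous U.
  move=> z; have := continuous_pospow_rho s x0 r s0 1 z.
  by rewrite (_ : (fun z => _) = U)//; apply/funext => w; rewrite mul1r.
exact: measurable_second_difference.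
Qed.

Let integral_V : (\int[lam m]_z (V z `^ (- (n%:R / 2)))%:E = (pi `^ (n%:R / 2) / Gamma (n%:R / 2))%:E)%E.
Proof. exact: integral_hemisphere. Qed.

(** The majorant min(1, |y|^2) |y|^(-p) is computed exactly in cone coordinates: each ray gives a
    constant times V^(-p/2) V^s = V^(-n/2), whose integral over the slopes is the finite area of the
    hemisphere. *)
Let F_integrable : (\int[lam n]_t `|F t|%:E < +oo)%E.
Proof.
have [K K0 GK] := G_bound.
pose H (t : n.-tuple mT) : R := Num.min 1 (sqnorm n t) * sqnorm n t `^ (- (p / 2)).
have mH : measurable_fun setT H.
  apply: measurable_funM; last by apply: measurable_fun_powR; exact: measurable_sqnorm.
  by apply: measurable_minr => //; exact: measurable_sqnorm.
have H0 t : 0 <= H t by rewrite mulr_ge0 ?powR_ge0// le_min ler01 sqnorm_ge0.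
apply: (@le_lt_trans _ _ (\int[lam n]_t (K%:E * (H t)%:E))%E).
  apply: ge0_le_integral => //.
  - by apply/measurable_EFinP; apply: measurableT_comp => //; exact: measurable_F.
  - by apply: emeasurable_funM => //; exact/measurable_EFinP.
  - move=> t _; rewrite -EFinM lee_fin FE normrM (ger0_norm (powR_ge0 _ _)) mulrA.
    by rewrite ler_wpM2r ?powR_ge0// -enorm_row_of_tuple GK.
rewrite ge0_integralZl//=; last 2 first.
- exact/measurable_EFinP.
- by move=> t _; rewrite lee_fin.
rewrite lte_mul_pinfty ?lee_fin// ge0_integral_cone//; last exact/measurable_EFinP.
pose C0 := 1 / (2 - 2 * s) + 1 / (2 * s).
have C00 : 0 <= C0.
  by rewrite addr_ge0// divr_ge0// ?mulr_ge0// ?(ltW s0)//; move: s1; lra.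
have VE z : V z `^ (- (p / 2)) * V z `^ s = V z `^ (- (n%:R / 2)).
  rewrite -powRD; last by rewrite (gt_eqF (V0 z)) implybT.
  by congr (_ `^ _); rewrite /p; field.
have -> : (\int[lam m]_z \int[mu]_b ((`|b| ^+ m)%:E * (H (cone m b z))%:E) =
    \int[lam m]_z ((2 * C0)%:E * (V z `^ (- (n%:R / 2)))%:E))%E.
  apply: eq_integral => z _.
  have mI : measurable_fun setT (fun b : mT => (`|b| ^+ m)%:E * (H (cone m b z))%:E)%E.
    apply: emeasurable_funM.
      by apply/measurable_EFinP; apply: measurable_funX; exact: normr_measurable.
    apply/measurable_EFinP; apply: (measurableT_comp mH); exact: measurable_cone_r.
  rewrite integralT_even//; last first.
    move=> b; rewrite normrN /H !sqnorm_cone sqrrN//.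
  transitivity (2%:E * \int[mu]_(b in `]0%R, +oo[) ((V z `^ (- (p / 2)))%:E *
      (Num.min 1 (b ^+ 2 * V z) * b `^ (- (1 + 2 * s)))%:E))%E.
    apply: (congr1 (mule 2%:E)); apply: eq_integral => b.
    rewrite inE/= in_itv/= andbT => b0.
    rewrite (gtr0_norm b0) /H sqnorm_cone -/(V z) -!EFinM; congr EFin.
    by rewrite mulrCA powR_cone//; ring.
  rewrite ge0_integralZl//=; last 3 first.
  - by apply: measurable_funTS; exact: measurable_min1_ray.
  - move=> b _; rewrite lee_fin mulr_ge0 ?powR_ge0// le_min ler01 mulr_ge0 ?sqr_ge0//.
    exact: ltW.
  - by rewrite lee_fin powR_ge0.
  rewrite integral_min1_ray// -!EFinM -VE -/C0; congr EFin; ring.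
rewrite ge0_integralZl//=; last 3 first.
- apply/measurable_EFinP; apply: measurable_fun_powR; apply: measurable_funD => //.
  exact: measurable_sqnorm.
- by move=> z _; rewrite lee_fin powR_ge0.
- by rewrite lee_fin mulr_ge0.
by rewrite integral_V -EFinM ltry.
Qed.

(** Each ray contributes V^(-p/2) V^s B = B V^(-n/2), a quantity without any trace of [x]; the
    integral over slopes and the doubling of half-lines give the constant. *)
Lemma integral_pospow_difference :
  (\int[lam n]_t (F t)%:E = (2 * (Gamma s * Gamma (1 - s)) * (pi `^ (n%:R / 2) / Gamma (n%:R / 2)))%:E)%E.
Proof.
pose B := Gamma s * Gamma (1 - s).
have B0 : 0 <= B by rewrite mulr_ge0// ltW// Gamma_gt0// subr_gt0.
have VE z : V z `^ (- (p / 2)) * V z `^ s = V z `^ (- (n%:R / 2)).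
  rewrite -powRD; last by rewrite (gt_eqF (V0 z)) implybT.
  by congr (_ `^ _); rewrite /p; field.
have mV : measurable_fun setT (fun z => V z `^ (- (n%:R / 2))).
  apply: measurable_fun_powR; apply: measurable_funD => //; exact: measurable_sqnorm.
have Fe t : F (scale_tuple _ (-1) t) = F t.
  rewrite !FE sqnorm_scale sqrrN expr1n mul1r row_scale scaleN1r.
  by rewrite G_even.
have h0 z : 0 <= B * V z `^ (- (n%:R / 2)) by rewrite mulr_ge0// powR_ge0.
have Fh z : (\int[mu]_(b in `]0%R, +oo[) (b ^+ m * F (cone m b z))%:E =
    (B * V z `^ (- (n%:R / 2)))%:E)%E.
  pose d := dot (row_of_tuple n (cone m 1 z)).
  transitivity (\int[mu]_(b in `]0%R, +oo[) ((V z `^ (- (p / 2)))%:E *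
    ((2 * pospow c s - pospow (c - 2 * b * d - b ^+ 2 * V z) s
     - pospow (c + 2 * b * d - b ^+ 2 * V z) s) * b `^ (- (1 + 2 * s)))%:E))%E.
    apply: eq_integral => b; rewrite inE/= in_itv/= andbT => b0.
    by rewrite F_cone.
  rewrite integralZl//=; last exact: integrable_ray.
  by rewrite integral_ray// -EFinM; congr EFin; rewrite [LHS]mulrA VE mulrC.
have mh : measurable_fun setT (fun z => B * V z `^ (- (n%:R / 2))) by exact: measurable_funM.
apply: (etrans (integral_cone m F _ measurable_F Fe mh h0 Fh F_integrable)).
under eq_integral do rewrite EFinM.
rewrite ge0_integralZl//=; last 2 first.
- exact/measurable_EFinP.
- by move=> z _; rewrite lee_fin powR_ge0.
by rewrite integral_V -!EFinM; congr EFin; exact: mulrA.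
Qed.

Lemma fraclap_pospow k : fraclap s (fun y => k * pospow (r ^+ 2 - enorm (y - x0) ^+ 2) s) x =
  (fraclap_cst n s * k * (Gamma s * Gamma (1 - s)) * (pi `^ (n%:R / 2) / Gamma (n%:R / 2)))%:E.
Proof.
rewrite /fraclap /integral_rV.
transitivity ((fraclap_cst n s / 2)%:E * \int[lam n]_t (k%:E * (F t)%:E))%E.
  congr (_ * _)%E; apply: eq_integral => t _; rewrite -EFinM; congr EFin.
  by rewrite -/(row_of_tuple n t) /F /G [RHS]mulrA !mulrBr [k * (2 * _)]mulrCA.
rewrite integralZl//=; last first.
  by apply: fin_num_integrable => //; [exact/measurable_EFinP|rewrite integral_pospow_difference].
rewrite integral_pospow_difference -!EFinM; congr EFin.
by move: (fraclap_cst n s) (Gamma s * _) (pi `^ _ / _) => C b q; field.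
Qed.

End fraclap_pospow.

(** * Uniqueness *)

Section cubes.
Context {R : realType} {n : nat}.
Notation mT := (measurableTypeR R).
Notation lam := (lebesgue_tuple R).
Variables (a : 'I_n -> R) (l : R).
Hypothesis l0 : 0 < l.

Let cube : set (n.-tuple mT) := [set t | forall i, `[a i, a i + l]%classic (tnth t i)].

Lemma measurable_cube : measurable cube.
Proof.
rewrite (_ : cube = \bigcap_(i in [set: 'I_n])
  ((fun t : n.-tuple mT => tnth t i) @^-1` `[a i, a i + l]%classic)).
  apply: fin_bigcap_measurable => // i _; rewrite -[X in measurable X]setTI.
  exact: measurable_tnth.
by apply/seteqP; split => t /= H i; [move=> _|]; exact: H.
Qed.

Lemma lebesgue_tuple_cube : lam n cube = (l ^+ n)%:E.
Proof.
have -> := @lebesgue_tuple_box R n (fun i => `[a i, a i + l]%classic) (fun=> measurable_itv _).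
under eq_bigr => i _.
  rewrite lebesgue_measure_itv/= lte_fin ltrDl l0 -EFinB addrAC subrr add0r.
  over.
by rewrite prodEFin prodr_const card_ord.
Qed.

End cubes.

Section bounded_support.
Context {R : realType} {n : nat}.
Notation mT := (measurableTypeR R).
Notation lam := (lebesgue_tuple R).

Lemma eball_cube (x0 x : 'rV[R]_n) r i : eball x0 r x -> `|x ord0 i - x0 ord0 i| <= r.
Proof. by move=> /ltW; apply: le_trans; have := coord_le_enorm (x - x0) i; rewrite !mxE. Qed.

(** The weight is at least 1, so the integrand is dominated by [M] on a cube of side 2r around the
    ball and vanishes elsewhere. *)
Lemma bounded_support_integral (x0 : 'rV[R]_n) (r s M : R) (u : 'rV[R]_n -> R) : 0 < r ->
  continuous u -> (forall x, `|u x| <= M) -> (forall x, ~ eball x0 r x -> u x = 0) ->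
  (integral_rV (fun x => (`|u x| / (1 + enorm x `^ (n%:R + 2 * s)))%:E) < +oo)%E.
Proof.
move=> r0 cu uM u0; rewrite /integral_rV.
pose a i := x0 ord0 i - r.
pose cube : set (n.-tuple mT) := [set t | forall i, `[a i, a i + 2 * r]%classic (tnth t i)].
have mcube : measurable cube by exact: measurable_cube.
have M0 : 0 <= M by apply: le_trans (uM 0).
have d1 (x : 'rV[R]_n) : 1 <= 1 + enorm x `^ (n%:R + 2 * s) by rewrite lerDl powR_ge0.
have d0 (x : 'rV[R]_n) : 0 < 1 + enorm x `^ (n%:R + 2 * s) by exact: lt_le_trans (d1 x).
apply: (@le_lt_trans _ _ (\int[lam n]_t (M%:E * (\1_cube t)%:E))%E).
  apply: ge0_le_integral => //.
  - by move=> t _; rewrite lee_fin divr_ge0// ltW.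
  - apply/measurable_EFinP; apply: measurable_funM.
      apply: measurableT_comp => //; exact: continuous_measurable_row.
    apply: measurable_fun_inv; apply: measurable_funD => //; apply: measurable_fun_powR.
    exact: (continuous_measurable_row n (@enorm R n) continuous_enorm).
  - by apply: emeasurable_funM => //; apply/measurable_EFinP; exact: measurable_indic.
  - move=> t _; rewrite -EFinM lee_fin -/(row_of_tuple n t).
    have [tb|tb] := pselect (eball x0 r (row_of_tuple n t)); last first.
      by rewrite u0// normr0 mul0r mulr_ge0// indicE.
    rewrite indicE mem_set ?mulr1; last first.
      move=> i; have := eball_cube _ _ _ i tb.
      by rewrite mxE ler_norml /= in_itv/= /a => /andP[h1 h2]; apply/andP; split; lra.
    rewrite ler_pdivrMr// (le_trans (uM _))// ler_peMr//.
rewrite ge0_integralZl//=; last by apply/measurable_EFinP; exact: measurable_indic.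
rewrite integral_indic// setIT.
rewrite [X in (_ * X)%E](_ : _ = ((2 * r) ^+ n)%:E); first by rewrite -EFinM ltry.
by apply: lebesgue_tuple_cube; rewrite mulr_gt0.
Qed.

End bounded_support.

(** * Comparison of two solutions *)

Section uniqueness.
Context {R : realType} {m : nat}.
Notation n := m.+1.
Notation mT := (measurableTypeR R).
Notation lam := (lebesgue_tuple R).
Variables (s : R) (x0 : 'rV[R]_n) (r : R).
Hypotheses (s0 : 0 < s) (s1 : s < 1) (r0 : 0 < r).

Lemma fraclap_cst_gt0 : 0 < fraclap_cst n s.
Proof.
rewrite /fraclap_cst divr_gt0// mulr_gt0// ?powR_gt0 ?pi_gt0//.
- by rewrite mulr_gt0// powR_gt0.
- by rewrite Gamma_gt0// divr_gt0// addr_gt0// mulr_gt0.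
- by rewrite Gamma_gt0// subr_gt0.
Qed.

Let quotient (u : 'rV[R]_n -> R) x (t : n.-tuple mT) : R :=
  (2 * u x - u (x + row_of_tuple n t) - u (x - row_of_tuple n t)) / enorm (row_of_tuple n t) `^ (n%:R + 2 * s).

(** The constant of the operator is positive and finite, so an infinite integral would make the
    fractional Laplacian infinite; the equation thus carries the convergence of the integral. *)
Let integral_quotient u x : fraclap s u x = 1%:E ->
  (\int[lam n]_t (quotient u x t)%:E = (2 / fraclap_cst n s)%:E)%E.
Proof.
have C0 := fraclap_cst_gt0.
have C20 : 0 < fraclap_cst n s / 2 by rewrite divr_gt0.
rewrite /fraclap /integral_rV -/(quotient u x).
case: (integral _ _ _) => [q| |].
- rewrite -EFinM => -[] <-; congr EFin; field.
  by rewrite gt_eqF.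
- by rewrite gt0_muley ?lte_fin.
- by rewrite gt0_muleNy ?lte_fin.
Qed.

(* At a positive maximum of [u - v] the integrand of the difference of the two
   fractional Laplacians is nonnegative, and positive away from the ball. *)
Lemma solution_comparison u v : dirichlet_solution s x0 r u -> dirichlet_solution s x0 r v ->
  forall x, u x <= v x.
Proof.
move=> [cu _ _ Lu u0] [cv _ _ Lv v0] y; rewrite leNgt; apply/negP => vuy.
pose d (x : 'rV[R]_n) := u x - v x.
(* A closed cube containing the open ball, compact as a product of segments. As [d] vanishes off the
   ball, a positive maximum over the cube is global and attained in the ball. *)
pose K : set 'rV[R]_n := [set x | forall i, `[x0 ord0 i - r, x0 ord0 i + r]%classic (x ord0 i)].
have cK : compact K.
  have := @rV_compact R n (fun i => `[x0 ord0 i - r, x0 ord0 i + r]%classic); apply => i.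
  exact: segment_compact.
have ballK x : eball x0 r x -> K x.
  move=> xr i; have := eball_cube _ _ _ i xr.
  by rewrite ler_norml /= in_itv/= => /andP[h1 h2]; apply/andP; split; lra.
have d0 x : ~ eball x0 r x -> d x = 0 by move=> xr; rewrite /d u0// v0// subrr.
have dy : 0 < d y by rewrite subr_gt0.
have yr : eball x0 r y by apply: contrapT => /d0 dy0; rewrite dy0 ltxx in dy.
have cd : continuous d by move=> x; apply: continuousB; [exact: cu|exact: cv].
have [||c _ cmax] := @compact_EVT_max _ R d K _ cK.
- by exists y; exact: ballK.
- exact: continuous_subspaceT.
have dc : 0 < d c by apply: lt_le_trans dy _; apply: cmax; apply/mem_set; exact: ballK.
have dmax z : d z <= d c.
  have [zr|zr] := pselect (eball x0 r z); last by rewrite d0// ltW.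
  by apply: cmax; apply/mem_set; exact: ballK.
have cr : eball x0 r c by apply: contrapT => /d0 dc0; rewrite dc0 ltxx in dc.
pose q t := quotient u c t - quotient v c t.
have mqu : measurable_fun setT (quotient u c) by exact: measurable_second_difference.
have mqv : measurable_fun setT (quotient v c) by exact: measurable_second_difference.
have qE t : q t = (2 * d c - d (c + row_of_tuple n t) - d (c - row_of_tuple n t)) /
    enorm (row_of_tuple n t) `^ (n%:R + 2 * s).
  by rewrite /q /quotient /d -mulrBl; congr (_ * _); ring.
have q0 t : 0 <= q t.
  rewrite qE divr_ge0 ?powR_ge0//.
  have := dmax (c + row_of_tuple n t); have := dmax (c - row_of_tuple n t).
  by move: (d c) (d _) (d _) => a b e; lra.
(* Both integrals are finite and equal, so the difference may be integrated term by term. *)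
have Iq : (\int[lam n]_t (q t)%:E = 0)%E.
  have iu := integral_quotient u c (Lu c cr); have iv := integral_quotient v c (Lv c cr).
  under eq_integral do rewrite /q EFinB.
  rewrite integralB_EFin//; last 2 first.
  - by apply: fin_num_integrable => //; [exact/measurable_EFinP|rewrite iu].
  - by apply: fin_num_integrable => //; [exact/measurable_EFinP|rewrite iv].
  by rewrite iu iv -EFinB subrr.
(* The first coordinate of [c] is within [r] of that of [x0], so a shift by at least 3r either way
   leaves the ball. On this cube the quotient is therefore 2 d(c)/|y|^(n+2s), and |y| <= L gives the
   lower bound [e]. *)
pose cube : set (n.-tuple mT) := [set t | forall i, `[3 * r, 3 * r + r]%classic (tnth t i)].
have mcube : measurable cube by exact: (measurable_cube (fun=> 3 * r)).
pose L := Num.sqrt (n%:R * (4 * r) ^+ 2).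
have p0 : 0 <= n%:R + 2 * s by rewrite addr_ge0// mulr_ge0// ltW.
have L0 : 0 < L by rewrite sqrtr_gt0 mulr_gt0// exprn_gt0// mulr_gt0.
pose e := 2 * d c / L `^ (n%:R + 2 * s).
have e0 : 0 < e by rewrite divr_gt0 ?powR_gt0// mulr_gt0.
have qcube t : cube t -> e <= q t.
  move=> ct; have t0 := ct ord0; rewrite /= in_itv/= in t0.
  have := eball_cube _ _ _ ord0 cr; rewrite ler_norml => /andP[c1 c2].
  have outside z : (z = 1 \/ z = -1) -> d (c + z *: row_of_tuple n t) = 0.
    move=> hz; apply: d0 => /(eball_cube _ _ _ ord0); rewrite !mxE ler_norml => /andP[h1 h2].
    by case: hz h1 h2 => ->; move/andP : t0 (r0); lra.
  have o1 := outside 1 (or_introl erefl); have o2 := outside (-1) (or_intror erefl).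
  rewrite scale1r in o1; rewrite scaleN1r in o2.
  rewrite qE o1 o2 !subr0 /e ler_wpM2l//; first by rewrite mulr_ge0// ltW.
  have tpos : 0 < enorm (row_of_tuple n t).
    apply: lt_le_trans (coord_le_enorm _ ord0); rewrite mxE normr_gt0.
    by apply/eqP => tz; move: t0 (r0); rewrite tz; lra.
  rewrite lef_pV2 ?posrE ?powR_gt0// ge0_ler_powR ?nnegrE ?enorm_ge0 ?(ltW L0)//.
  rewrite /L enormE ler_wsqrtr// enorm_row_of_tuple /sqnorm.
  have -> : n%:R * (4 * r) ^+ 2 = \sum_(i < n) (4 * r) ^+ 2 by rewrite sumr_const card_ord mulr_natl.
  apply: ler_sum => i _; have := ct i; rewrite /= in_itv/= => /andP[h1 h2].
  have ti0 : 0 <= tnth t i by move: h1 (r0); lra.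
  have r40 : 0 <= 4 * r by rewrite mulr_ge0// ltW.
  by rewrite ler_pXn2r//; move: h2; lra.
have : (\int[lam n]_(t in cube) (cst e%:E t) <= 0)%E.
  rewrite -Iq; apply: (@le_trans _ _ (\int[lam n]_(t in cube) (q t)%:E)%E).
    apply: ge0_le_integral => //.
    - by move=> t _; rewrite lee_fin ltW.
    - by apply: measurable_funTS; apply/measurable_EFinP; exact: measurable_funB.
  apply: ge0_subset_integral => //; first by apply/measurable_EFinP; exact: measurable_funB.
  by move=> t _; rewrite lee_fin.
rewrite integral_cst// [X in (_ * X)%E](_ : _ = (r ^+ n)%:E); last exact: lebesgue_tuple_cube.
rewrite -EFinM lee_fin leNgt.
by rewrite mulr_gt0// exprn_gt0.
Qed.

End uniqueness.

(** The left side is the value of [fraclap_pospow] for the factor of the theorem. With 4^s = 2^(2s)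
    and Gamma (s + 1) = s Gamma s every factor cancels, positivity of [Gamma] making the divisions
    legitimate. *)
Lemma fraclap_cst_normalization (R : realType) (m : nat) (s : R) : 0 < s -> s < 1 ->
  fraclap_cst m.+1 s * (Gamma (m.+1%:R / 2) / (4 `^ s * Gamma ((m.+1%:R + 2 * s) / 2) * Gamma (s + 1))) *
  (Gamma s * Gamma (1 - s)) * (pi `^ (m.+1%:R / 2) / Gamma (m.+1%:R / 2)) = 1 :> R.
Proof.
move=> s0 s1; rewrite /fraclap_cst (GammaS s s0).
have -> : 4 `^ s = 2 `^ (2 * s) :> R by rewrite powRrM powR_mulrn// -natrX.
have G1 : 0 < Gamma (m.+1%:R / 2 : R) by rewrite Gamma_gt0// divr_gt0.
have G2 : 0 < Gamma ((m.+1%:R + 2 * s) / 2) by rewrite Gamma_gt0// divr_gt0// addr_gt0// mulr_gt0.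
have G3 : 0 < Gamma s by exact: Gamma_gt0.
have G4 : 0 < Gamma (1 - s) by rewrite Gamma_gt0// subr_gt0.
have P : 0 < (pi : R) `^ (m.+1%:R / 2) by rewrite powR_gt0// pi_gt0.
have T : 0 < (2 : R) `^ (2 * s) by rewrite powR_gt0.
move: (Gamma (m.+1%:R / 2)) (Gamma ((m.+1%:R + 2 * s) / 2)) (Gamma s) (Gamma (1 - s))
  (pi `^ (m.+1%:R / 2)) (2 `^ (2 * s)) G1 G2 G3 G4 P T => a b c d e f *.
by field; rewrite !gt_eqF.
Qed.

Theorem proposition13p1 (R : realType) (n : nat) (hn : (1 <= n)%N)
    (s : R) (hs0 : 0 < s) (hs1 : s < 1)
    (x0 : 'rV[R]_n) (r : R) (hr : 0 < r) :
  unique (@dirichlet_solution R n s x0 r)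
    (fun x : 'rV[R]_n => Gamma (n%:R / 2) /
           (4 `^ s * Gamma ((n%:R + 2 * s) / 2) * Gamma (s + 1)) *
         pospow (r ^+ 2 - enorm (x - x0) ^+ 2) s).
Proof.
case: n hn x0 => // m _ x0.
set k := Gamma (m.+1%:R / 2) / _.
suff solk : dirichlet_solution s x0 r (fun x => k * pospow (r ^+ 2 - enorm (x - x0) ^+ 2) s).
  (* Comparison in both directions gives equality with any other solution. *)
  split => // v solv; apply/funext => x; apply/eqP; rewrite eq_le.
  apply/andP; split.
    exact: (solution_comparison s x0 r hs0 hs1 hr _ _ solk solv).
  exact: (solution_comparison s x0 r hs0 hs1 hr _ _ solv solk).
have cu := continuous_pospow_rho s x0 r hs0 k.
have u0 x : ~ eball x0 r x -> k * pospow (r ^+ 2 - enorm (x - x0) ^+ 2) s = 0.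
  by move=> xr; rewrite (pospow_outside s x0 r) ?mulr0.
split => //.
- apply: (bounded_support_integral x0 r s (`|k| * pospow (r ^+ 2) s)) => // x.
  rewrite normrM (ger0_norm (pospow_ge0 _ _)) ler_wpM2l//.
  by apply: ler_pospow; [exact: ltW|rewrite gerBl sqr_ge0].
- exact: loc_regular_pospow.
- by move=> x xr; rewrite fraclap_pospow// fraclap_cst_normalization.
Qed.
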